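(* Let $1\le p<\infty$. Then every weakly hypercyclic bilateral weighted shift acting on $\ell_p(\mathbb{Z})$ is hypercyclic if and only if $p<2$. Moreover, every weakly supercyclic bilateral weighted shift acting on $\ell_p(\mathbb{Z})$ is supercyclic if and only if $p\le 2$.
   Context: All spaces are complex. Given a bounded sequence $\{w_n\}_{n\in\mathbb{Z}}$ in $\mathbb{C}\setminus\{0\}$ (the weight sequence), the bilateral weighted shift $T$ on $\ell_p(\mathbb{Z})$ is the bounded linear operator defined on the canonical basis $\{e_n\}_{n\in\mathbb{Z}}$ by $Te_n=w_ne_{n-1}$. For a bounded linear operator $T$ on a Banach space $\mathcal{B}$ and $x\in\mathcal{B}$ put $O(T,x)=\{T^nx:n=0,1,2,\dots\}$ and $O_{\rm pr}(T,x)=\{\lambda T^nx:n=0,1,2,\dots,\ \lambda\in\mathbb{C}\}$. $T$ is hypercyclic (weakly hypercyclic) if $O(T,x)$ is norm dense (weakly dense) in $\mathcal{B}$ for some $x$; $T$ is supercyclic (weakly supercyclic) if $O_{\rm pr}(T,x)$ is norm dense (weakly dense) in $\mathcal{B}$ for some $x$. *)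

(* Defs.v *)
From HB Require Import structures.
From mathcomp Require Import all_boot all_order all_algebra.
From mathcomp Require Import complex.
From mathcomp Require Import all_classical all_reals all_analysis.
From mathcomp Require Import ring.

Set Implicit Arguments.
Unset Strict Implicit.
Unset Printing Implicit Defensive.
Import Order.TTheory GRing.Theory Num.Theory.
Import numFieldNormedType.Exports.
Import ComplexField.Normc.

Local Open Scope classical_set_scope.
Local Open Scope ring_scope.
Local Open Scope complex_scope.

Section orbits.
Variables (K : numFieldType) (V : normedModType K).

(* The coarsest topology on V making every functional of the
   topological dual of V continuous. *)
Definition weak_topology : topologicalType :=
  sup_topology (fun f : {f : {linear V -> K^o} | continuous f} =>
    Topological.class (initial_topology (sval f))).

Definition weakly_dense (A : set V) := dense (A : set weak_topology).

Definition op_orbit (T : V -> V) (x : V) : set V :=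
  [set iter n T x | n in [set: nat]].

Definition projective_orbit (T : V -> V) (x : V) : set V :=
  [set y | exists (l : K) (n : nat), y = l *: iter n T x].

Definition hypercyclic (T : V -> V) := exists x, dense (op_orbit T x).

Definition weakly_hypercyclic (T : V -> V) :=
  exists x, weakly_dense (op_orbit T x).

Definition supercyclic (T : V -> V) := exists x, dense (projective_orbit T x).

Definition weakly_supercyclic (T : V -> V) :=
  exists x, weakly_dense (projective_orbit T x).

End orbits.

Section lp_sums.
Variables (R : realType) (p : R).
Implicit Types (x y : int -> R[i]).

Definition lpsum x : \bar R := \esum_(n in [set: int]) (normc (x n) `^ p)%:E.

Definition lpseq : {pred int -> R[i]} := [pred x | (lpsum x < +oo)%E].

Definition lpnorm x : R := fine (lpsum x) `^ p^-1.

End lp_sums.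

(* The proof that 1 <= p is a parameter of the type, so that the norm
   instance below can depend on it. *)
Record lp (R : realType) (p : R) (p1 : 1 <= p) :=
  Lp { lpval :> int -> R[i]; _ : lpval \in lpseq p }.

Section lp_theory.
Variables (R : realType) (p : R) (p1 : 1 <= p).
Implicit Types (x y : int -> R[i]).

Local Lemma p0 : 0 < p. Proof. exact: lt_le_trans p1. Qed.
#[local] Hint Resolve p0 : core.

Local Lemma pN0 : p != 0. Proof. by rewrite gt_eqF. Qed.
#[local] Hint Resolve pN0 : core.

Lemma normc_ge0 (z : R[i]) : 0 <= normc z.
Proof. by case: z => a b; exact: sqrtr_ge0. Qed.

Lemma normcE (z : R[i]) : `|z| = (normc z)%:C. Proof. by []. Qed.

Lemma ler_normcD (z w : R[i]) : normc (z + w) <= normc z + normc w.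
Proof. by rewrite -lecR rmorphD -!normcE ler_normD. Qed.

Lemma lpsum_ge0 x : (0 <= lpsum p x)%E.
Proof. by apply: esum_ge0 => n _; rewrite lee_fin powR_ge0. Qed.

Lemma le_lpsum x n : ((normc (x n) `^ p)%:E <= lpsum p x)%E.
Proof.
apply: esum_ge; exists [set n]; first by split; [exact: finite_set1|].
by rewrite fsbig_set1.
Qed.

Lemma ge0_esumZl_le (a : int -> \bar R) (c : R) :
  0 <= c -> (forall n, 0 <= a n)%E ->
  (\esum_(n in [set: int]) (c%:E * a n) <= c%:E * \esum_(n in [set: int]) a n)%E.
Proof.
move=> c0 a0; apply: ge_ereal_sup => _ [A [fA AT] <-].
rewrite -ge0_mule_fsumr//; apply: lee_wpmul2l => //.
by apply: ereal_sup_ubound; exists A.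
Qed.

Lemma lpsumZ_le (c : R[i]) x :
  (lpsum p (fun n => (c * x n)%R) <= (normc c `^ p)%:E * lpsum p x)%E.
Proof.
apply: le_trans (ge0_esumZl_le (powR_ge0 _ _) _); last first.
  by move=> n; rewrite lee_fin powR_ge0.
by apply: le_esum => n _; rewrite -EFinM normcM powRM ?normc_ge0.
Qed.

Lemma lpsumZ (c : R[i]) x :
  lpsum p (fun n => c * x n) = ((normc c `^ p)%:E * lpsum p x)%E.
Proof.
have [->|c0] := eqVneq c 0.
  rewrite normc0 powR0// mul0e; apply: esum1 => n _.
  by rewrite mul0r normc0 powR0.
have nc0 : 0 < normc c.
  rewrite lt0r normc_ge0 andbT; apply: contra c0 => /eqP h.
  by apply/eqP/eq0_normc.
apply/eqP; rewrite eq_le lpsumZ_le/=.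
have := lpsumZ_le c^-1 (fun n => c * x n).
under [X in lpsum p X]eq_fun do rewrite mulrA mulVf// mul1r.
rewrite normcV => h.
apply: (le_trans (lee_wpmul2l (_ : (0 <= (normc c `^ p)%:E)%E) h)).
  by rewrite lee_fin powR_ge0.
rewrite muleA -EFinM -powRM ?invr_ge0 ?normc_ge0// divff ?gt_eqF//.
by rewrite powR1 mul1e.
Qed.

Lemma lpsumZ_fin (c : R[i]) x : (lpsum p x < +oo)%E ->
  (lpsum p (fun n => (c * x n)%R) < +oo)%E.
Proof.
by move=> xoo; rewrite lpsumZ lte_mul_pinfty// ?lee_fin ?powR_ge0.
Qed.

Lemma powR_convex (a b u v : R) : 0 < a -> 0 < b -> 0 <= u -> 0 <= v ->
  (u + v) `^ p <=
  (a + b) `^ p * (a / (a + b) * (u / a) `^ p + b / (a + b) * (v / b) `^ p).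
Proof.
move=> a0 b0 u0 v0; have ab0 : 0 < a + b by rewrite addr_gt0.
have t0 : 0 <= a / (a + b) by rewrite divr_ge0// ltW.
have t1 : a / (a + b) <= 1 by rewrite ler_pdivrMr// mul1r lerDl ltW.
have tE : unstable.onem (a / (a + b)) = b / (a + b).
  by rewrite /unstable.onem -[X in X - _](@divff _ (a + b)) ?gt_eqF// -mulrBl addrC addKr.
have ua0 : 0 <= u / a by rewrite divr_ge0 ?(ltW a0).
have vb0 : 0 <= v / b by rewrite divr_ge0 ?(ltW b0).
have h : (a / (a + b) * (u / a) + b / (a + b) * (v / b)) `^ p <=
    a / (a + b) * (u / a) `^ p + b / (a + b) * (v / b) `^ p.
  rewrite -tE; have := @convex_powR R p p1 (Itv01 t0 t1) (u / a) (v / b).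
  by rewrite !inE/= !in_itv/= !andbT => /(_ ua0 vb0).
have w0 : 0 <= a / (a + b) * (u / a) + b / (a + b) * (v / b).
  by rewrite addr_ge0// mulr_ge0 ?divr_ge0// ltW.
rewrite -(ler_pM2l (powR_gt0 p ab0)) -(powRM p (ltW ab0) w0) in h.
apply: le_trans h; rewrite le_eqVlt; apply/orP; left; apply/eqP; congr (_ `^ _).
by field; rewrite !gt_eqF.
Qed.

Lemma lpsum_lpnorm x : (lpsum p x < +oo)%E -> lpsum p x = (lpnorm p x `^ p)%:E.
Proof.
move=> xoo; rewrite /lpnorm -powRrM mulVf// powRr1.
  by rewrite fineK// ge0_fin_numE// lpsum_ge0.
by rewrite fine_ge0// lpsum_ge0.
Qed.

Lemma lpnorm_ge0 x : 0 <= lpnorm p x. Proof. exact: powR_ge0. Qed.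

Lemma lpnorm_eq0 x : (lpsum p x < +oo)%E -> lpnorm p x = 0 -> x = fun=> 0.
Proof.
move=> xoo x0; apply/funext => n; apply: eq0_normc.
have := le_lpsum x n; rewrite lpsum_lpnorm// x0 powR0// lee_fin => h.
by apply: (@powR_eq0_eq0 _ _ p); apply/eqP; rewrite eq_le h powR_ge0.
Qed.

Lemma lpnormZ (c : R[i]) x : (lpsum p x < +oo)%E ->
  lpnorm p (fun n => c * x n) = normc c * lpnorm p x.
Proof.
move=> xoo; rewrite /lpnorm lpsumZ fineM//; last first.
  by rewrite ge0_fin_numE// lpsum_ge0.
rewrite powRM ?powR_ge0//; last by rewrite fine_ge0// lpsum_ge0.
by rewrite -powRrM divff// powRr1// normc_ge0.
Qed.

Lemma minkowski_lpsum_gt0 x y (a b : R) : 0 < a -> 0 < b ->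
  lpsum p x = (a `^ p)%:E -> lpsum p y = (b `^ p)%:E ->
  (lpsum p (fun n => (x n + y n)%R) <= ((a + b) `^ p)%:E)%E.
Proof.
move=> x0 y0 Sx Sy.
have ab0 : 0 < a + b by rewrite addr_gt0.
pose s := (a + b) `^ p * (a / (a + b)) / a `^ p.
pose t := (a + b) `^ p * (b / (a + b)) / b `^ p.
have s0 : 0 <= s by rewrite !mulr_ge0 ?invr_ge0 ?powR_ge0 ?(ltW x0) ?(ltW ab0).
have t0 : 0 <= t by rewrite !mulr_ge0 ?invr_ge0 ?powR_ge0 ?(ltW y0) ?(ltW ab0).
apply: (@le_trans _ _ (\esum_(n in [set: int])
  (s%:E * (normc (x n) `^ p)%:E + t%:E * (normc (y n) `^ p)%:E))%E).
  apply: le_esum => n _; rewrite -!EFinM -EFinD lee_fin.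
  apply: (le_trans (ge0_ler_powR (ltW p0) _ _ (ler_normcD (x n) (y n)))).
  - by rewrite nnegrE normc_ge0.
  - by rewrite nnegrE addr_ge0 ?normc_ge0.
  apply: (le_trans (powR_convex x0 y0 (normc_ge0 _) (normc_ge0 _))).
  rewrite !powRM ?invr_ge0 ?normc_ge0 ?(ltW x0) ?(ltW y0)//.
  have powRV (c : R) : 0 < c -> c^-1 `^ p = (c `^ p)^-1.
    move=> c0; apply: (mulfI (lt0r_neq0 (powR_gt0 p c0))).
    rewrite -powRM ?invr_ge0 ?(ltW c0)// divff ?gt_eqF// powR1 divff//.
    by rewrite gt_eqF// powR_gt0.
  rewrite !powRV// /s /t le_eqVlt; apply/orP; left; apply/eqP.
  rewrite mulrDr; congr (_ + _); rewrite -!mulrA; congr (_ * (_ * (_ * _)));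
    exact: mulrC.
rewrite esumD; last 2 first.
- by move=> n _; rewrite -EFinM lee_fin mulr_ge0// powR_ge0.
- by move=> n _; rewrite -EFinM lee_fin mulr_ge0// powR_ge0.
apply: (@le_trans _ _ (s%:E * lpsum p x + t%:E * lpsum p y)%E).
  by apply: leeD; apply: ge0_esumZl_le => // n; rewrite lee_fin powR_ge0.
rewrite Sx Sy -!EFinM -EFinD lee_fin /s /t.
rewrite !divfK ?gt_eqF ?powR_gt0//.
by rewrite -mulrDr -mulrDl divff ?gt_eqF// mulr1.
Qed.

Lemma minkowski_lpsum x y :
  (lpsum p x < +oo)%E -> (lpsum p y < +oo)%E ->
  (lpsum p (fun n => (x n + y n)%R) <= ((lpnorm p x + lpnorm p y) `^ p)%:E)%E.
Proof.
move=> xoo yoo.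
have := lpnorm_ge0 x; rewrite le_eqVlt => /predU1P[/esym x0|x0].
  rewrite x0 add0r (lpnorm_eq0 xoo x0).
  by under [X in lpsum p X]eq_fun do rewrite add0r; rewrite lpsum_lpnorm.
have := lpnorm_ge0 y; rewrite le_eqVlt => /predU1P[/esym y0|y0].
  rewrite y0 addr0 (lpnorm_eq0 yoo y0).
  by under [X in lpsum p X]eq_fun do rewrite addr0; rewrite lpsum_lpnorm.
exact: minkowski_lpsum_gt0 x0 y0 (lpsum_lpnorm xoo) (lpsum_lpnorm yoo).
Qed.

Lemma lpsumD_fin x y : (lpsum p x < +oo)%E -> (lpsum p y < +oo)%E ->
  (lpsum p (fun n => (x n + y n)%R) < +oo)%E.
Proof.
by move=> xoo yoo; rewrite (le_lt_trans (minkowski_lpsum xoo yoo))// ltry.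
Qed.

Lemma ler_lpnormD x y : (lpsum p x < +oo)%E -> (lpsum p y < +oo)%E ->
  lpnorm p (fun n => x n + y n) <= lpnorm p x + lpnorm p y.
Proof.
move=> xoo yoo; have := minkowski_lpsum xoo yoo.
rewrite lpsum_lpnorm ?lpsumD_fin// lee_fin => h.
rewrite leNgt; apply/negP => /(gt0_ltr_powR p0).
rewrite !nnegrE addr_ge0 ?lpnorm_ge0// => /(_ isT isT).
by rewrite ltNge h.
Qed.

Lemma lpseq_submod_closed : submod_closed (lpseq p : {pred int -> R[i]}).
Proof.
split=> [|c x y]; rewrite !inE.
  rewrite /lpsum esum1 ?ltry// => n _.
  by rewrite [X in normc X](_ : _ = 0)// normc0 powR0.
by move=> xoo yoo; apply: lpsumD_fin => //; exact: lpsumZ_fin.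
Qed.

Lemma lpsum_delta (n : int) : lpsum p (fun k => (k == n)%:R) = 1%E.
Proof.
rewrite -(@esum_set1 R int n (fun=> 1%E))// esum_mkcond; apply: eq_esum => k _.
rewrite in_set1; case: eqP => _; first by rewrite normc1 powR1.
by rewrite normc0 powR0.
Qed.

Lemma lpseq_delta (n : int) : (fun k : int => (k == n)%:R) \in lpseq (R := R) p.
Proof. by rewrite inE lpsum_delta ltry. Qed.

HB.instance Definition _ := [isSub for @lpval R p p1].
HB.instance Definition _ := [Choice of lp p1 by <:].
#[local] HB.instance Definition _ :=
  GRing.isSubmodClosed.Build _ _ (lpseq p) lpseq_submod_closed.
HB.instance Definition _ := [SubChoice_isSubLmodule of lp p1 by <:].

Lemma lp_fin (x : lp p1) : (lpsum p x < +oo)%E.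
Proof. by have := valP x; rewrite inE. Qed.

Local Definition nrm (x : lp p1) : R[i] := (lpnorm p x)%:C.

Local Lemma nrmD (x y : lp p1) : nrm (x + y) <= nrm x + nrm y.
Proof. by rewrite /nrm -rmorphD lecR ler_lpnormD ?lp_fin. Qed.

Local Lemma nrmZ (c : R[i]) (x : lp p1) : nrm (c *: x) = `|c| * nrm x.
Proof. by rewrite normcE /nrm -rmorphM -lpnormZ ?lp_fin. Qed.

Local Lemma nrm_eq0 (x : lp p1) : nrm x = 0 -> x = 0.
Proof.
by move=> /complexI h; apply/val_inj; exact: lpnorm_eq0 (lp_fin x) h.
Qed.

HB.instance Definition _ := Lmodule_isNormed.Build R[i] (lp p1) nrmD nrmZ nrm_eq0.

Lemma lp_normE (x : lp p1) : `|x| = (lpnorm p x)%:C. Proof. by []. Qed.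

Definition lp_basis (n : int) : lp p1 := Lp p1 (lpseq_delta n).

(* Since the basis spans a dense subspace, a continuous linear T is determined
   by the weight sequence w. *)
Definition bilateral_weighted_shift (T : {linear lp p1 -> lp p1}) :=
  continuous T /\
  exists w : int -> R[i],
    [/\ exists M : R, forall n, normc (w n) <= M,
        forall n, w n != 0 &
        forall n, T (lp_basis n) = w n *: lp_basis (n - 1)].

End lp_theory.

(* Main.v *)
Require Import Defs.
From HB Require Import structures.
From mathcomp Require Import all_boot all_order all_algebra complex finmap.
From mathcomp Require Import all_classical all_reals all_analysis.
From mathcomp Require Import ring lra zify.

Set Implicit Arguments.
Unset Strict Implicit.
Unset Printing Implicit Defensive.
Import Order.TTheory GRing.Theory Num.Theory.
Import numFieldNormedType.Exports.
Import ComplexField.Normc.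
Local Open Scope classical_set_scope.
Local Open Scope ring_scope.

(** The orbit of x under a bilateral weighted shift T is read off from one
sequence b of nonzero scalars: coordinate j of T^n x is (b (j + n) / b j) times
x (j + n), and the quotients b (j + 1) / b j are bounded.

A sufficient condition for cyclicity ([block_criterion]).  If, on every finite
window around 0, both b (j + m) and b (j - m) can be made large for the same m
(up to a factor e and its inverse in the supercyclic case), then x can be built
as a sum of translates of the members of a dense family, placed at very distant
windows; the time that brings one block back to the origin makes all the others
small in norm.  Hence, if T is not hypercyclic, then for some r and every m one
of b (r + m), b (r - m) is bounded by a constant K; if T is not supercyclic, then
the product of their moduli is bounded by a constant.

Weak density implies norm density for small p.  Assume that the criterion fails
and that the orbit of x is weakly dense.  It suffices to find a continuous
functional F that kills the basis vector e_r and satisfies |F (T^n x)| >= 1 (in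
the supercyclic case, after division of T^n x by its coordinate r) for all n but
one among those that could come near a multiple of e_r: a weak neighbourhood of
such a multiple given by F, by the coordinate r and by one more coordinate then
misses the orbit.  Such an F comes from a plank theorem ([finite_plank],
[infinite_plank]): when h_n are finitely supported vectors with <h_n, y_n> = 1
whose norms in l_q have a summable sequence of squares, where 2 <= q <= 4 and
(p - 1)(q - 1) <= 1, some functional of finite norm is at least 1 in modulus on
every y_n.  For finitely many forms u_n this is proved by
maximizing sum_n g_n ln (1 + |u_n f|^2) - |f|_q^q: if |u_k f| < 1, then moving f
along z h_k, averaged over the four points z = t, -t, it, -it, raises the sum of
logarithms by more than it raises the penalty.  Infinitely many forms follow by
weak-star compactness.
- For p <= 2 and supercyclicity ([weakly_supercyclic_supercyclic]) take q = 2
  and for h_n a multiple of a single basis vector; the bound on the products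
  makes the sum of squares at most a multiple of the sum of |x_j|^2, which is
  finite because p <= 2.
- For p < 2 and hypercyclicity ([weakly_hypercyclic_hypercyclic]) take q = 4 - p.
  Call n relevant when |(T^n x)_r| > 1/2.  For two relevant times n and m, the
  bound K makes coordinate r + m - n of T^n x, or the same with n and m
  exchanged, larger than a fixed constant.  This is a tournament, so at most
  2 t + 1 relevant times have at most t large coordinates; spreading h_n equally
  over the large coordinates gives a convergent sum exactly because q > 2.

Counterexamples for large p.  With x a sum of blocks as above, but with gaps
chosen only for separation, T^n x at the return time of block k equals the
wanted vector plus the images of the other blocks.  Those that are not small
have disjoint supports for different k and p-th powers of norms O(k^(p - 1));
no functional of finite norm can stay away from 0 on them, because the harmonic
series diverges ([disjoint_weak_small]).  So they are weakly negligible along a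
subsequence.  For p >= 2 the weights 2 on the right half and
1 on the left half give a weakly hypercyclic T whose orbits cannot approach 0 in
norm; for p > 2 the unweighted shift is weakly supercyclic, and it is not
supercyclic, since scalar multiples of translates of one vector cannot be close
to both e_0 and e_0 + e_1. *)

(** * Inequalities for real powers *)

Section powR_inequalities.
Variable R : realType.
Implicit Types (a b e r s x y : R).

(** Bernoulli's inequality for exponents below 1, obtained from Young's inequality. *)
Lemma powR1D_le r x : 0 <= r <= 1 -> -1 <= x -> (1 + x) `^ r <= 1 + r * x.
Proof.
move=> /andP[r0 r1] x1; have x0 : 0 <= 1 + x by lra.
have [->|rN0] := eqVneq r 0; first by rewrite powRr0 mul0r addr0.
have [->|rN1] := eqVneq r 1; first by rewrite powRr1// mul1r.
have rgt0 : 0 < r by rewrite lt0r rN0.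
have rlt1 : r < 1 by rewrite lt_neqAle rN1.
have := @conjugate_powR R ((1 + x) `^ r) 1 r^-1 (1 - r)^-1 (powR_ge0 _ _) ler01.
rewrite !invr_gt0 !invrK subr_gt0 rgt0 rlt1 addrC subrK => /(_ isT isT erefl).
rewrite mulr1 -powRrM divff// powRr1// powR1 => h; apply: (le_trans h); lra.
Qed.

Lemma powR_splitB s x : 0 < s -> 0 <= x -> x `^ s = x * x `^ (s - 1).
Proof. by move=> s0 x0; rewrite mulr_powRB1. Qed.

Lemma powRD_le_tangent s a b : 1 <= s <= 2 -> 0 <= a -> 0 <= b ->
  (a + b) `^ s <= a `^ s + 2 * b * (a + b) `^ (s - 1).
Proof.
move=> /andP[s1 s2] a0 b0.
have sgt0 : 0 < s by lra.
have [->|aN0] := eqVneq a 0.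
  rewrite add0r powR0 ?gt_eqF// add0r powR_splitB// ler_wpM2r ?powR_ge0//; lra.
have agt0 : 0 < a by rewrite lt0r aN0.
have h : a * (a + b) `^ (s - 1) <= a `^ s + b * a `^ (s - 1).
  have -> : a + b = a * (1 + b / a) by rewrite mulrDr mulr1 mulrCA divff ?mulr1.
  rewrite powRM// ?addr_ge0 ?divr_ge0//.
  have h1 : (1 + b / a) `^ (s - 1) <= 1 + (s - 1) * (b / a).
    apply: powR1D_le; first by apply/andP; split; lra.
    by apply: le_trans (_ : 0 <= _); [lra|rewrite divr_ge0].
  rewrite (powR_splitB sgt0 a0) mulrA.
  apply: (le_trans (ler_wpM2l _ h1)); first by rewrite mulr_ge0 ?powR_ge0.
  rewrite mulrDr mulr1 lerD2l.
  have -> : a * a `^ (s - 1) * ((s - 1) * (b / a)) = (s - 1) * (b * a `^ (s - 1)).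
    by field.
  by rewrite ler_piMl ?mulr_ge0 ?powR_ge0//; lra.
rewrite (powR_splitB sgt0 (addr_ge0 a0 b0)) mulrDl.
have h2 : a `^ (s - 1) <= (a + b) `^ (s - 1).
  by apply: ge0_ler_powR; rewrite ?nnegrE; lra.
have := ler_wpM2l b0 h2; lra.
Qed.

(** Second order expansion with a remainder of the size of the square: averaged
over e and - e, the linear term disappears. *)
Lemma powRD_le_quad s a e : 1 <= s <= 2 -> 0 < a -> `|e| <= a ->
  (a + e) `^ s <= a `^ s + s * e * a `^ (s - 1) + e ^+ 2 / a * a `^ (s - 1).
Proof.
move=> /andP[s1 s2] a0 ea.
have sgt0 : 0 < s by lra.
have xm1 : -1 <= e / a.
  by rewrite ler_pdivlMr// mulN1r; move: ea; rewrite ler_norml => /andP[].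
have -> : a + e = a * (1 + e / a) by field; rewrite gt_eqF.
have x0 : 0 <= 1 + e / a by lra.
rewrite powRM// ?(ltW a0)// (powR_splitB sgt0 x0) (powR_splitB sgt0 (ltW a0)).
have h1 : (1 + e / a) `^ (s - 1) <= 1 + (s - 1) * (e / a).
  by apply: powR1D_le => //; apply/andP; split; lra.
apply: (@le_trans _ _ (a * a `^ (s - 1) *
    ((1 + e / a) * (1 + (s - 1) * (e / a))))).
  by rewrite ler_wpM2l ?mulr_ge0 ?powR_ge0 ?(ltW a0)// ler_wpM2l.
set P := a `^ (s - 1).
have -> : a * P * ((1 + e / a) * (1 + (s - 1) * (e / a))) =
  a * P + s * e * P + (s - 1) * (e ^+ 2 / a * P) by field; rewrite gt_eqF.
rewrite lerD2l ler_piMl//; last by lra.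
by rewrite mulr_ge0 ?powR_ge0// divr_ge0 ?sqr_ge0// ltW.
Qed.

(** Here a is |f|^2, d is |t h|^2, and the four bases are the values of |f + z h|^2
for z = t, -t, it, -it; the hypothesis on e1 and e2 comes from
Re(w)^2 + Im(w)^2 = |w|^2 for the cross term w. *)
Lemma powR_four_point s a d e1 e2 : 1 <= s <= 2 -> 0 <= a -> 0 <= d ->
  `|e1| <= a + d -> `|e2| <= a + d -> e1 ^+ 2 + e2 ^+ 2 <= 4 * d * (a + d) ->
  (a + d + e1) `^ s + (a + d - e1) `^ s + (a + d + e2) `^ s + (a + d - e2) `^ s
  <= 4 * a `^ s + 16 * d * (a + d) `^ (s - 1).
Proof.
move=> s12 a0 d0; set B := a + d => he1 he2 hq.
have sgt0 : 0 < s by lra.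
have := powRD_le_tangent s12 a0 d0; rewrite -/B => hB.
have [B0|BN0] := eqVneq B 0.
  have -> : e1 = 0 by apply/eqP; rewrite -normr_le0 -B0.
  have -> : e2 = 0 by apply/eqP; rewrite -normr_le0 -B0.
  rewrite !(addr0, subr0).
  have : 0 <= d * B `^ (s - 1) by rewrite mulr_ge0 ?powR_ge0.
  lra.
have Bgt0 : 0 < B by rewrite lt0r BN0 addr_ge0.
have h1 := powRD_le_quad s12 Bgt0 he1.
have h1' := @powRD_le_quad s B (- e1) s12 Bgt0; rewrite normrN in h1'.
have {}h1' := h1' he1.
have h2 := powRD_le_quad s12 Bgt0 he2.
have h2' := @powRD_le_quad s B (- e2) s12 Bgt0; rewrite normrN in h2'.
have {}h2' := h2' he2.
rewrite !sqrrN in h1' h2'.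
have h3 : (e1 ^+ 2 + e2 ^+ 2) / B * B `^ (s - 1) <= 4 * d * B `^ (s - 1).
  by rewrite ler_wpM2r ?powR_ge0// ler_pdivrMr.
rewrite !(mulrDl (e1 ^+ 2)) in h3; lra.
Qed.

(** Young's inequality with a free parameter l, which later balances the increment
of the penalty against the gain of one logarithm. *)
Lemma mulr_powR_le s l a b : 1 <= s -> 0 < l -> 0 <= a -> 0 <= b ->
  b * a `^ (s - 1) <= l * ((b / l) `^ s + a `^ s).
Proof.
move=> s1 l0 a0 b0; have sgt0 : 0 < s by lra.
have -> : b * a `^ (s - 1) = l * (b / l * a `^ (s - 1)).
  by field; rewrite gt_eqF.
rewrite ler_wpM2l ?(ltW l0)//.
have bl0 : 0 <= b / l by rewrite divr_ge0// ltW.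
have [h|h] := leP (b / l) a.
  apply: (@le_trans _ _ (a `^ s)); last by rewrite lerDr powR_ge0.
  by rewrite (powR_splitB sgt0 a0) ler_wpM2r// powR_ge0.
apply: (@le_trans _ _ ((b / l) `^ s)); last by rewrite lerDl powR_ge0.
rewrite (powR_splitB sgt0 bl0) ler_wpM2l// ge0_ler_powR ?nnegrE//; last exact: ltW.
by lra.
Qed.

Lemma powRD_le4 s a b : 1 <= s <= 2 -> 0 <= a -> 0 <= b ->
  (a + b) `^ s <= 4 * (a `^ s + b `^ s).
Proof.
move=> /andP[s1 s2] a0 b0.
have h2 : (2 : R) `^ s <= 4.
  have -> : (4 : R) = 2 `^ 2%:R by rewrite powR_mulrn// -natrX.
  by apply: ler_powR => //; lra.
have key x y : 0 <= x -> x <= y -> (x + y) `^ s <= 4 * y `^ s.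
  move=> x0 xy; have y0 := le_trans x0 xy.
  apply: (@le_trans _ _ ((2 * y) `^ s)).
    by rewrite ge0_ler_powR ?nnegrE; lra.
  by rewrite powRM// ler_wpM2r// powR_ge0.
have [ab|/ltW ba] := leP a b.
  apply: (le_trans (key _ _ a0 ab)); rewrite ler_wpM2l// ?lerDr ?powR_ge0//.
rewrite addrC; apply: (le_trans (key _ _ b0 ba)).
by rewrite ler_wpM2l// lerDl powR_ge0.
Qed.

Lemma ln_ge_frac x : 0 <= x -> x / (1 + x) <= ln (1 + x).
Proof.
move=> x0; have p : 0 < 1 + x by lra.
have -> : ln (1 + x) = - ln (1 + x)^-1 by rewrite lnV ?opprK.
have h : -1 < - (x / (1 + x)) by rewrite ltrN2 ltr_pdivrMr// mul1r ltrDr.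
have := le_ln1Dx h; have -> : 1 + - (x / (1 + x)) = (1 + x)^-1.
  by field; rewrite gt_eqF.
lra.
Qed.

Lemma powR_half_le (p : R) k : 1 <= p ->
  (2^-1 ^+ k : R) `^ p <= 2^-1 ^+ k.
Proof.
move=> p1; apply: ge1r_powR => //; apply/andP; split; first by rewrite exprn_gt0// invr_gt0.
by rewrite exprn_ile1 ?invr_ge0// invf_le1// ler1n.
Qed.

End powR_inequalities.

Section complex_modulus.
Variable R : realType.

Lemma normcR (a : R) : normc (a%:C)%C = `|a|.
Proof. by rewrite /= expr0n /= addr0 sqrtr_sqr. Qed.

Lemma normc_gt0 (z : R[i]) : z != 0 -> 0 < normc z.
Proof.
move=> z0; rewrite lt0r normc_ge0 andbT; apply: contra z0 => /eqP h.
by apply/eqP/eq0_normc.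
Qed.

Lemma normcB_ge (z w : R[i]) : normc w - normc (z - w) <= normc z.
Proof.
rewrite lerBlDr; have -> : w = z - (z - w) by ring.
by apply: (le_trans (ler_normcD _ _)); rewrite normcN opprD opprK addrA subrr add0r.
Qed.

Lemma normc_sum (J : eqType) (js : seq J) (F : J -> R[i]) :
  normc (\sum_(j <- js) F j) <= \sum_(j <- js) normc (F j).
Proof.
elim/big_ind2: _ => [|x a y b xa yb|//]; first by rewrite normc0.
by apply: (le_trans (ler_normcD _ _)); rewrite lerD.
Qed.

Lemma normc_sqr (a b : R) : normc (a +i* b)%C ^+ 2 = a ^+ 2 + b ^+ 2.
Proof. by rewrite /normc sqr_sqrtr// addr_ge0 ?sqr_ge0. Qed.

Lemma normc_sqrE (z : R[i]) : normc z ^+ 2 = complex.Re z ^+ 2 + complex.Im z ^+ 2.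
Proof. by case: z => a b; rewrite normc_sqr. Qed.

Lemma normRe_le (z : R[i]) : `|complex.Re z| <= normc z.
Proof.
case: z => a b /=; rewrite -sqrtr_sqr ler_wsqrtr// lerDl sqr_ge0 //.
Qed.

Lemma normIm_le (z : R[i]) : `|complex.Im z| <= normc z.
Proof.
case: z => a b /=; rewrite -sqrtr_sqr ler_wsqrtr// lerDr sqr_ge0 //.
Qed.

Lemma normc_le_ReIm (z : R[i]) : normc z <= `|complex.Re z| + `|complex.Im z|.
Proof.
rewrite -(@ler_pXn2r _ 2)// ?nnegrE ?normc_ge0 ?addr_ge0//.
rewrite normc_sqrE sqrrD !real_normK ?num_real// addrAC lerDl.
by rewrite mulrn_wge0// mulr_ge0.
Qed.

End complex_modulus.

(** * Averages over the four points of a circle on the axes *)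

Section circle_averages.
Variable R : realType.
Implicit Types (t s : R) (u f h z : R[i]).

(** Averaging over these four points cancels the first order term of a function
of |f + z h|^2, as averaging over a whole circle would. *)
Definition axis_points t : seq R[i] :=
  [:: (t +i* 0)%C; (- t +i* 0)%C; (0 +i* t)%C; (0 +i* - t)%C].

Lemma sum_axis t (F : R[i] -> R) : \sum_(z <- axis_points t) F z =
  F (t +i* 0)%C + F (- t +i* 0)%C + F (0 +i* t)%C + F (0 +i* - t)%C.
Proof. by rewrite /axis_points !big_cons big_nil addr0 !addrA. Qed.

Lemma normc_powR_sqr s z : normc z `^ (2 * s) = (normc z ^+ 2) `^ s.
Proof. by rewrite powRrM powR_mulrn// normc_ge0. Qed.

Lemma axis_normc_powR s t f h : 1 <= s <= 2 ->
  let d := t ^+ 2 * normc h ^+ 2 in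
  \sum_(z <- axis_points t) normc (f + z * h) `^ (2 * s) <=
  4 * normc f `^ (2 * s) + 16 * d * (normc f ^+ 2 + d) `^ (s - 1).
Proof.
move=> s12; rewrite /= sum_axis !normc_powR_sqr.
case: f => a b; case: h => c e; rewrite !normc_sqrE /=.
set A := a ^+ 2 + b ^+ 2; set D := t ^+ 2 * _.
have A0 : 0 <= A by rewrite addr_ge0 ?sqr_ge0.
have D0 : 0 <= D by rewrite mulr_ge0 ?addr_ge0 ?sqr_ge0.
set e1 := 2 * t * (a * c + b * e); set e2 := 2 * t * (b * c - a * e).
apply: (@le_trans _ _ ((A + D + e1) `^ s + (A + D - e1) `^ s +
    (A + D + e2) `^ s + (A + D - e2) `^ s)).
  rewrite le_eqVlt; apply/orP; left; apply/eqP.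
  by congr (_ `^ _ + _ `^ _ + _ `^ _ + _ `^ _); rewrite /A /D /e1 /e2; ring.
have ee : e1 ^+ 2 + e2 ^+ 2 = 4 * D * A by rewrite /e1 /e2 /A /D; ring.
have bnd x : x ^+ 2 <= 4 * D * A -> `|x| <= A + D.
  move=> hx; rewrite -(@ler_pXn2r _ 2)// ?nnegrE ?(addr_ge0 A0 D0)//.
  rewrite real_normK ?num_real//; apply: (le_trans hx); rewrite -subr_ge0.
  by rewrite (_ : _ - _ = (A - D) ^+ 2) ?sqr_ge0//; ring.
apply: powR_four_point => //.
- by apply: bnd; rewrite -ee lerDl sqr_ge0.
- by apply: bnd; rewrite -ee lerDr sqr_ge0.
- by rewrite ee; apply: ler_wpM2l; [rewrite mulr_ge0|rewrite lerDl].
Qed.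

(** The right-hand side is the product of the four numbers 1 + |u + z h|^2, where
A = 1 + |u|^2, H = |h|^2 and X, Y are the real and imaginary parts of the cross
term, whence X^2 + Y^2 = H (A - 1).  The product avoids expanding logarithms. *)
Lemma axis_prod_ge (A X Y H : R) t : 1 <= A -> 0 <= H -> X ^+ 2 + Y ^+ 2 = H * (A - 1) ->
  A ^+ 4 + (4 * (t ^+ 2 * H) - 2 * (t ^+ 2 * H) ^+ 2) * A ^+ 2 <=
  (A + t ^+ 2 * H + 2 * t * X) * (A + t ^+ 2 * H - 2 * t * X) *
  (A + t ^+ 2 * H + 2 * t * Y) * (A + t ^+ 2 * H - 2 * t * Y).
Proof.
move=> A1 H0 XY; set B := A + t ^+ 2 * H.
have tH : 0 <= t ^+ 2 * H by rewrite mulr_ge0 ?sqr_ge0.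
have AB : A <= B by rewrite lerDl.
have -> : (B + 2 * t * X) * (B - 2 * t * X) * (B + 2 * t * Y) * (B - 2 * t * Y) =
   B ^+ 4 - 4 * t ^+ 2 * B ^+ 2 * (X ^+ 2 + Y ^+ 2) + 16 * (t ^+ 2 * X * Y) ^+ 2.
  by ring.
rewrite XY; apply: (@le_trans _ _ (B ^+ 4 - 4 * t ^+ 2 * B ^+ 2 * (H * (A - 1)))); last first.
  by rewrite lerDl mulr_ge0 ?sqr_ge0.
have -> : B ^+ 4 - 4 * t ^+ 2 * B ^+ 2 * (H * (A - 1)) =
    (A ^+ 2 - (t ^+ 2 * H) ^+ 2) ^+ 2 + 4 * (t ^+ 2 * H) * B ^+ 2.
  by rewrite /B; ring.
have : A ^+ 2 <= B ^+ 2 by rewrite ler_pXn2r ?nnegrE//; lra.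
move: (t ^+ 2 * H) tH (B ^+ 2) => w w0 C AC.
have -> : (A ^+ 2 - w ^+ 2) ^+ 2 + 4 * w * C =
    A ^+ 4 + (4 * w - 2 * w ^+ 2) * A ^+ 2 + ((w ^+ 2) ^+ 2 + 4 * w * (C - A ^+ 2)).
  by ring.
by rewrite lerDl addr_ge0 ?sqr_ge0// !mulr_ge0// subr_ge0.
Qed.

Lemma ln_le_sum_axis t u h A w : A = 1 + normc u ^+ 2 ->
  w = t ^+ 2 * normc h ^+ 2 -> w <= 1 ->
  ln (A ^+ 4 + (4 * w - 2 * w ^+ 2) * A ^+ 2) <=
  \sum_(z <- axis_points t) ln (1 + normc (u + z * h) ^+ 2).
Proof.
case: u => a b; case: h => c e; rewrite sum_axis.
have p z : 1 + normc z ^+ 2 \is Num.pos by rewrite posrE ltr_pwDl// sqr_ge0.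
rewrite -!lnM ?posrE ?mulr_gt0 -?posrE// !normc_sqrE /= => AE wE w1.
have A1 : 1 <= A by rewrite AE lerDl addr_ge0 ?sqr_ge0.
have w0 : 0 <= w by rewrite wE mulr_ge0 ?addr_ge0 ?sqr_ge0.
set P := (X in _ <= ln X).
suff h : A ^+ 4 + (4 * w - 2 * w ^+ 2) * A ^+ 2 <= P.
  have A2 : 0 < A ^+ 4 + (4 * w - 2 * w ^+ 2) * A ^+ 2.
    rewrite ltr_pwDl ?exprn_gt0 ?(lt_le_trans ltr01 A1)//.
    by rewrite mulr_ge0 ?sqr_ge0//; nra.
  by rewrite ler_ln ?posrE// (lt_le_trans A2).
have := @axis_prod_ge A (a * c + b * e) (b * c - a * e) (c ^+ 2 + e ^+ 2) t A1.
rewrite addr_ge0 ?sqr_ge0// => /(_ isT); rewrite -wE.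
have -> : (a * c + b * e) ^+ 2 + (b * c - a * e) ^+ 2 =
  (c ^+ 2 + e ^+ 2) * (A - 1) by rewrite AE; ring.
move=> /(_ erefl) h; apply: (le_trans h); rewrite le_eqVlt; apply/orP; left.
by apply/eqP; rewrite /P AE wE; ring.
Qed.

(** ln (1 + |u|^2) is subharmonic, so its averages are at least its value. *)
Lemma axis_ln_ge t u h : t ^+ 2 * normc h ^+ 2 <= 1 ->
  4 * ln (1 + normc u ^+ 2) <= \sum_(z <- axis_points t) ln (1 + normc (u + z * h) ^+ 2).
Proof.
move=> w1; apply: le_trans (ln_le_sum_axis erefl erefl w1).
set w := t ^+ 2 * _ in w1 *; set A := 1 + _.
have w0 : 0 <= w by rewrite mulr_ge0 ?sqr_ge0.
have A1 : 1 <= A by rewrite lerDl sqr_ge0.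
have -> : 4 * ln A = ln (A ^+ 4).
  by rewrite lnXn ?(lt_le_trans ltr01)// mulr_natl.
have h0 : 0 <= (4 * w - 2 * w ^+ 2) * A ^+ 2.
  by rewrite mulr_ge0 ?sqr_ge0//; move: (w) w0 w1 => v *; nra.
rewrite ler_ln ?posrE ?lerDl//; first by rewrite exprn_gt0// (lt_le_trans ltr01).
by rewrite ltr_pwDl// exprn_gt0// (lt_le_trans ltr01).
Qed.

(** ln (1 + |u|^2) is strictly subharmonic where |u| < 1; this is the only place
where the smallness of a form is used. *)
Lemma axis_ln_gain t u : t ^+ 2 <= 1 -> normc u < 1 ->
  4 * ln (1 + normc u ^+ 2) + t ^+ 2 / 3 <=
  \sum_(z <- axis_points t) ln (1 + normc (u + z) ^+ 2).
Proof.
move=> t1 u1.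
have := @ln_le_sum_axis t u 1 _ _ erefl erefl; rewrite normc1 expr1n mulr1 => /(_ t1).
under eq_bigr do rewrite mulr1.
move=> h; apply: le_trans h.
set A := 1 + _; set w := t ^+ 2 in t1 *.
have w0 : 0 <= w by rewrite sqr_ge0.
have A1 : 1 <= A by rewrite lerDl sqr_ge0.
have A2 : A ^+ 2 <= 4.
  have n0 := normc_ge0 u.
  have : A <= 2 by rewrite /A; nra.
  by move=> ?; nra.
have A0 : 0 < A by rewrite (lt_le_trans ltr01).
have -> : 4 * ln A = ln (A ^+ 4) by rewrite lnXn// mulr_natl.
have -> : A ^+ 4 + (4 * w - 2 * w ^+ 2) * A ^+ 2 =
  A ^+ 4 * (1 + (4 * w - 2 * w ^+ 2) / A ^+ 2) by field; rewrite gt_eqF.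
have hw : w / 2 <= (4 * w - 2 * w ^+ 2) / A ^+ 2.
  by rewrite ler_pdivlMr ?exprn_gt0//; nra.
have g0 : 0 <= (4 * w - 2 * w ^+ 2) / A ^+ 2 by apply: le_trans hw; lra.
rewrite (@lnM _ (A ^+ 4)) ?posrE ?exprn_gt0 ?ltr_pwDl ?sqr_ge0//.
rewrite lerD2l; apply: (@le_trans _ _ (ln (1 + w / 2))); last first.
  by rewrite ler_ln ?posrE ?lerD2l// ltr_pwDl//; lra.
apply: (@le_trans _ _ ((w / 2) / (1 + w / 2))); last by apply: ln_ge_frac; lra.
by rewrite ler_pdivlMr; nra.
Qed.

End circle_averages.

(** * A plank theorem for finitely many forms *)

Section penalty.
Variables (R : realType) (J : eqType) (js : seq J) (s : R).
Hypothesis s12 : 1 <= s <= 2.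
Implicit Types (f h : J -> R[i]) (t g : R).

(** The q-th power of the norm in l_q, with q = 2 s: it is written as a power of
|f j|^2, and s ranges over [1, 2]. *)
Definition qsum f : R := \sum_(j <- js) normc (f j) `^ (2 * s).

Lemma qsum_ge0 f : 0 <= qsum f.
Proof. by apply: sumr_ge0 => j _; rewrite powR_ge0. Qed.

(** The cost, in the penalty, of moving f along z h: it is linear in g as soon as
the norm of h in l_q is at most the square root of g.  Young's inequality is
applied with l = t^2 g; the constant is 144 = 16 (1 + 4 + 4). *)
Lemma axis_qsum f h t g : qsum f <= 1 -> 0 < g -> qsum h <= g `^ s ->
  0 < t -> t ^+ 2 * g <= 1 ->
  \sum_(z <- axis_points t) qsum (fun j => f j + z * h j) <= 4 * qsum f + 144 * (t ^+ 2 * g).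
Proof.
move=> f1 g0 hg t0 tg; have /andP[s1 s2] := s12; have s0 : 0 < s by lra.
have t2 : 0 < t ^+ 2 by rewrite exprn_gt0.
set l := t ^+ 2 * g; have l0 : 0 < l by rewrite mulr_gt0.
pose X j := normc (h j) `^ (2 * s) / g `^ s.
have X0 j : 0 <= X j by rewrite divr_ge0 ?powR_ge0.
have sX : \sum_(j <- js) X j <= 1.
  by rewrite -mulr_suml ler_pdivrMr ?mul1r ?powR_gt0.
rewrite /qsum exchange_big /=.
apply: (@le_trans _ _ (\sum_(j <- js) (4 * normc (f j) `^ (2 * s) +
    16 * (l * (X j + 4 * (normc (f j) `^ (2 * s) + X j)))))).
  apply: ler_sum => j _; apply: (le_trans (axis_normc_powR t (f j) (h j) s12)).
  rewrite lerD2l -mulrA ler_wpM2l//.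
  set d := t ^+ 2 * _; set a := normc (f j) ^+ 2.
  have a0 : 0 <= a by rewrite sqr_ge0.
  have d0 : 0 <= d by rewrite mulr_ge0 ?sqr_ge0.
  apply: (le_trans (mulr_powR_le s1 l0 (addr_ge0 a0 d0) d0)).
  have dl : (d / l) `^ s = X j.
    rewrite /X normc_powR_sqr.
    have -> : d / l = normc (h j) ^+ 2 * g^-1.
      by rewrite /d /l; field; rewrite !gt_eqF.
    rewrite powRM ?sqr_ge0 ?invr_ge0 ?(ltW g0)//; congr (_ * _).
    by rewrite -powR_inv1 ?(ltW g0)// -powRrM mulN1r powRN.
  rewrite ler_wpM2l ?(ltW l0)// dl lerD2l.
  apply: (le_trans (powRD_le4 s12 a0 d0)); rewrite ler_wpM2l// normc_powR_sqr lerD2l.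
  rewrite -dl ge0_ler_powR ?nnegrE ?divr_ge0 ?(ltW l0)//; first exact: ltW.
  by rewrite ler_pdivlMr// ler_piMr.
rewrite big_split /= -!mulr_sumr lerD2l -/(qsum f).
have -> : 144 * l = 16 * (l * 9) by ring.
rewrite ler_wpM2l// ler_wpM2l ?(ltW l0)// big_split /= -mulr_sumr big_split /=.
rewrite -/(qsum f); lra.
Qed.

Lemma qsum_half f : qsum (fun j => 2^-1 * f j) <= 4^-1 * qsum f.
Proof.
rewrite /qsum mulr_sumr; apply: ler_sum => j _.
rewrite normcM powRM ?normc_ge0// ler_wpM2r ?powR_ge0//.
have -> : normc (2^-1 : R[i]) = 2^-1 :> R.
  by rewrite normcV; congr (_^-1); rewrite -[2 : R[i]]/(1 *+ 2) normcMn normc1.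
have /andP[s1 s2] := s12.
rewrite powRrM powR_mulrn ?invr_ge0// exprVn -natrX.
by apply: ge1r_powR => //; rewrite invr_gt0 ltr0n invf_le1 ?ler1n.
Qed.

End penalty.

Section finite_plank.
Variables (R : realType) (J I : eqType) (js : seq J) (ks : seq I) (s : R).
Hypothesis s12 : 1 <= s <= 2.
Variables (Y h : I -> J -> R[i]) (g : I -> R).

(* The weight 435 = 3 * 145 makes the gain of one logarithm, 435 g t^2 / 3, exceed
   the cost 144 t^2 g of the penalty by t^2 g; the bound 3480 = 8 * 435 makes the
   sum of all the weights at most 1 / 8. *)
Local Notation N := (qsum js s).
Let u n (f : J -> R[i]) := \sum_(j <- js) f j * Y n j.
Let Phi f := \sum_(n <- ks) 435 * g n * ln (1 + normc (u n f) ^+ 2) - N f.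

Hypothesis uh : forall n, n \in ks -> u n (h n) = 1.
Hypothesis g0 : forall n, n \in ks -> 0 < g n.
Hypothesis hg : forall n, n \in ks -> N (h n) <= g n `^ s.
Hypothesis sg : \sum_(n <- ks) g n <= 3480^-1.

Let g435 n : n \in ks -> 0 <= 435 * g n.
Proof. by move=> /g0; lra. Qed.

Let uD n f z k : u n (fun j => f j + z * k j) = u n f + z * u n k.
Proof.
rewrite /u mulr_sumr -big_split /=; apply: eq_bigr => j _.
by rewrite mulrDl mulrA.
Qed.

Let normc_le_qsum f j : j \in js -> normc (f j) <= 1 + N f.
Proof.
move=> jjs; have /andP[s1 s2] := s12.
have h1 : normc (f j) <= 1 + normc (f j) `^ (2 * s).
  have [/ltW f1|f1] := ltP (normc (f j)) 1.
    by apply: (le_trans f1); rewrite lerDl powR_ge0.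
  apply: (@le_trans _ _ (normc (f j) `^ (2 * s))); last by rewrite lerDr.
  by apply: le1r_powR => //; lra.
apply: (le_trans h1); rewrite lerD2l /qsum (big_rem j)//= lerDl.
by apply: sumr_ge0 => *; exact: powR_ge0.
Qed.

(** The logarithms grow at most like 2 N f with total weight 1 / 8, so the penalty
dominates. *)
Let Phi_bounded : exists B, forall f, Phi f <= B.
Proof.
pose K n := \sum_(j <- js) normc (Y n j).
exists (\sum_(n <- ks) 435 * g n * ln (1 + K n ^+ 2)) => f.
have N0 := qsum_ge0 js s f.
have K0 n : 0 <= K n by apply: sumr_ge0 => j _; exact: normc_ge0.
have uK n : normc (u n f) <= K n * (1 + N f).
  apply: (le_trans (normc_sum _ _)); rewrite mulr_suml big_seq [leRHS]big_seq.
  apply: ler_sum => j jjs; rewrite normcM mulrC ler_wpM2l ?normc_ge0//.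
  exact: normc_le_qsum.
have lnu n : ln (1 + normc (u n f) ^+ 2) <= ln (1 + K n ^+ 2) + 2 * N f.
  have N1 : 0 < 1 + N f by lra.
  apply: (@le_trans _ _ (ln ((1 + K n ^+ 2) * (1 + N f) ^+ 2))).
    rewrite ler_ln ?posrE ?mulr_gt0 ?exprn_gt0 ?ltr_pwDl ?sqr_ge0//.
    have h2 : normc (u n f) ^+ 2 <= K n ^+ 2 * (1 + N f) ^+ 2.
      by rewrite -exprMn lerXn2r ?nnegrE ?normc_ge0// mulr_ge0// ltW.
    have h3 : 1 <= (1 + N f) ^+ 2 by rewrite exprn_ege1//; lra.
    lra.
  rewrite lnM ?posrE ?exprn_gt0 ?ltr_pwDl ?sqr_ge0// lerD2l lnXn//.
  rewrite -[ln _ *+ 2]mulr_natl ler_wpM2l// le_ln1Dx//; lra.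
rewrite lerBlDr; apply: (@le_trans _ _ (\sum_(n <- ks)
   (435 * g n * ln (1 + K n ^+ 2) + 435 * g n * (2 * N f)))).
  rewrite big_seq [leRHS]big_seq; apply: ler_sum => n nks; rewrite -mulrDr.
  by apply: ler_wpM2l (lnu n); exact: g435.
rewrite big_split /= lerD2l -mulr_suml -mulr_sumr.
by move: sg; nra.
Qed.

(** A form that is too small at f forces one of the four neighbours of f along h k
to have a larger value of Phi: the k-th logarithm gains 145 t^2 g, the others do
not decrease on average, and the penalty costs at most 144 t^2 g. *)
Let Phi_gain f k t : k \in ks -> N f <= 1 -> normc (u k f) < 1 ->
  0 < t -> t ^+ 2 * (1 + \sum_(n <- ks) \sum_(m <- ks) normc (u n (h m)) ^+ 2 +
    \sum_(n <- ks) g n) <= 1 ->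
  4 * Phi f + t ^+ 2 * g k <= \sum_(z <- axis_points t) Phi (fun j => f j + z * h k j).
Proof.
move=> kks f1 uk t0 tb; have t2 : 0 < t ^+ 2 by rewrite exprn_gt0.
have S0 : 0 <= \sum_(n <- ks) \sum_(m <- ks) normc (u n (h m)) ^+ 2.
  by apply: sumr_ge0 => n _; apply: sumr_ge0 => m _; exact: sqr_ge0.
have G0 : 0 <= \sum_(n <- ks) g n.
  by rewrite big_seq; apply: sumr_ge0 => n /g0/ltW.
have t1 : t ^+ 2 <= 1 by nra.
have gk : g k <= \sum_(n <- ks) g n.
  rewrite (big_rem k)//= lerDl big_seq; apply: sumr_ge0 => n /mem_rem.
  by move=> /g0/ltW.
have tg : t ^+ 2 * g k <= 1.
  by apply: le_trans tb; rewrite ler_wpM2l ?(ltW t2)//; lra.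
have tu n : n \in ks -> t ^+ 2 * normc (u n (h k)) ^+ 2 <= 1.
  move=> nks; apply: le_trans tb; rewrite ler_wpM2l ?(ltW t2)//.
  apply: (@le_trans _ _ (\sum_(n <- ks) \sum_(m <- ks) normc (u n (h m)) ^+ 2)); last by lra.
  rewrite (big_rem n)//= (big_rem k)//= -addrA lerDl addr_ge0//.
    by apply: sumr_ge0 => m _; exact: sqr_ge0.
  by apply: sumr_ge0 => m _; apply: sumr_ge0 => m' _; exact: sqr_ge0.
have pen := axis_qsum s12 f1 (g0 kks) (hg kks) t0 tg.
rewrite sumrB; under eq_bigr do under eq_bigr do rewrite uD.
rewrite exchange_big /=; under eq_bigr do rewrite -mulr_sumr.
apply: (@le_trans _ _ (4 * \sum_(n <- ks) 435 * g n * ln (1 + normc (u n f) ^+ 2) +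
   145 * (t ^+ 2 * g k) - (4 * N f + 144 * (t ^+ 2 * g k)))).
  by rewrite /Phi; lra.
apply: lerB => //.
rewrite (big_rem k)//= [leRHS](big_rem k)//= mulrDr addrAC; apply: lerD.
  have gain := axis_ln_gain t1 uk.
  under [in leRHS]eq_bigr do rewrite uh// mulr1.
  have := ler_wpM2l (g435 kks) gain.
  apply: le_trans; rewrite mulrDr lerD//; first by rewrite mulrCA.
  by rewrite le_eqVlt; apply/orP; left; apply/eqP; field.
rewrite [leLHS]mulr_sumr [leLHS]big_seq [leRHS]big_seq.
apply: ler_sum => n /mem_rem nks; rewrite mulrCA.
apply: ler_wpM2l; [exact: g435|]; apply: axis_ln_ge; exact: tu.
Qed.

(** Passing from f to f / 2 costs at most ln 4 <= 3 in each logarithm, that is 3 / 8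
altogether, and saves three quarters of the penalty.  So N f <= 1 wherever Phi is
nearly maximal. *)
Let Phi_half f : Phi f <= Phi (fun j => 2^-1 * f j) + 8^-1 * 3 - 3 / 4 * N f.
Proof.
have uhalf n : u n (fun j => 2^-1 * f j) = 2^-1 * u n f.
  by rewrite /u mulr_sumr; apply: eq_bigr => j _; rewrite mulrA.
have := qsum_half js s12 f; rewrite /Phi => hN.
suff : \sum_(n <- ks) 435 * g n * ln (1 + normc (u n f) ^+ 2) <=
  \sum_(n <- ks) 435 * g n * ln (1 + normc (u n (fun j => 2^-1 * f j)) ^+ 2) + 8^-1 * 3.
  lra.
apply: (@le_trans _ _ (\sum_(n <- ks) (435 * g n * ln (1 + normc (u n (fun j => 2^-1 * f j)) ^+ 2)
    + 435 * g n * 3))).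
  rewrite big_seq [leRHS]big_seq; apply: ler_sum => n nks.
  rewrite -mulrDr; apply: ler_wpM2l; rewrite ?g435// uhalf.
  have -> : normc (2^-1 * u n f) ^+ 2 = 4^-1 * normc (u n f) ^+ 2.
    rewrite normcM normcV -[2 : R[i]]/(1 *+ 2) normcMn normc1 exprMn.
    by rewrite exprVn -natrX.
  move: (normc _ ^+ 2) (sqr_ge0 (normc (u n f))) => a a0.
  have h4 : 1 + a <= (1 + 4^-1 * a) * (1 + 3) by lra.
  apply: (@le_trans _ _ (ln ((1 + 4^-1 * a) * (1 + 3)))).
    by rewrite ler_ln ?posrE//; lra.
  rewrite lnM ?posrE; [|lra|lra]; rewrite lerD2l; apply: le_ln1Dx; lra.
rewrite big_split /= lerD2l -mulr_suml -mulr_sumr; move: sg; lra.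
Qed.

(** Phi need not attain its supremum, but a point within t^2 m / 4 of it, where m
is a lower bound of the g n, is as good: the gain t^2 g k of the sum of four
values is then already impossible. *)
Lemma finite_plank : exists f, N f <= 1 /\ forall n, n \in ks -> 1 <= normc (u n f).
Proof.
have [B PhiB] := Phi_bounded.
pose E := range Phi.
have E0 : has_sup E.
  split; first by exists (Phi (fun=> 0)), (fun=> 0).
  by exists B => _ [f _ <-].
have PhiE f : Phi f <= sup E by apply: ub_le_sup; [exact: E0.2|exists f].
set Q := 1 + \sum_(n <- ks) \sum_(m <- ks) normc (u n (h m)) ^+ 2 + \sum_(n <- ks) g n.
have Q1 : 1 <= Q.
  rewrite /Q -addrA lerDl addr_ge0//.
    by apply: sumr_ge0 => n _; apply: sumr_ge0 => m _; exact: sqr_ge0.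
  by rewrite big_seq; apply: sumr_ge0 => n /g0/ltW.
have Q0 : 0 < Q by rewrite (lt_le_trans ltr01).
have [m m0 mg] : exists2 m : R, 0 < m <= 1 & forall n, n \in ks -> m <= g n.
  elim: (ks) g0 => [|n l IH] gl; first by exists 1 => //; rewrite ltr01 lexx.
  have [|m /andP[m0 m1] mg] := IH; first by move=> k kl; apply: gl; rewrite inE kl orbT.
  exists (Num.min m (g n)).
    by rewrite lt_min m0 gl ?inE ?eqxx//= ge_min m1.
  move=> k; rewrite inE => /orP[/eqP->|/mg mk]; first by rewrite ge_min lexx orbT.
  by rewrite ge_min mk.
have /andP[mgt0 m1] := m0.
pose t := Q^-1.
have t0 : 0 < t by rewrite invr_gt0.
have tQ : t ^+ 2 * Q <= 1.
  by rewrite /t expr2 -mulrA mulVf ?gt_eqF// mulr1 invf_le1.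
have t21 : t ^+ 2 <= 1 by nra.
have t20 : 0 < t ^+ 2 by rewrite exprn_gt0.
have e0 : 0 < t ^+ 2 * m / 4 by rewrite divr_gt0// mulr_gt0.
have [_ [f _ <-]] := sup_adherent e0 E0; rewrite ltrBlDr => fE.
have f1 : N f <= 1.
  have := Phi_half f; have := PhiE (fun j => 2^-1 * f j).
  have : t ^+ 2 * m <= 1 by nra.
  lra.
exists f; split=> // k kks; rewrite leNgt; apply/negP => uk.
have := Phi_gain kks f1 uk t0 tQ.
have : \sum_(z <- axis_points t) Phi (fun j => f j + z * h k j) <= 4 * sup E.
  rewrite sum_axis.
  have p z := PhiE (fun j => f j + z * h k j).
  have -> : 4 * sup E = sup E + sup E + sup E + sup E by ring.
  by rewrite !lerD.
have : t ^+ 2 * m <= t ^+ 2 * g k by rewrite ler_wpM2l ?(ltW t20)// mg.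
lra.
Qed.

End finite_plank.

(** * Norm and coordinates of the sequence space *)

Section lpsum_finite.
Variables (R : realType) (p : R).
Implicit Types (x : int -> R[i]).

Lemma sum_le_lpsum x (s : seq int) : uniq s ->
  ((\sum_(j <- s) normc (x j) `^ p)%:E <= lpsum p x)%E.
Proof.
move=> us; apply: ereal_sup_ubound; exists [set` s].
  by split=> //; exact: finite_seq.
by rewrite -sumEFin [RHS]fsbig_seq.
Qed.

Lemma lpsum_le x (C : R) :
  (forall s : seq int, uniq s -> \sum_(j <- s) normc (x j) `^ p <= C) ->
  (lpsum p x <= C%:E)%E.
Proof.
move=> xC; apply: ge_ereal_sup => _ [A [fA _] <-].
rewrite fsbig_finite//= sumEFin lee_fin; apply: xC; exact: fset_uniq.
Qed.

End lpsum_finite.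

Section lp_space.
Variables (R : realType) (p : R) (p1 : 1 <= p).
Local Notation V := (lp p1).
Implicit Types (x y z : V) (s : seq int).

Let pgt0 : 0 < p. Proof. exact: lt_le_trans p1. Qed.

(** The norm of the space takes its values in the complex numbers; this is the same
norm as a real number. *)
Definition nrm x : R := lpnorm p x.

Lemma nrm_ge0 x : 0 <= nrm x. Proof. exact: lpnorm_ge0. Qed.

Lemma nrmD x y : nrm (x + y) <= nrm x + nrm y.
Proof. exact: ler_lpnormD p1 _ _ (lp_fin x) (lp_fin y). Qed.

Lemma nrmZ (c : R[i]) x : nrm (c *: x) = normc c * nrm x.
Proof. exact: lpnormZ p1 c _ (lp_fin x). Qed.

Lemma nrm0 : nrm 0 = 0.
Proof. by rewrite -(scale0r (0 : V)) nrmZ normc0 mul0r. Qed.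

Lemma nrmN x : nrm (- x) = nrm x.
Proof. by rewrite -scaleN1r nrmZ normcN normc1 mul1r. Qed.

Lemma nrmB x y : nrm (x - y) <= nrm x + nrm y.
Proof. by rewrite -[leRHS](congr1 (+%R (nrm x)) (nrmN y)) nrmD. Qed.

Lemma sum_le_nrm x s : uniq s -> \sum_(j <- s) normc (x j) `^ p <= nrm x `^ p.
Proof.
by move=> us; have := sum_le_lpsum p x us; rewrite (lpsum_lpnorm p1 (lp_fin x)).
Qed.

Lemma coord_le_nrm x j : normc (x j) <= nrm x.
Proof.
have := @sum_le_nrm x [:: j] erefl; rewrite big_seq1 => h.
rewrite leNgt; apply/negP => /(gt0_ltr_powR pgt0).
by rewrite !nnegrE normc_ge0 nrm_ge0 => /(_ isT isT); rewrite ltNge h.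
Qed.

Lemma nrm_powR_le x C : (forall s, uniq s -> \sum_(j <- s) normc (x j) `^ p <= C) ->
  nrm x `^ p <= C.
Proof.
by move=> /lpsum_le; rewrite (lpsum_lpnorm p1 (lp_fin x)) lee_fin.
Qed.

Lemma lp_exists (f : int -> R[i]) (C : R) :
  (forall s, uniq s -> \sum_(j <- s) normc (f j) `^ p <= C) ->
  exists x : V, x =1 f.
Proof.
move=> /lpsum_le fC.
have h : f \in lpseq p by rewrite inE (le_lt_trans fC)// ltry.
by exists (Lp p1 h).
Qed.

Lemma lpP x y : x =1 y -> x = y.
Proof. by move=> xy; apply/val_inj/funext. Qed.

Lemma coordD x y j : (x + y) j = x j + y j. Proof. by []. Qed.
Lemma coordZ (c : R[i]) x j : (c *: x) j = c * x j. Proof. by []. Qed.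
Lemma coord_sum (I : Type) (r : seq I) (F : I -> V) j :
  (\sum_(i <- r) F i) j = \sum_(i <- r) F i j.
Proof. by elim/big_ind2: _ => // x a y b <- <-. Qed.

Lemma restr_subproof (A : pred int) x :
  exists y : V, forall j, y j = if A j then x j else 0.
Proof.
apply: (@lp_exists _ (nrm x `^ p)) => s us; apply: le_trans (sum_le_nrm x us).
apply: ler_sum => j _; case: (A j) => //.
by rewrite normc0 powR0 ?gt_eqF// powR_ge0.
Qed.

Definition restr A x : V := sval (cid (restr_subproof A x)).

Lemma restrE A x j : restr A x j = if A j then x j else 0.
Proof. by rewrite /restr; case: cid. Qed.

Lemma lp_tail x (e : R) : 0 < e -> exists s, uniq s /\
  nrm (restr (fun j => j \notin s) x) `^ p <= e.
Proof.
move=> e0; have := lp_fin x; rewrite -ge0_fin_numE ?lpsum_ge0// => xfin.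
have [_ [A [fA _] <-]] := ub_ereal_sup_adherent e0 xfin.
rewrite -[ereal_sup _]/(lpsum p x) fsbig_finite//= sumEFin => hA.
exists (fset_set A); split; first exact: fset_uniq.
apply: nrm_powR_le => s us.
set s' := [seq j <- s | j \notin fset_set A].
have u' : uniq (s' ++ fset_set A).
  rewrite cat_uniq filter_uniq// fset_uniq andbT /=.
  by apply/hasPn => j jA; rewrite mem_filter jA.
have := sum_le_lpsum p x u'; rewrite big_cat/= => h.
have -> : \sum_(j <- s) normc (restr (fun j => j \notin fset_set A) x j) `^ p =
  \sum_(j <- s') normc (x j) `^ p.
  rewrite big_filter [RHS]big_mkcond/=; apply: eq_bigr => j _; rewrite restrE.
  by case: ifP => // _; rewrite normc0 powR0// gt_eqF.
by move: hA h; rewrite -(fineK xfin) -EFinB lte_fin lee_fin; lra.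
Qed.

End lp_space.

(** * Functionals and the weak topology *)

Section lp_topology.
Variables (R : realType) (p : R) (p1 : 1 <= p).
Local Notation V := (lp p1).
Implicit Types (x y z : V).

Definition functional := {f : {linear V -> R[i]^o} | continuous f}.

Lemma gt0_RcRe (e : R[i]) : 0 < e -> e = (complex.Re e)%:C%C /\ 0 < complex.Re e.
Proof.
move=> e0; have eE : e = (complex.Re e)%:C%C.
  by apply/esym/RRe_real; rewrite ger0_real// ltW.
by split=> //; rewrite -ltcR -eE.
Qed.

(** Linear maps are built below as plain functions; this packs them. *)
Lemma bounded_linear_exists (W : normedModType R[i]) (g : V -> W) (C : R) :
  (forall a x y, g (a *: x + y) = a *: g x + g y) ->
  (forall x, `|g x| <= (C * nrm x)%:C%C) ->
  exists2 f : {linear V -> W}, continuous f & forall x, f x = g x.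
Proof.
move=> gl gC.
pose gM := GRing.isLinear.Build _ _ _ _ g gl.
pose f : {linear V -> W} := HB.pack g gM.
exists f => //; apply/linear_bounded_continuous/linear_boundedP.
exists C%:C%C; split; first by apply/complex_realP; exists C.
move=> r Cr x; apply: (le_trans (gC x)); rewrite rmorphM.
by apply: ler_wpM2r; [rewrite lecR nrm_ge0|exact: ltW].
Qed.

Lemma functional_exists (g : V -> R[i]) (C : R) :
  (forall a x y, g (a *: x + y) = a * g x + g y) ->
  (forall x, normc (g x) <= C * nrm x) ->
  exists f : functional, forall x, sval f x = g x.
Proof.
move=> gl gC; have [|f fc fg] := @bounded_linear_exists R[i]^o g C gl.
  by move=> x; have := gC x; rewrite -lecR; exact.
by exists (exist _ f fc).
Qed.

Lemma continuous_linear_bound (W : normedModType R[i]) (f : {linear V -> W}) :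
  continuous f -> exists2 C : R, 0 < C & forall x, `|f x| <= (C * nrm x)%:C%C.
Proof.
move=> /linear_bounded_continuous/linear_boundedP.
move=> /pinfty_ex_gt0[M /gt0_RcRe[ME M0] fM].
exists (complex.Re M) => // x; have := fM x; rewrite {1}ME => h.
by apply: (le_trans h); rewrite rmorphM.
Qed.

Lemma functional_bound (f : functional) :
  exists2 C : R, 0 < C & forall x, normc (sval f x) <= C * nrm x.
Proof.
have [C C0 fC] := continuous_linear_bound (svalP f).
by exists C => // x; rewrite -lecR; exact: fC.
Qed.

Lemma coord_functional j : exists f : functional, forall x, sval f x = x j.
Proof.
apply: (@functional_exists (fun x => x j) 1) => // x.
by rewrite mul1r coord_le_nrm.
Qed.

Lemma denseP (A : set V) :
  dense A <-> forall y (e : R), 0 < e -> exists2 z, A z & nrm (z - y) < e.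
Proof.
split=> [dA y e e0|dA O [y Oy] oO].
  have e0' : 0 < (e%:C)%C by rewrite ltcR.
  have [|z [bz Az]] := dA (ball y e%:C%C) _ (ball_open _ _).
    by exists y; apply: ballxx.
  exists z => //; move: bz; rewrite -ball_normE.
  by move=> h; rewrite -nrmN opprB -ltcR; exact: h.
have /nbhs_ballP[e /gt0_RcRe[eE e0] bO] := (open_nbhs_nbhs (conj oO Oy)).
have [z Az ze] := dA y _ e0.
exists z; split=> //; apply: bO; rewrite -ball_normE eE.
have : (nrm (y - z))%:C%C < (complex.Re e)%:C%C by rewrite ltcR -nrmN opprB.
exact.
Qed.

Lemma functional_nbhs (f : functional) (A : set R[i]^o) y : open A -> A (sval f y) ->
  exists2 e : R, 0 < e & forall z, normc (sval f (z - y)) < e -> A (sval f z).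
Proof.
move=> oA Ay; have /nbhs_ballP[e /gt0_RcRe[eE e0] bA] := open_nbhs_nbhs (conj oA Ay).
exists (complex.Re e) => // z; rewrite linearB/= => h; apply: bA.
rewrite -ball_normE eE.
have : (normc (sval f z - sval f y))%:C%C < (complex.Re e)%:C%C by rewrite ltcR.
by rewrite -(normcN (sval f z - sval f y)) opprB.
Qed.

(** A basic open set of the supremum topology is a finite intersection of preimages
of open sets under functionals, and each of those contains a strip. *)
Lemma weak_nbhs (O : set (weak_topology V)) y : O y -> open O ->
  exists (n : nat) (f : nat -> functional) (e : R), 0 < e /\
    forall z, (forall i, (i < n)%N -> normc (sval (f i) (z - y)) < e) -> O z.
Proof.
move=> Oy [B sB BO].
move: Oy; rewrite -BO => -[C BC Cy].
have [D sD DC] := sB _ BC.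
have [f0 _] := coord_functional 0.
suff [n [f [e [e0 fD]]]] : exists (n : nat) (f : nat -> functional) (e : R), 0 < e /\
    forall z, (forall i, (i < n)%N -> normc (sval (f i) (z - y)) < e) ->
    forall E, E \in enum_fset D -> E z.
  exists n, f, e; split=> // z fz; exists C => //.
  by change (C z); rewrite -DC => E ED; exact: fD ED.
have : forall E, E \in enum_fset D ->
    exists (f : functional) (e : R), 0 < e /\ forall z, normc (sval f (z - y)) < e -> E z.
  move=> E ED; have := sD _ ED; rewrite inE => -[f _ [A oA AE]].
  have Ey : E y.
    by move: Cy; change (C y -> E y); rewrite -DC => /(_ _ ED).
  have [|e e0 fe] := @functional_nbhs f A y oA.
    by rewrite -AE in Ey.
  by exists f, e; split=> // z /fe; rewrite -AE.
elim: (enum_fset D) => [_|E s IH Es].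
  by exists 0%N, (fun=> f0), 1; split.
have [|n [f [e [e0 fD]]]] := IH; first by move=> F Fs; apply: Es; rewrite inE Fs orbT.
have [|g [d [d0 gE]]] := Es E; first by rewrite inE eqxx.
exists n.+1, (fun i => if i is k.+1 then f k else g), (Num.min e d).
split; first by rewrite lt_min e0.
move=> z h F; rewrite inE => /orP[/eqP->|].
  by apply: gE; have := h 0%N isT; rewrite lt_min => /andP[].
by move: F; apply: fD => i ni; have := h i.+1 ni; rewrite lt_min => /andP[].
Qed.

Lemma weakly_denseP (A : set V) : weakly_dense A <->
  forall y (n : nat) (f : nat -> functional) (e : R), 0 < e ->
    exists2 z, A z & forall i, (i < n)%N -> normc (sval (f i) (z - y)) < e.
Proof.
split=> [dA y n f e e0|dA O [y Oy] oO]; last first.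
  have [n [f [e [e0 fO]]]] := weak_nbhs Oy oO.
  by have [z Az /fO Oz] := dA y n f e e0; exists z.
pose U i : set (weak_topology V) :=
  [set z : V | ball (sval (f i) y : R[i]^o) e%:C%C (sval (f i) z)].
have oU i : open (U i).
  have : @open (initial_topology (sval (f i))) (U i).
    exists (ball (sval (f i) y : R[i]^o) e%:C%C) => //; exact: ball_open.
  move=> oU; exists [set U i]; last by rewrite bigcup_set1.
  move=> _ ->; exists [fset U i]%fset; last by rewrite set_fset1 bigcap_set1.
  by move=> _ /fset1P ->; rewrite inE; exists (f i).
have oI : open (\bigcap_(i < n) U i).
  rewrite bigcap_mkord; elim/big_ind: _ => // [|? ? ? ?]; first exact: openT.
  exact: openI.
have e0' : 0 < (e%:C)%C by rewrite ltcR.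
have [|z [Uz Az]] := dA _ _ oI; first by exists y => i _; apply: ballxx.
exists z => // i ni; have := Uz i ni; rewrite /U /= -ball_normE.
by rewrite linearB -normcN opprB -ltcR; exact.
Qed.

End lp_topology.

(** * Weak-star cluster points *)

Section weak_star_compactness.
Variables (R : realType) (p : R) (p1 : 1 <= p).
Local Notation V := (lp p1).
Implicit Types (x y z : V).

(** Tychonoff's theorem for the real and imaginary parts of L k x, which lie in a
compact segment depending only on x. *)
Lemma cluster_functional (L : nat -> V -> R[i]) (C : R) :
  (forall k x, normc (L k x) <= C * nrm x) ->
  exists f : V -> R[i], forall (xs : seq V) (e : R) k0, 0 < e ->
    exists2 k, (k0 <= k)%N & forall x, x \in xs -> normc (f x - L k x) < e.
Proof.
move=> LC.
pose c (b : bool) (z : R[i]) : R := if b then complex.Re z else complex.Im z.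
have cz b (z : R[i]) : `|c b z| <= normc z.
  by case: b; [exact: normRe_le|exact: normIm_le].
pose T (i : V * bool) : topologicalType := R.
pose A i : set (T i) := [set` `[- (C * nrm i.1), C * nrm i.1] ].
have cA : @compact (prod_topology T) [set f | forall i, A i (f i)].
  by apply: tychonoff => i; exact: segment_compact.
pose phi k : prod_topology T := fun i => c i.2 (L k i.1).
have FA : (phi @ \oo) [set f | forall i, A i (f i)].
  exists 0%N => // k _ i; rewrite /A /= in_itv /= -ler_norml.
  exact: le_trans (cz _ _) (LC k _).
have [g [_ gcl]] := cA (phi @ \oo) _ FA.
exists (fun x => (g (x, true) +i* g (x, false))%C) => xs e k0 e0.
pose near_g (xs : seq V) := [set h : prod_topology T |
  forall x b, x \in xs -> `|g (x, b) - h (x, b)| < e / 2].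
have ng : nbhs g (near_g xs).
  elim: xs => [|x xs IH]; first by apply: filterS (@filterT _ (nbhs g) _) => h _ x b.
  have nb b : nbhs g [set h : prod_topology T | `|g (x, b) - h (x, b)| < e / 2].
    apply: (@proj_continuous _ T (x, b) g [set u : R | `|g (x, b) - u| < e / 2]).
    apply/nbhs_ballP; exists (e / 2); first by rewrite /= divr_gt0.
    by move=> u.
  apply: filterS (filterI (filterI (nb true) (nb false)) IH) => h [[h1 h2] hxs] y b.
  by rewrite inE => /orP[/eqP->|/hxs//]; case: b.
have Fk0 : (phi @ \oo) [set phi k | k in [set k | (k0 <= k)%N]].
  by exists k0 => // k /= k0k; exists k.
have [_ [[k k0k <-] hk]] := gcl _ _ Fk0 ng.
exists k => // x xxs; apply: (le_lt_trans (normc_le_ReIm _)).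
have := hk x true xxs; have := hk x false xxs; rewrite /phi /c /=.
by case: (L k x) => a b /=; lra.
Qed.

(** The cluster point inherits linearity and the bound, since each of these is a
closed condition on finitely many values. *)
Lemma weak_star_cluster (L : nat -> V -> R[i]) (C : R) :
  (forall k a x y, L k (a *: x + y) = a * L k x + L k y) ->
  (forall k x, normc (L k x) <= C * nrm x) ->
  exists f : functional p1,
    (forall x c k0, (forall k, (k0 <= k)%N -> c <= normc (L k x)) ->
      c <= normc (sval f x)) /\
    (forall x, (forall k, L k x = 0) -> sval f x = 0).
Proof.
move=> Ll LC; have [f fL] := cluster_functional LC.
have eq0 (z : R[i]) (B : R) : (forall e, 0 < e -> normc z <= B * e) -> z = 0.
  move=> zB; apply: eq0_normc; apply/eqP; rewrite eq_le normc_ge0 andbT.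
  apply/ler_addgt0Pr => e e0; rewrite add0r.
  have B1 : 0 < 1 + `|B| by rewrite ltr_pwDl.
  apply: (le_trans (zB (e / (1 + `|B|)) _)); first by rewrite divr_gt0.
  rewrite mulrA ler_pdivrMr// mulrC ler_wpM2l ?(ltW e0)//.
  by rewrite (le_trans (ler_norm B))// lerDr.
have flin a x y : f (a *: x + y) = a * f x + f y.
  apply/eqP; rewrite -subr_eq0; apply/eqP; apply: (eq0 _ (2 + normc a)) => e e0.
  have [k _ hk] := fL [:: a *: x + y; x; y] e 0%N e0.
  have h1 : normc (f (a *: x + y) - L k (a *: x + y)) < e by apply: hk; rewrite !inE eqxx.
  have h2 : normc (f x - L k x) < e by apply: hk; rewrite !inE eqxx orbT.
  have h3 : normc (f y - L k y) < e by apply: hk; rewrite !inE eqxx !orbT.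
  have -> : f (a *: x + y) - (a * f x + f y) =
    (f (a *: x + y) - L k (a *: x + y)) - (a * (f x - L k x) + (f y - L k y)).
    by rewrite Ll; ring.
  apply: (le_trans (ler_normcD _ _)); rewrite normcN mulrDl mulr2n mulrDl !mul1r -addrA.
  apply: lerD; first exact: ltW.
  rewrite addrC; apply: (le_trans (ler_normcD _ _)); rewrite normcM.
  by apply: lerD; [apply: ler_wpM2l; [exact: normc_ge0|]|]; exact: ltW.
have fC x : normc (f x) <= C * nrm x.
  apply/ler_addgt0Pr => e e0; have [k _ /(_ x)] := fL [:: x] e 0%N e0.
  rewrite inE eqxx => /(_ isT) h.
  have -> : f x = L k x + (f x - L k x) by ring.
  by apply: (le_trans (ler_normcD _ _)); apply: lerD; [exact: LC|exact: ltW].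
have [F Ff] := functional_exists flin fC.
exists F; split=> [x c k0 Lc|x L0]; rewrite Ff.
  apply/ler_addgt0Pr => e e0; have [k /Lc ck /(_ x)] := fL [:: x] e k0 e0.
  rewrite inE eqxx => /(_ isT) h; apply: (le_trans ck).
  have -> : L k x = f x - (f x - L k x) by ring.
  apply: (le_trans (ler_normcD _ _)); rewrite normcN.
  by rewrite lerD2l ltW.
apply: (eq0 _ 1) => e e0; have [k _ /(_ x)] := fL [:: x] e 0%N e0.
by rewrite inE eqxx L0 subr0 mul1r => /(_ isT)/ltW.
Qed.

End weak_star_compactness.

(** * The plank theorem in the sequence space *)

Section infinite_plank.
Variables (R : realType) (p : R) (p1 : 1 <= p) (s : R).
Local Notation V := (lp p1).
Hypothesis s12 : 1 <= s <= 2.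
Hypothesis pq : (p - 1) * (2 * s - 1) <= 1.

(** The inequality (p - 1)(2 s - 1) <= 1 says that 2 s is at most the conjugate
exponent of p, for which this would be Young's inequality; b <= 1 makes up for
the difference. *)
Lemma young_le (a b : R) : 0 <= a -> 0 <= b <= 1 -> a * b <= a `^ (2 * s) + b `^ p.
Proof.
move=> a0 /andP[b0 b1]; have /andP[s1 s2] := s12; have p1' := p1.
have [ab|ba] := leP a (b `^ (p - 1)).
  apply: (@le_trans _ _ (b `^ p)); last by rewrite lerDr powR_ge0.
  rewrite (powR_splitB _ b0); last by lra.
  by rewrite mulrC ler_wpM2l.
apply: (@le_trans _ _ (a `^ (2 * s))); last by rewrite lerDl powR_ge0.
rewrite (powR_splitB _ a0); last by lra.
rewrite ler_wpM2l//.
have [a1|a1] := leP 1 a.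
  by apply: (le_trans b1); rewrite -[leLHS](powRr0 a) ler_powR//; lra.
rewrite leNgt; apply/negP => h; move: ba; rewrite ltNge => /negP; apply.
have [->|aN0] := eqVneq a 0; first exact: powR_ge0.
have agt0 : 0 < a by rewrite lt0r aN0.
apply: (@le_trans _ _ (a `^ ((2 * s - 1) * (p - 1)))).
  rewrite -{1}(powRr1 a0).
  by apply: ger_powR; [rewrite agt0 ltW|rewrite mulrC].
rewrite powRrM ge0_ler_powR ?nnegrE ?powR_ge0//; last exact: ltW.
by lra.
Qed.

(** Sequences in the unit ball of l_q act on l_p with norm at most 2, uniformly in
the finite set of indices: this is what the compactness argument needs. *)
Lemma pairing_le (js : seq int) (f : int -> R[i]) (x : V) : uniq js ->
  qsum js s f <= 1 -> normc (\sum_(j <- js) f j * x j) <= 2 * nrm x.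
Proof.
move=> ujs f1; have /andP[s1 s2] := s12.
have [x0|xN0] := eqVneq (nrm x) 0.
  rewrite big1 ?normc0 ?x0 ?mulr0// => j _.
  have -> : x j = 0; last by rewrite mulr0.
  by apply: eq0_normc; apply/eqP; rewrite eq_le normc_ge0 -x0 coord_le_nrm.
have xgt0 : 0 < nrm x by rewrite lt0r xN0 nrm_ge0.
apply: (le_trans (normc_sum _ _)); rewrite mulrC -ler_pdivrMl// mulr_sumr.
apply: (@le_trans _ _ (\sum_(j <- js) (normc (f j) `^ (2 * s) + (normc (x j) / nrm x) `^ p))).
  apply: ler_sum => j _; rewrite normcM mulrCA [_^-1 * _]mulrC.
  apply: young_le; first exact: normc_ge0.
  by rewrite divr_ge0 ?normc_ge0 ?nrm_ge0//= ler_pdivrMr// mul1r coord_le_nrm.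
rewrite big_split /=.
have -> : (2 : R) = 1 + 1 by [].
apply: lerD; first exact: f1.
under eq_bigr do rewrite powRM ?normc_ge0 ?invr_ge0 ?nrm_ge0//.
rewrite -mulr_suml -powR_inv1 ?nrm_ge0// -powRrM mulN1r powRN ler_pdivrMr ?(powR_gt0 _ xgt0)//.
by rewrite mul1r sum_le_nrm.
Qed.

(** The finite plank theorem is applied to the first K forms, rescaled by m so that
the weights m^2 g n have a sum below 3480^-1; the functionals obtained have norm at
most 2 / m whatever K is, and a cluster point of them works for all n at once. *)
Lemma infinite_plank (I : pred nat) (y : nat -> V) (h : nat -> int -> R[i])
    (js : nat -> seq int) (g : nat -> R) (G : R) (r : int) :
  (forall n, I n -> [/\ forall j, j \notin js n -> h n j = 0, uniq (js n) & r \notin js n]) ->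
  (forall n, I n -> \sum_(j <- js n) h n j * y n j = 1) ->
  (forall n, I n -> 0 < g n /\ qsum (js n) s (h n) <= g n `^ s) ->
  (forall K, \sum_(n < K | I n) g n <= G) ->
  exists f : functional p1, sval f (lp_basis p1 r) = 0 /\
    forall n, I n -> 1 <= normc (sval f (y n)).
Proof.
move=> hsupp hy hg gG; have /andP[s1 s2] := s12.
have G0 : 0 <= G by have := gG 0%N; rewrite big_ord0.
pose m : R := (60 * (1 + G))^-1.
have m0 : 0 < m by rewrite invr_gt0 mulr_gt0// ltr_pwDl.
have mG : m ^+ 2 * G <= 3480^-1.
  rewrite /m exprVn mulrC ler_pdivrMr ?exprn_gt0 ?mulr_gt0 ?ltr_pwDl//; nra.
pose ks K := [seq n <- iota 0 K | I n].
pose J K := undup (flatten [seq js n | n <- ks K]).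
have ksI K n : n \in ks K -> I n by rewrite mem_filter => /andP[].
have jsJ K n j : n \in ks K -> j \in js n -> j \in J K.
  by move=> nK jn; rewrite mem_undup; apply/flattenP; exists (js n) => //; exact: map_f.
have sumJ (W : zmodType) K n (F : int -> W) : n \in ks K -> (forall j, j \notin js n -> F j = 0) ->
    \sum_(j <- J K) F j = \sum_(j <- js n) F j.
  move=> nK F0; rewrite (bigID (mem (js n)))/= [X in _ + X]big1 ?addr0//.
  rewrite -big_filter; apply: perm_big; apply: uniq_perm.
  - by rewrite filter_uniq// undup_uniq.
  - by have [] := hsupp _ (ksI _ _ nK).
  - by move=> j; rewrite mem_filter; case: (boolP (j \in js n)) => // /(jsJ _ _ _ nK).
have fin K : exists f : int -> R[i], qsum (J K) s f <= 1 /\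
    forall n, n \in ks K -> 1 <= normc (\sum_(j <- J K) f j * (m^-1%:C%C * y n j)).
  apply: (@finite_plank R _ _ (J K) (ks K) s s12 (fun n j => m^-1%:C%C * y n j)
     (fun n j => m%:C%C * h n j) (fun n => m ^+ 2 * g n)).
  - move=> n nK; have In := ksI _ _ nK; apply: (etrans (sumJ _ K n _ nK _)).
      by move=> j jn; have [-> //] := hsupp _ In; rewrite mulr0 mul0r.
    rewrite -(hy n In); apply: eq_bigr => j _.
    by rewrite mulrACA -rmorphM divff ?gt_eqF// mul1r.
  - by move=> n /ksI/hg[g0 _]; rewrite mulr_gt0// exprn_gt0.
  - move=> n nK; have [g0 gs] := hg _ (ksI _ _ nK).
    have m20 : 0 <= m ^+ 2 by rewrite exprn_ge0// ltW.
    rewrite (powRM _ m20 (ltW g0)).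
    rewrite /qsum (sumJ _ K n)//; last first.
      move=> j jn; have [-> //] := hsupp _ (ksI _ _ nK).
      by rewrite mulr0 normc0 powR0//; apply/eqP; lra.
    have -> : (m ^+ 2) `^ s = m `^ (2 * s) by rewrite powRrM powR_mulrn// ltW.
    apply: le_trans (ler_wpM2l (powR_ge0 _ _) gs); rewrite /qsum mulr_sumr.
    apply: ler_sum => j _; rewrite normcM normcR gtr0_norm// powRM ?normc_ge0//.
    exact: ltW.
  - rewrite -mulr_sumr; apply: le_trans mG.
    rewrite ler_wpM2l ?sqr_ge0//; apply: le_trans (gG K).
    by rewrite big_filter -(big_mkord I g) /index_iota subn0.
have {fin} [f /all_and2 [f1 fy]] := choice fin.
pose L K (x : V) := m^-1%:C%C * \sum_(j <- J K) f K j * x j.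
have Ll K a x z : L K (a *: x + z) = a * L K x + L K z.
  rewrite /L mulrCA -mulrDr; congr (_ * _).
  rewrite mulr_sumr -big_split; apply: eq_bigr => j _.
  by change (f K j * (a * x j + z j) = a * (f K j * x j) + f K j * z j);
    rewrite mulrDr mulrCA.
have LC K x : normc (L K x) <= 2 / m * nrm x.
  have mV0 : 0 < m^-1 by rewrite invrK mulr_gt0// ltr_pwDl.
  rewrite /L normcM normcR gtr0_norm ?mV0// mulrAC [leRHS]mulrC ler_pM2l ?mV0//.
  exact: pairing_le (undup_uniq _) (f1 K).
have [F [FL F0]] := weak_star_cluster Ll LC.
exists F; split.
  apply: F0 => K; rewrite /L [X in _ * X]big1_seq ?mulr0// => j /andP[_ jJ].
  have -> : lp_basis p1 r j = (j == r)%:R :> R[i] by [].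
  have [jr|_] := eqVneq j r; last by rewrite mulr0.
  move: jJ; rewrite mem_undup => /flattenP[_ /mapP[n nK ->]].
  by rewrite jr => rn; have [_ _] := hsupp _ (ksI _ _ nK); rewrite rn.
move=> n In; apply: (FL _ _ n.+1) => K nK.
apply: (le_trans (fy K n _)); first by rewrite mem_filter In mem_iota.
rewrite /L mulr_sumr le_eqVlt; apply/orP; left; apply/eqP; congr normc.
by apply: eq_bigr => j _; rewrite mulrCA.
Qed.

End infinite_plank.

(** * Weighted shifts in diagonal form *)

Section shifts.
Variables (R : realType) (p : R) (p1 : 1 <= p).
Local Notation V := (lp p1).
Implicit Types (x y z : V).

Lemma nrm_le_powR x (e : R) : 0 <= e -> nrm x `^ p <= e `^ p -> nrm x <= e.
Proof.
move=> e0 xe; rewrite leNgt; apply/negP => h.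
have pgt0 : 0 < p := lt_le_trans ltr01 p1.
have := gt0_ltr_powR pgt0 _ _ h; rewrite !nnegrE => /(_ e0 (nrm_ge0 _)).
by rewrite ltNge xe.
Qed.

Lemma lp_decomp x (s : seq int) : uniq s ->
  x = \sum_(i <- s) x i *: lp_basis p1 i + restr (fun j => j \notin s) x.
Proof.
move=> us; apply: lpP => j.
have -> : (\sum_(i <- s) x i *: lp_basis p1 i + restr (fun j => j \notin s) x : V) j =
    \sum_(i <- s) x i * (j == i)%:R + (if j \notin s then x j else 0).
  rewrite -(restrE (fun j => j \notin s)) coordD; congr (_ + _).
  by rewrite coord_sum; apply: eq_bigr.
case: (boolP (j \in s)) => js.
  rewrite addr0 (bigD1_seq j js us)/= eqxx mulr1 [X in _ + X]big1 ?addr0// => i /negPf ij.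
  by rewrite eq_sym ij mulr0.
rewrite [X in X + _]big1_seq ?add0r// => i /andP[_ si].
by case: eqP si js => [->->//|_ _ _]; rewrite mulr0.
Qed.

(** The basis vectors span a dense subspace. *)
Lemma functional_basis0 (g : V -> R[i]) (C : R) :
  (forall a x y, g (a *: x + y) = a * g x + g y) ->
  (forall x, normc (g x) <= C * nrm x) ->
  (forall i, g (lp_basis p1 i) = 0) -> forall x, g x = 0.
Proof.
move=> gl gC g0 x; apply: eq0_normc; apply/eqP; rewrite eq_le normc_ge0 andbT.
apply/ler_addgt0Pr => e e0; rewrite add0r.
have C0 : 0 < 1 + `|C| by rewrite ltr_pwDl.
have d0 : 0 < e / (1 + `|C|) by rewrite divr_gt0.
have [s [us sx]] := lp_tail x (powR_gt0 p d0).
have {}sx := nrm_le_powR (ltW d0) sx.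
have g00 : g 0 = 0 by have := gl 1 0 0; rewrite scaler0 addr0 mul1r; move=> /eqP; rewrite -subr_eq subrr => /eqP.
have gD u v : g (u + v) = g u + g v by rewrite -[u]scale1r gl mul1r scale1r.
rewrite [x in g x](lp_decomp x us) gD.
have -> : g (\sum_(i <- s) x i *: lp_basis p1 i) = 0.
  elim/big_rec: _ => // i y _ gy; rewrite gl g0 mulr0 add0r //.
rewrite add0r; apply: (le_trans (gC _)).
apply: (@le_trans _ _ ((1 + `|C|) * nrm (restr (fun j => j \notin s) x))).
  rewrite ler_wpM2r ?nrm_ge0//; apply: (le_trans (ler_norm C)); lra.
by apply: (le_trans (ler_wpM2l (ltW C0) sx)); rewrite mulrCA divff ?mulr1// gt_eqF.
Qed.

(** T is conjugate to the unweighted shift by the diagonal operator with entries b.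
Contrary to the weights of T, the sequence b describes all the powers of T at
once. *)
Definition diag_shift (b : int -> R[i]) (M : R) (T : V -> V) := [/\ 1 <= M,
  forall j, b j != 0, forall j, normc (b (j + 1)) <= M * normc (b j) &
  forall x j, T x j = b (j + 1) / b j * x (j + 1)].

(** Products of weights to the right of 0, inverses of products to its left. *)
Lemma weights_exist (w : int -> R[i]) : (forall n, w n != 0) ->
  exists b : int -> R[i], (forall j, b j != 0) /\ forall j, b (j + 1) = w (j + 1) * b j.
Proof.
move=> w0.
pose b (j : int) := match j with
  | Posz n => \prod_(i < n) w (i.+1 : nat)
  | Negz n => (\prod_(i < n.+1) w (- (i : nat)%:Z))^-1 end.
have b0 j : b j != 0.
  by case: j => n; rewrite /b ?invr_eq0; apply/prodf_neq0 => i _; exact: w0.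
exists b; split=> // -[n|n].
  have -> : n%:Z + 1 = n.+1 by lia.
  by rewrite /b big_ord_recr mulrC.
case: n => [|n].
  have -> : Negz 0 + 1 = 0%N by lia.
  by rewrite /b big_ord0 big_ord_recr big_ord0 /= mul1r oppr0 divff.
have -> : Negz n.+1 + 1 = Negz n by lia.
rewrite /b [in RHS]big_ord_recr /= invfM mulrCA.
have -> : - (n.+1)%:Z = Negz n by lia.
by rewrite divff ?mulr1.
Qed.

(** The coordinates of T x depend continuously on x, so the basis determines them. *)
Lemma weighted_shift_diag (T : {linear V -> V}) : bilateral_weighted_shift T ->
  exists b M, diag_shift b M T.
Proof.
move=> [cT [w [[M0 wM] w0 Te]]].
have [b [b0 bw]] := weights_exist w0.
exists b, (1 + `|M0|); split=> //; first by rewrite lerDl.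
  move=> j; rewrite bw normcM ler_wpM2r ?normc_ge0//.
  apply: (le_trans (wM _)); apply: (le_trans (ler_norm _)); lra.
have [C C0 TC] := continuous_linear_bound cT.
have {}TC x : nrm (T x) <= C * nrm x by rewrite -lecR; exact: TC.
move=> x j; have -> : b (j + 1) / b j = w (j + 1) by rewrite bw mulfK.
pose g x := T x j - w (j + 1) * x (j + 1).
suff : g x = 0 by move/eqP; rewrite subr_eq0 => /eqP.
apply: (@functional_basis0 g (C + normc (w (j + 1)))) => [a u v|u|i].
- rewrite /g linearP.
  change (a * T u j + T v j - w (j + 1) * (a * u (j + 1) + v (j + 1)) =
    a * (T u j - w (j + 1) * u (j + 1)) + (T v j - w (j + 1) * v (j + 1))).
  ring.
- rewrite /g; apply: (le_trans (ler_normcD _ _)); rewrite normcN normcM mulrDl.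
  by apply: lerD; [exact: le_trans (coord_le_nrm _ _) (TC u)|
    rewrite ler_wpM2l ?normc_ge0 ?coord_le_nrm].
- rewrite /g Te.
  change (w i * (j == i - 1)%:R - w (j + 1) * (j + 1 == i)%:R = 0 :> R[i]).
  have -> : (j == i - 1) = (j + 1 == i) by lia.
  by case: eqP => [->|_]; rewrite ?mulr1 ?mulr0 subrr.
Qed.

Lemma diag_shift_exists (b : int -> R[i]) (M : R) : 1 <= M ->
  (forall j, b j != 0) -> (forall j, normc (b (j + 1)) <= M * normc (b j)) ->
  exists T : {linear V -> V}, bilateral_weighted_shift T /\ diag_shift b M T.
Proof.
move=> M1 b0 bM; have M0 : 0 < M by rewrite (lt_le_trans ltr01).
pose w j := b j / b (j - 1).
have wM j : normc (w j) <= M.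
  rewrite /w normcM normcV ler_pdivrMr.
    by have := bM (j - 1); rewrite subrK.
  rewrite lt0r normc_ge0 andbT; apply/eqP => /eq0_normc/eqP.
  by rewrite (negPf (b0 _)).
have wx x s : uniq s ->
    \sum_(j <- s) normc (w (j + 1) * x (j + 1)) `^ p <= M `^ p * nrm x `^ p.
  move=> us.
  apply: (@le_trans _ _ (M `^ p * \sum_(j <- [seq i + 1 | i <- s]) normc (x j) `^ p)).
    rewrite big_map mulr_sumr; apply: ler_sum => j _.
    rewrite normcM powRM ?normc_ge0// ler_wpM2r ?powR_ge0//.
    rewrite ge0_ler_powR ?nnegrE ?normc_ge0 ?(ltW M0)//.
    by rewrite ltW// (lt_le_trans ltr01 p1).
  rewrite ler_wpM2l ?powR_ge0// sum_le_nrm// map_inj_uniq//; exact: addIr.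
have Tx x : exists y : V, y =1 (fun j => w (j + 1) * x (j + 1)).
  exact: (@lp_exists _ _ _ _ (M `^ p * nrm x `^ p) (wx x)).
have {Tx} [T0 T0E] := choice Tx.
have Tl a x y : T0 (a *: x + y) = a *: T0 x + T0 y.
  apply: lpP => j.
  change (T0 (a *: x + y) j = a * T0 x j + T0 y j); rewrite !T0E.
  change (w (j + 1) * (a * x (j + 1) + y (j + 1)) =
    a * (w (j + 1) * x (j + 1)) + w (j + 1) * y (j + 1)); ring.
have TM x : `|T0 x| <= (M * nrm x)%:C%C.
  suff : nrm (T0 x) <= M * nrm x by rewrite -lecR; exact.
  apply: nrm_le_powR; first by rewrite mulr_ge0 ?nrm_ge0// ltW.
  rewrite powRM ?nrm_ge0 ?(ltW M0)//; apply: nrm_powR_le => s us.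
  by under eq_bigr do rewrite T0E; exact: wx.
have [T cT TT0] := bounded_linear_exists Tl TM.
exists T; split.
  split=> //; exists w; split; first by exists M.
    by move=> n; rewrite /w mulf_neq0 ?invr_eq0.
  move=> n; apply: lpP => j; rewrite TT0 T0E.
  change (w (j + 1) * (j + 1 == n)%:R = w n * (j == n - 1)%:R :> R[i]).
  have -> : (j == n - 1) = (j + 1 == n) by lia.
  by case: eqP => [->|_]; rewrite ?mulr1 ?mulr0.
by split=> // x j; rewrite TT0 T0E /w addrK.
Qed.

Lemma diag_shift_iter b M (T : V -> V) n x j : diag_shift b M T ->
  iter n T x j = b (j + n%:Z) / b j * x (j + n%:Z).
Proof.
move=> [_ b0 _ Tx]; elim: n j => [|n IH] j; first by rewrite addr0 divff ?mul1r.
rewrite iterS Tx IH mulrA; have -> : j + 1 + n%:Z = j + n.+1%:Z by lia.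
by congr (_ * _); field; rewrite !b0.
Qed.

Lemma diag_shift_bound b M (T : V -> V) (j : int) n : diag_shift b M T ->
  normc (b (j + n%:Z)) <= M ^+ n * normc (b j).
Proof.
move=> [M1 _ bM _]; elim: n => [|n IH]; first by rewrite addr0 mul1r.
have -> : j + n.+1%:Z = j + n%:Z + 1 by lia.
apply: (le_trans (bM _)); rewrite exprS -mulrA ler_wpM2l//.
by rewrite (le_trans ler01).
Qed.

End shifts.

(** * Recursive choice and a dense family *)

(** Each choice may depend on all the previous ones, which are presented to the
step as a function h of which only the values up to l matter. *)
Lemma dependent_choice_history (A : Type) (a0 : A) (P : nat -> nat -> A -> A -> Prop) :
  (forall l (h : nat -> A), exists a, forall k, (k <= l)%N -> P k l.+1 (h k) a) ->
  exists f : nat -> A, f 0%N = a0 /\ forall k l, (k < l)%N -> P k l (f k) (f l).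
Proof.
move=> ex.
have [g gP] : exists g : nat -> (nat -> A) -> A,
    forall l h k, (k <= l)%N -> P k l.+1 (h k) (g l h).
  have /choice[g gP] : forall lh : nat * (nat -> A), exists a,
      forall k, (k <= lh.1)%N -> P k lh.1.+1 (lh.2 k) a by move=> [l h]; exact: ex.
  by exists (fun l h => g (l, h)) => l h; exact: (gP (l, h)).
pose F := fix F l : nat -> A := if l is l'.+1 then
  (fun i => if (i <= l')%N then F l' i else g l' (F l')) else (fun=> a0).
have FE l i : F l.+1 i = if (i <= l)%N then F l i else g l (F l) by [].
have FS i l : (i <= l)%N -> F l i = F i i.
  elim: l => [|l IH]; first by rewrite leqn0 => /eqP->.
  rewrite leq_eqVlt => /orP[/eqP->//|il]; have il' : (i <= l)%N by [].
  by rewrite FE il' IH.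
exists (fun l => F l l); split=> // k [//|l] kl.
rewrite (FE l l.+1) ltnn.
by rewrite -(FS k l)//; exact: gP.
Qed.

Section dense_family.
Variables (R : realType) (p : R) (p1 : 1 <= p).
Local Notation V := (lp p1).
Implicit Types (x y z : V).

Lemma normc_basis j i : normc (lp_basis p1 j i) = (i == j)%:R :> R.
Proof.
change (normc ((i == j)%:R : R[i]) = (i == j)%:R :> R).
by case: (i == j); rewrite ?normc1 ?normc0.
Qed.

Lemma nrm_basis j : nrm (lp_basis p1 j) = 1.
Proof.
apply/eqP; rewrite eq_le; apply/andP; split; last first.
  by have := coord_le_nrm (lp_basis p1 j) j; rewrite normc_basis eqxx.
apply: nrm_le_powR => //; rewrite powR1; apply: nrm_powR_le => s us.
have p0 : p != 0 by rewrite gt_eqF// (lt_le_trans ltr01 p1).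
under eq_bigr do rewrite normc_basis.
have [js|js] := boolP (j \in s).
  rewrite (bigD1_seq j js us) /= big1 ?addr0 ?eqxx ?powR1//.
  by move=> i /negPf ->; rewrite powR0.
rewrite big1_seq// => i /andP[_ si].
by case: eqP si js => [->->//|_ _ _]; rewrite powR0.
Qed.

Lemma rat_complex_approx (c : R[i]) (e : R) : 0 < e ->
  exists q : rat * rat, normc ((ratr q.1 +i* ratr q.2)%C - c) < e.
Proof.
move=> e0; case: c => a d.
have app (u : R) : exists q : rat, `|ratr q - u| < e / 2.
  have [|q] := @rat_in_itvoo R (u - e / 2) (u + e / 2).
    by rewrite ltrD2l; lra.
  by rewrite in_itv/= => /andP[q1 q2]; exists q; rewrite ltr_distlC; lra.
have [q1 h1] := app a; have [q2 h2] := app d.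
exists (q1, q2); apply: (le_lt_trans (normc_le_ReIm _)) => /=; lra.
Qed.

(** Finite sequences with rational complex coordinates, enumerated. *)
Lemma dense_family : exists (W : nat -> V) (rho : nat -> nat),
  (forall i j, (rho i < `|j|)%N -> W i j = 0) /\
  forall y (e : R), 0 < e -> exists i, nrm (W i - y) < e.
Proof.
pose code := seq (int * (rat * rat))%type.
pose el (c : code) : V :=
  \sum_(q <- c) (ratr q.2.1 +i* ratr q.2.2)%C *: lp_basis p1 q.1.
pose dec i : code := odflt [::] (choice.unpickle i).
exists (fun i => el (dec i)), (fun i => \sum_(q <- dec i) `|q.1|)%N; split.
  move=> i j; elim: (dec i) => [|q c IH] ij; first by rewrite /el big_nil.
  rewrite big_cons in ij; rewrite /el big_cons.
  change ((ratr q.2.1 +i* ratr q.2.2)%C * (j == q.1)%:R + el c j = 0).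
  rewrite IH ?addr0; last by lia.
  by case: eqP ij => [->|_ _]; [lia|rewrite mulr0].
move=> y e e0; have e2 : 0 < e / 2 by lra.
have [s [us sy]] := lp_tail y (powR_gt0 p e2).
have {}sy := nrm_le_powR (ltW e2) sy.
suff [c cy] : exists c : code, nrm (el c - \sum_(i <- s) y i *: lp_basis p1 i) < e / 2.
  exists (choice.pickle c); rewrite /dec choice.pickleK.
  have E : el c - y = (el c - \sum_(i <- s) y i *: lp_basis p1 i)
      - restr (fun j => j \notin s) y.
    by rewrite {1}(lp_decomp y us) opprD addrA.
  have h := nrmB (el c - \sum_(i <- s) y i *: lp_basis p1 i)
      (restr (fun j => j \notin s) y).
  rewrite -E in h.
  by apply: (le_lt_trans h); rewrite [ltRHS]splitr; exact: (ltr_leD cy sy).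
elim: s {us sy} (e / 2) e2 => [|i s IH] d d0.
  by exists [::]; rewrite /el !big_nil subr0 nrm0.
have [c hc] := IH _ (divr_gt0 d0 (ltr0Sn _ 1)).
have [q hq] := rat_complex_approx (y i) (divr_gt0 d0 (ltr0Sn _ 1)).
exists ((i, q) :: c); rewrite /el !big_cons -/(el c) opprD addrACA -scalerBl.
apply: (le_lt_trans (nrmD _ _)); rewrite nrmZ nrm_basis mulr1 /=.
by rewrite (splitr d) ltrD.
Qed.

End dense_family.

(** * Vectors made of separated blocks *)

Section block_vectors.
Variables (R : realType) (p : R) (p1 : 1 <= p).
Local Notation V := (lp p1).

Variables (b : int -> R[i]) (v : nat -> V) (r n : nat -> nat) (eps om : nat -> R).
Hypothesis b0 : forall j, b j != 0.
Hypothesis eps0 : forall l, 0 < eps l.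
Hypothesis om0 : forall l, 0 < om l.
Hypothesis vsupp : forall l j, (r l < `|j|)%N -> v l j = 0.
Hypothesis vom : forall l s, uniq s ->
  \sum_(j <- s) normc (v l j * b j) `^ p <= om l `^ p.

Definition window l (i : int) := (`|i - (n l)%:Z| <= r l)%N.

Let p0 : 0 < p. Proof. exact: lt_le_trans p1. Qed.
Let nb0 j : 0 < normc (b j). Proof. exact: normc_gt0. Qed.

(** What T^m makes of the l-th block of x, that is of the part of x that T^(n l) maps
to eps l *: v l. *)
Definition block l (m j : int) : R[i] :=
  (eps l)%:C%C * v l (j + m - (n l)%:Z) * b (j + m - (n l)%:Z) / b j.

(** On the window of the block, b is bounded below by the hypothesis, and om l bounds
the norm of v l weighted by b. *)
Lemma block_part_le l (m : int) (a : R) s : uniq s -> 0 <= a ->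
  (forall j : int, (`|j| <= r l)%N -> eps l * om l <= a * normc (b (j + (n l)%:Z - m))) ->
  \sum_(j <- s) normc (block l m j) `^ p <= a `^ p.
Proof.
move=> us a0 hb; pose sh j : int := j + m - (n l)%:Z.
have om00 := om0 l; have e0 := eps0 l.
have step j : normc (block l m j) `^ p <=
    (a / om l) `^ p * normc (v l (sh j) * b (sh j)) `^ p.
  rewrite -powRM ?normc_ge0 ?divr_ge0 ?(ltW om00)//.
  have ao0 : 0 <= a / om l by rewrite divr_ge0// ltW.
  apply: ge0_ler_powR; rewrite ?(ltW p0) ?nnegrE ?normc_ge0//.
    by rewrite mulr_ge0// normc_ge0.
  have -> : normc (block l m j) =
      eps l * normc (v l (sh j) * b (sh j)) / normc (b j).
    by rewrite /block -/(sh j) !normcM normcV normcR gtr0_norm// !mulrA.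
  have [hj|hj] := leqP `|sh j| (r l); last first.
    by rewrite vsupp// mul0r normc0 !(mulr0, mul0r).
  have := hb _ hj; have -> : sh j + (n l)%:Z - m = j by rewrite /sh; lia.
  move=> hjb; rewrite [leRHS]mulrC -mulrA mulrCA ler_wpM2l ?normc_ge0//.
  by rewrite ler_pdivrMr// mulrAC ler_pdivlMr.
apply: (@le_trans _ _ ((a / om l) `^ p *
    \sum_(j <- [seq sh j | j <- s]) normc (v l j * b j) `^ p)).
  by rewrite big_map mulr_sumr; apply: ler_sum => j _; exact: step.
have us' : uniq [seq sh j | j <- s].
  by rewrite map_inj_uniq// => i j; rewrite /sh; lia.
apply: (le_trans (ler_wpM2l (powR_ge0 _ _) (vom l us'))).
by rewrite -powRM ?divr_ge0 ?(ltW om00)// divfK// gt_eqF.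
Qed.

(** A sequence that coincides at each index with one of the blocks, or vanishes, is
bounded by the sum of the bounds of all the blocks. *)
Lemma block_sum_le (Q : pred nat) (m : int) (a : nat -> R) (C : R) (Z : int -> R[i]) :
  (forall l, 0 <= a l) ->
  (forall l (j : int), Q l -> (`|j| <= r l)%N ->
    eps l * om l <= a l * normc (b (j + (n l)%:Z - m))) ->
  (forall L, \sum_(l < L | Q l) a l `^ p <= C) ->
  (forall j, Z j = 0 \/ exists2 l, Q l & Z j = block l m j) ->
  forall s, uniq s -> \sum_(j <- s) normc (Z j) `^ p <= C.
Proof.
move=> a0 hb hC hZ s us.
have /choice[f fP] : forall j, exists l, Z j = 0 \/ Q l /\ Z j = block l m j.
  move=> j; by have [Z0|[l Ql Zl]] := hZ j; [exists 0%N; left|exists l; right].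
pose L := (\sum_(j <- s) (f j).+1)%N.
have fL j : j \in s -> (f j < L)%N.
  by move=> js; rewrite /L (big_rem j)//= ltnS leq_addr.
apply: (@le_trans _ _ (\sum_(j <- s) \sum_(l < L | Q l) normc (block l m j) `^ p)).
  rewrite big_seq [leRHS]big_seq; apply: ler_sum => j js.
  have [->|[Ql ->]] := fP j.
    by rewrite normc0 powR0 ?gt_eqF// sumr_ge0// => *; exact: powR_ge0.
  rewrite (bigD1 (Ordinal (fL j js)))//= lerDl.
  by apply: sumr_ge0 => *; exact: powR_ge0.
rewrite exchange_big /=; apply: le_trans (hC L); apply: ler_sum => l Ql.
by apply: block_part_le => // j; exact: hb.
Qed.

Hypothesis sep : forall k l, (k < l)%N -> (n k + r k + r l < n l)%N.

Lemma window_inj k l i : window k i -> window l i -> k = l.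
Proof.
rewrite /window => hk hl; have [kl|lk|//] := ltngtP k l.
  by have := sep kl; lia.
by have := sep lk; lia.
Qed.

Lemma block_vector_exists (a : nat -> R) (C : R) : (forall l, 0 <= a l) ->
  (forall l (j : int), (`|j| <= r l)%N ->
    eps l * om l <= a l * normc (b (j + (n l)%:Z))) ->
  (forall L, \sum_(l < L) a l `^ p <= C) ->
  exists x : V, (forall l i, window l i -> x i = block l 0 i) /\
    forall i, (forall l, ~~ window l i) -> x i = 0.
Proof.
move=> a0 hb hC.
pose X i : R[i] := if pselect (exists l, window l i) is left h then
  block (sval (cid h)) 0 i else 0.
have [|x xX] := @lp_exists R p p1 X C.
  apply: (@block_sum_le predT 0 a) => // [l j _ jl|j]; first by rewrite subr0; exact: hb.
  by rewrite /X; case: pselect => h; [right; exists (sval (cid h))|left].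
exists x; split=> [l i li|i hi]; rewrite xX /X; case: pselect => h.
- by rewrite (window_inj (svalP (cid h)) li).
- by case: h; exists l.
- by case: (h) => l wl; have := hi l; rewrite wl.
- by [].
Qed.

Variables (M : R) (T : V -> V) (x : V).
Hypothesis bT : diag_shift b M T.
Hypothesis xblock : forall l i, window l i -> x i = block l 0 i.
Hypothesis x0 : forall i, (forall l, ~~ window l i) -> x i = 0.

Lemma iter_block m l j : window l (j + m%:Z) -> iter m T x j = block l m j.
Proof.
move=> w; rewrite (diag_shift_iter _ _ _ bT) (xblock w) /block addr0.
by field; rewrite !b0.
Qed.

Lemma iter_block0 m j : (forall l, ~~ window l (j + m%:Z)) -> iter m T x j = 0.
Proof. by move=> w; rewrite (diag_shift_iter _ _ _ bT) x0// mulr0. Qed.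

Lemma block_self k j : block k (n k) j = (eps k)%:C%C * v k j.
Proof. by rewrite /block addrK mulfK. Qed.

Lemma iter_block_self k j : window k (j + (n k)%:Z) -> iter (n k) T x j = (eps k)%:C%C * v k j.
Proof. by move=> /iter_block ->; exact: block_self. Qed.

Lemma window_other k l j : l != k -> window l (j + (n k)%:Z) -> v k j = 0.
Proof.
move=> lk wl; apply: vsupp; rewrite ltnNge; apply/negP => jk.
have wk : window k (j + (n k)%:Z) by rewrite /window addrK.
by rewrite (window_inj wl wk) eqxx in lk.
Qed.

(** The error made by T^(n k) x in approximating eps k *: v k. *)
Definition others k := iter (n k) T x - (eps k)%:C%C *: v k.

Lemma othersE k j : others k j = iter (n k) T x j - (eps k)%:C%C * v k j.
Proof. by []. Qed.

Lemma others_block k l j : l != k -> window l (j + (n k)%:Z) -> others k j = block l (n k) j.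
Proof.
by move=> lk wl; rewrite othersE (window_other lk wl) mulr0 subr0; exact: iter_block.
Qed.

Lemma others_eq0 k j : (forall l, l != k -> ~~ window l (j + (n k)%:Z)) -> others k j = 0.
Proof.
move=> hw; rewrite othersE; have [wk|wk] := boolP (window k (j + (n k)%:Z)).
  by rewrite iter_block_self// subrr.
rewrite iter_block0 ?sub0r; last first.
  by move=> l; have [->//|/hw] := eqVneq l k.
rewrite vsupp ?mulr0 ?oppr0//; move: wk; rewrite /window addrK; lia.
Qed.

Lemma others_alt k j : (exists2 l, l != k & window l (j + (n k)%:Z)) \/ others k j = 0.
Proof.
have [[l [lk wl]]|h] := pselect (exists l, l != k /\ window l (j + (n k)%:Z)).
  by left; exists l.
right; apply: others_eq0 => l lk; apply/negP => wl; apply: h; by exists l.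
Qed.

(** Coordinates can be selected according to the block to which they belong, since
each coordinate meets at most one. *)
Lemma others_restr_le k (Q : pred nat) (A : pred int) (a : nat -> R) (C : R) :
  (forall l, 0 <= a l) ->
  (forall l (j : int), l != k -> Q l -> (`|j| <= r l)%N ->
    eps l * om l <= a l * normc (b (j + (n l)%:Z - (n k)%:Z))) ->
  (forall L, \sum_(l < L | (nat_of_ord l != k) && Q l) a l `^ p <= C) ->
  (forall j l, l != k -> window l (j + (n k)%:Z) -> A j -> Q l) ->
  nrm (restr A (others k)) `^ p <= C.
Proof.
move=> a0 hb hC AQ; apply: nrm_powR_le.
apply: (@block_sum_le (fun l => (l != k) && Q l) (n k) a) => //.
  by move=> l j /andP[lk Ql]; exact: hb.
move=> j; rewrite restrE; case: ifP => Aj; last by left.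
have [[l lk wl]|->] := others_alt k j; last by left.
right; exists l; first by rewrite lk (AQ _ _ lk wl).
exact: others_block.
Qed.

End block_vectors.

(** * A sufficient condition for cyclicity *)

(** For each i, these are the integers of 2-adic valuation i: a partition of the
positive integers into infinitely many sequences of linear growth. *)
Definition dyadic (i t : nat) : nat := (2 ^ i * t.*2.+1)%N.

Lemma logn_dyadic i t : logn 2 (dyadic i t) = i.
Proof.
rewrite /dyadic lognM ?expn_gt0// pfactorK// lognE /= dvdn2 /= odd_double /=.
by rewrite addn0.
Qed.

Lemma dyadic_gt0 i t : (0 < dyadic i t)%N.
Proof. by rewrite /dyadic muln_gt0 expn_gt0. Qed.

Lemma leq_dyadic i t : (t <= dyadic i t)%N.
Proof.
rewrite /dyadic; have : (0 < 2 ^ i)%N by rewrite expn_gt0.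
by move: (2 ^ i)%N => u; nia.
Qed.

Section criterion.
Variables (R : realType) (p : R) (p1 : 1 <= p).
Local Notation V := (lp p1).

Lemma weight_exists (b : int -> R[i]) (x : V) (rho : nat) :
  (forall j, (rho < `|j|)%N -> x j = 0) ->
  exists2 om : R, 0 < om & forall s, uniq s ->
    \sum_(j <- s) normc (x j * b j) `^ p <= om `^ p.
Proof.
move=> xs; have p0 : 0 < p := lt_le_trans ltr01 p1.
pose B : R := \sum_(i < (2 * rho).+1) normc (b ((i : nat)%:Z - rho%:Z)).
have B0 : 0 <= B by apply: sumr_ge0 => i _; exact: normc_ge0.
have bB j : (`|j| <= rho)%N -> normc (b j) <= B.
  move=> jr; have h : (absz (j + rho%:Z)%R < (2 * rho).+1)%N by lia.
  rewrite /B (bigD1 (Ordinal h))//=.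
  have -> : (absz (j + rho%:Z))%:Z - rho%:Z = j by lia.
  by rewrite lerDl; apply: sumr_ge0 => i _; exact: normc_ge0.
have N0 := nrm_ge0 x.
exists (B * nrm x + 1); first by rewrite ltr_wpDl// mulr_ge0.
move=> s us; apply: (@le_trans _ _ (B `^ p * \sum_(j <- s) normc (x j) `^ p)).
  rewrite mulr_sumr; apply: ler_sum => j _; rewrite normcM mulrC.
  have [jr|jr] := leqP `|j| rho; last first.
    by rewrite xs// normc0 mulr0 powR0 ?gt_eqF// mulr0.
  rewrite powRM ?normc_ge0// ler_wpM2r ?powR_ge0//.
  by apply: ge0_ler_powR; rewrite ?(ltW p0) ?nnegrE ?normc_ge0//; exact: bB.
apply: (le_trans (ler_wpM2l (powR_ge0 _ _) (sum_le_nrm x us))).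
rewrite -powRM//; apply: ge0_ler_powR; rewrite ?(ltW p0) ?nnegrE ?addr_ge0 ?mulr_ge0//.
by rewrite lerDl.
Qed.

(** Each member of a dense family is repeated at infinitely many indices l, with a bound
om l on its norm weighted by b that grows so slowly with l that the sum of the
om l ^ p for l < k is O(k).  The index 0 carries the zero vector, which makes the
recursive construction start at time 0. *)
Lemma repeated_dense_family (b : int -> R[i]) :
  exists (v : nat -> V) (r : nat -> nat) (om : nat -> R),
  [/\ [/\ v 0%N = 0, r 0%N = 0%N & om 0%N = 1],
      forall l j, (r l < `|j|)%N -> v l j = 0,
      [/\ forall l, 0 < om l, forall l, om l `^ p <= (logn 2 l).+1%:R &
        forall i t, om (dyadic i t) = om (dyadic i 0)],
      forall l s, uniq s -> \sum_(j <- s) normc (v l j * b j) `^ p <= om l `^ p &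
      forall y (e : R), 0 < e -> exists i, forall t, nrm (v (dyadic i t) - y) < e].
Proof.
have p0 : p != 0 by rewrite gt_eqF// (lt_le_trans ltr01 p1).
have [W [rho [Ws Wd]]] := dense_family p1.
have /choice[om omP] : forall i, exists om : R, 0 < om /\ forall s, uniq s ->
    \sum_(j <- s) normc (W i j * b j) `^ p <= om `^ p.
  by move=> i; have [om om0 h] := weight_exists b (Ws i); exists om.
(* The vector number i is allowed at index l when its bound is at most one plus the
   2-adic valuation of l.  The valuation i of l is decoded as the valuation of
   i + 1, so each vector has arbitrarily large codes i, for which it is allowed. *)
pose ok l := (l != 0%N) && (om (logn 2 (logn 2 l).+1) `^ p <= (logn 2 l).+1%:R).
pose idx l := logn 2 (logn 2 l).+1.
have zero s : \sum_(j <- s) normc ((0 : V) j * b j) `^ p <= 1 `^ p.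
  rewrite big1 ?powR1// => j _; have -> : (0 : V) j = 0 by [].
  by rewrite mul0r normc0 powR0.
have okd i t : ok (dyadic i t) = (om (logn 2 i.+1) `^ p <= i.+1%:R).
  by rewrite /ok -lt0n dyadic_gt0 logn_dyadic.
have idxd i t : idx (dyadic i t) = logn 2 i.+1 by rewrite /idx logn_dyadic.
exists (fun l => if ok l then W (idx l) else 0),
  (fun l => if ok l then rho (idx l) else 0%N),
  (fun l => if ok l then om (idx l) else 1); split.
- by [].
- by move=> l j; case: ifP => // _; exact: Ws.
- split=> [l|l|i t].
  + by case: ifP => // _; have [] := omP (idx l).
  + by case: ifP => [/andP[]//|_]; rewrite powR1 ler1n.
  + by rewrite !okd !idxd.
- by move=> l s us; case: ifP => _; [have [_ ->] := omP (idx l)|exact: zero].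
- move=> y e e0; have [i hi] := Wd y e e0.
  pose t := Num.bound (om i `^ p).
  have eE : (dyadic i t).-1.+1 = dyadic i t by rewrite prednK// dyadic_gt0.
  exists (dyadic i t).-1 => u; rewrite okd idxd eE logn_dyadic.
  have -> : om i `^ p <= (dyadic i t)%:R; last exact: hi.
  apply: (@le_trans _ _ t%:R); last by rewrite ler_nat leq_dyadic.
  by apply: ltW; apply: archi_boundP; exact: powR_ge0.
Qed.

Lemma sum_half_powers (c : R) k L (P : pred nat) : 0 <= c ->
  \sum_(l < L | P l) c * 2^-1 ^+ (k + l).+1 <= c * 2^-1 ^+ k.
Proof.
move=> c0; have h0 i : 0 <= (2^-1 : R) ^+ i by rewrite exprn_ge0// invr_ge0.
apply: (@le_trans _ _ (\sum_(l < L) c * 2^-1 ^+ (k + l).+1)).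
  rewrite [leRHS](bigID (fun l : 'I_L => P l))/= lerDl; apply: sumr_ge0 => l _; exact: mulr_ge0.
suff -> : \sum_(l < L) c * 2^-1 ^+ (k + l).+1 = c * 2^-1 ^+ k - c * 2^-1 ^+ (k + L).
  by rewrite gerBl mulr_ge0.
elim: L => [|L IH]; first by rewrite big_ord0 addn0 subrr.
by rewrite big_ord_recr /= IH addnS !exprS; field.
Qed.

(** The pairs (n l, eps l) are chosen recursively, with E the set of admissible
scalars: E = {1} concerns orbits and E = R projective orbits.  The l-th choice
makes the l-th block small at all previous times n k, and all the previous blocks
small at time n l, relative to the scalar at that time and by a factor of at most
2^-(k + l + 1), which is summable over the blocks. *)
Lemma block_criterion (b : int -> R[i]) (M : R) (T : V -> V) (E : set R) :
  diag_shift b M T ->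
  (forall (N : nat) (C : R), exists (m : nat) (e : R), [/\ E e, 0 < e &
     forall j : int, (`|j| <= N)%N -> C * e <= normc (b (j + m%:Z)) /\
        C / e <= normc (b (j - m%:Z))]) ->
  exists x : V, forall y (d : R), 0 < d ->
    exists k (e : R), [/\ E e, 0 < e & nrm (e^-1%:C%C *: iter k T x - y) < d].
Proof.
move=> bT crit; have [M1 b0 _ _] := bT.
have p0 : 0 < p := lt_le_trans ltr01 p1.
have [v [r [om [[v0 r0 _] vs [om0 _ _] vom vd]]]] := repeated_dense_family b.
pose P k l (a a' : nat * R) := 0 < a.2 -> [/\ E a'.2, 0 < a'.2,
  (a.1 + r k + r l < a'.1)%N,
  forall j : int, (`|j| <= r l)%N ->
    a'.2 * om l * 2 ^+ (l + l).+1 <= a.2 * normc (b (j + a'.1%:Z - a.1%:Z)) &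
  forall j : int, (`|j| <= r k)%N ->
    a.2 * om k * 2 ^+ (l + l).+1 <= a'.2 * normc (b (j + a.1%:Z - a'.1%:Z))].
have step l (h : nat -> nat * R) : exists a, forall k, (k <= l)%N -> P k l.+1 (h k) a.
  pose N := (\sum_(k < l.+1) ((h k).1 + r k) + r l.+1)%N.
  pose t : R := 2 ^+ (l.+1 + l.+1).+1.
  have t0 : 0 < t by rewrite exprn_gt0.
  pose c k := om l.+1 * t / (h k).2 + (h k).2 * om k * t.
  pose C : R := 1 + normc (b 0) + \sum_(k < l.+1) `|c k|.
  have S0 : 0 <= \sum_(k < l.+1) `|c k| by apply: sumr_ge0.
  have C0 : normc (b 0) < C by rewrite /C; lra.
  have [m [e [Ee e0 me]]] := crit N C.
  exists (m, e) => k kl hk /=.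
  have kN : ((h k).1 + r k + r l.+1 <= N)%N.
    have kl' : (k < l.+1)%N by [].
    by rewrite /N leq_add2r (bigD1 (Ordinal kl'))//= leq_addr.
  have cC : om l.+1 * t / (h k).2 <= C /\ (h k).2 * om k * t <= C.
    have kl' : (k < l.+1)%N by [].
    have c1 : 0 <= om l.+1 * t / (h k).2.
      by rewrite divr_ge0 ?(ltW hk)// mulr_ge0 ?(ltW t0)// ltW.
    have c2 : 0 <= (h k).2 * om k * t.
      by rewrite mulr_ge0 ?(ltW t0)// mulr_ge0 ?(ltW hk)// ltW.
    have : c k <= C.
      rewrite /C (bigD1 (Ordinal kl'))//= addrCA; apply: (le_trans (ler_norm _)).
      by rewrite lerDl !addr_ge0 ?normc_ge0// sumr_ge0.
    by rewrite /c; split; lra.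
  have [cC1 cC2] := cC.
  (* Otherwise j = m and j = - m belong to the window, where b takes its value at 0,
     and C has been chosen larger than that. *)
  have mN : (N < m)%N.
    rewrite ltnNge; apply/negP => mN.
    have [|h1 _] := me (- m%:Z); first by rewrite abszN absz_nat.
    have [|_ h2] := me m%:Z; first by rewrite absz_nat.
    rewrite addNr in h1; rewrite subrr ler_pdivrMr// in h2.
    have Cb : 0 <= normc (b 0) := normc_ge0 _.
    by move: (normc (b 0)) h1 h2 C0 Cb => B *; nra.
  split=> //.
  - exact: leq_ltn_trans kN mN.
  - move=> j jr; have [|h1 _] := me (j - (h k).1%:Z); first by move: kN jr; clear; lia.
    rewrite addrAC.
    apply: (le_trans _ (ler_wpM2l (ltW hk) h1)).
    have h' : om l.+1 * t <= C * (h k).2 by rewrite -ler_pdivrMr.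
    by have := ler_wpM2l (ltW e0) h'; rewrite -/t; lra.
  - move=> j jr; have [|_ h1] := me (j + (h k).1%:Z); first by move: kN jr; clear; lia.
    apply: (le_trans _ (ler_wpM2l (ltW e0) h1)).
    by have -> : e * (C / e) = C by field; rewrite gt_eqF.
have [f [f0 fP]] := dependent_choice_history (0%N, 1) step.
pose n l := (f l).1; pose eps l := (f l).2.
have eps0 l : 0 < eps l.
  case: l => [|l]; first by rewrite /eps f0.
  by have [|//] := fP 0%N l.+1 isT; rewrite f0.
have sep k l : (k < l)%N -> (n k + r k + r l < n l)%N.
  by move=> kl; have [] := fP k l kl (eps0 k).
have n0 : n 0%N = 0%N by rewrite /n f0.
have part k l (j : int) : l != k -> (`|j| <= r l)%N -> eps l * om l <=
    eps k * 2^-1 ^+ (k + l).+1 * normc (b (j + (n l)%:Z - (n k)%:Z)).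
  move=> lk jl; rewrite mulrAC exprVn ler_pdivlMr ?exprn_gt0//.
  have mono a c : (a <= c)%N -> (2 : R) ^+ a <= 2 ^+ c.
    by move=> ac; rewrite ler_eXn2l// ltr1n.
  have eo : 0 <= eps l * om l by rewrite mulr_ge0 ?(ltW (eps0 _)) ?(ltW (om0 _)).
  move: lk; rewrite neq_ltn => /orP[lk|kl].
    have [_ _ _ _ h] := fP l k lk (eps0 l); apply: le_trans (h j jl).
    by apply: ler_wpM2l => //; apply: mono; rewrite ltnS leq_add2l ltnW.
  have [_ _ _ h _] := fP k l kl (eps0 k); apply: le_trans (h j jl).
  by apply: ler_wpM2l => //; apply: mono; rewrite ltnS leq_add2r ltnW.
have h0 i : 0 <= (2^-1 : R) ^+ i by rewrite exprn_ge0// invr_ge0.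
have [x [xb x0]] : exists x : V, (forall l i, window r n l i -> x i = block b v n eps l 0 i) /\
    forall i, (forall l, ~~ window r n l i) -> x i = 0.
  pose a l := if l is 0%N then eps 0%N * om 0%N / normc (b 0) else (2^-1 : R) ^+ (0 + l).+1.
  have a0 l : 0 <= a l.
    case: l => [|l] /=; last exact: h0.
    by rewrite divr_ge0 ?normc_ge0// mulr_ge0 ?(ltW (eps0 _)) ?(ltW (om0 _)).
  apply: (@block_vector_exists _ _ p1 _ _ _ _ _ _ b0 eps0 om0 vs vom sep a
    (a 0%N `^ p + 1 * 2^-1 ^+ 0)) => //.
    case=> [|l] j jl.
      have -> : j = 0 by move: jl; rewrite r0; lia.
      by rewrite n0 /= divfK// gt_eqF// normc_gt0.
    by have := @part 0%N l.+1 j isT jl; rewrite n0 subr0 /eps f0 mul1r.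
  case=> [|L]; first by rewrite big_ord0 addr_ge0 ?powR_ge0// mulr_ge0.
  rewrite big_ord_recl lerD2l; apply: le_trans (sum_half_powers 0 L.+1 predT ler01).
  rewrite [leRHS]big_ord_recl; apply: (@le_trans _ _ (\sum_(i < L) 1 * 2^-1 ^+ (0 + (lift ord0 i : 'I_L.+1)).+1)).
    by apply: ler_sum => l _; rewrite mul1r; exact: powR_half_le.
  by rewrite lerDr mulr_ge0.
have oth k : nrm (others v n eps T x k) `^ p <= eps k `^ p * 2^-1 ^+ k.
  have -> : others v n eps T x k = restr predT (others v n eps T x k).
    by apply: lpP => j; rewrite restrE.
  apply: (@others_restr_le _ _ p1 _ _ _ _ _ _ b0 eps0 om0 vs vom sep M T x bT xb x0
     k predT predT (fun l => eps k * 2^-1 ^+ (k + l).+1)) => //.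
  - by move=> l; rewrite mulr_ge0// ltW.
  - by move=> l j lk _ jl; exact: part.
  - move=> L; apply: le_trans (sum_half_powers k L (fun l => (l != k) && true) (powR_ge0 (eps k) p)).
    apply: ler_sum => l _; rewrite powRM// ?(ltW (eps0 _))//.
    by rewrite ler_wpM2l ?powR_ge0// powR_half_le.
exists x => y d d0.
have d2 : 0 < d / 2 by rewrite divr_gt0.
have [i hi] := vd y _ d2.
have [t ht] : exists t, (2^-1 : R) ^+ (dyadic i t) <= (d / 2) `^ p.
  have dp0 : 0 < (d / 2) `^ p by rewrite powR_gt0.
  have [t ht] : exists t : nat, ((d / 2) `^ p)^-1 <= t%:R.
    exists (Num.bound ((d / 2) `^ p)^-1); apply: ltW; apply: archi_boundP.
    by rewrite invr_ge0 ltW.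
  exists t; rewrite exprVn -[leRHS]invrK lef_pV2 ?posrE ?invr_gt0 ?exprn_gt0//.
  apply: (le_trans ht); rewrite -natrX ler_nat.
  by apply: (leq_trans (leq_dyadic i t)); apply: ltnW; exact: ltn_expl.
pose k := dyadic i t.
exists (n k), (eps k); split=> //.
  have k0 : (0 < k)%N := dyadic_gt0 i t.
  by have [|] := fP 0%N k k0; rewrite ?f0.
have ek0 := eps0 k.
have E2 : (eps k)^-1%:C%C *: iter (n k) T x - y =
    (eps k)^-1%:C%C *: others v n eps T x k + (v k - y).
  rewrite /others scalerBr scalerA -rmorphM mulVf ?gt_eqF// scale1r.
  by rewrite addrA subrK.
rewrite E2; apply: (le_lt_trans (nrmD _ _)); rewrite [ltRHS]splitr.
apply: ler_ltD (hi t); rewrite nrmZ normcR gtr0_norm ?invr_gt0//.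
rewrite mulrC ler_pdivrMr//; apply: nrm_le_powR; first by rewrite mulr_ge0 ?(ltW d2) ?(ltW ek0).
apply: (le_trans (oth k)); rewrite powRM ?(ltW d2) ?(ltW ek0)// mulrC.
by rewrite ler_wpM2r ?powR_ge0.
Qed.

End criterion.

(** * Counting and disjoint supports *)

(** The sum is the 2-adic valuation of (n - 1)!, which Legendre's formula bounds. *)
Lemma sum_logn2_le n : (\sum_(l < n) logn 2 l <= n)%N.
Proof.
have fact n' : (logn 2 n'`! <= n')%N.
  rewrite logn_fact//.
  suff h N m : (\sum_(1 <= k < N.+1) m %/ 2 ^ k <= m)%N by exact: h.
  elim: N m => [|N IH] m; first by rewrite big_geq.
  rewrite big_nat_recl//= expn1.
  have -> : (\sum_(1 <= i < N.+1) m %/ 2 ^ i.+1 = \sum_(1 <= i < N.+1) (m %/ 2) %/ 2 ^ i)%N.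
    by apply: eq_bigr => i _; rewrite expnS divnMA.
  have := IH (m %/ 2)%N; lia.
case: n => [|n]; first by rewrite big_ord0.
suff -> : (\sum_(l < n.+1) logn 2 l = logn 2 n`!)%N by apply: leq_trans (fact n) _.
elim: n => [|n IH]; first by rewrite big_ord_recr big_ord0.
by rewrite big_ord_recr IH factS lognM ?fact_gt0// addnC.
Qed.

Lemma geometric_sum_le (R : realType) (q : R) N : 0 <= q < 1 ->
  \sum_(m < N) q ^+ m <= (1 - q)^-1.
Proof.
move=> /andP[q0 q1]; rewrite -[leRHS]mul1r ler_pdivlMr ?subr_gt0//.
suff -> : (\sum_(m < N) q ^+ m) * (1 - q) = 1 - q ^+ N by rewrite gerBl exprn_ge0.
elim: N => [|N IH]; first by rewrite big_ord0 mul0r expr0 subrr.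
by rewrite big_ord_recr mulrDl IH exprS; ring.
Qed.

(** The values between 2^m and 2^(m + 1) are at most 6 * 2^m in number, and contribute
at most 6 (2^(1 - al))^m. *)
Lemma counted_powR_sum (R : realType) (al : R) : 1 < al ->
  exists C : R, forall (I : eqType) (s : seq I) (d : I -> nat),
    (forall i, i \in s -> (0 < d i)%N) ->
    (forall t, (count (fun i => d i <= t)%N s <= 3 * t)%N) ->
    \sum_(i <- s) (d i)%:R `^ (- al) <= C.
Proof.
move=> al1; pose q : R := 2 * 2 `^ (- al).
have q0 : 0 <= q by rewrite mulr_ge0 ?powR_ge0.
have q1 : q < 1.
  have -> : q = (2 `^ (al - 1))^-1.
    rewrite -powRN opprB powRD ?powRr1//; last by apply/implyP => _; rewrite pnatr_eq0.
  have al0 : 0 < al - 1 by rewrite subr_gt0.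
  have := gt0_ltr_powR al0 (_ : 1 \is Num.nneg) (_ : 2 \is Num.nneg) (_ : 1 < 2 :> R).
  rewrite !nnegrE powR1 => /(_ ler01 ltac:(by []) ltac:(by rewrite ltr1n)) h.
  by rewrite invf_lt1 ?powR_gt0.
exists (6 * (1 - q)^-1) => I s d d0 dc.
pose N := (\sum_(i <- s) (trunc_log 2 (d i)).+1)%N.
have tN i : i \in s -> (trunc_log 2 (d i) < N)%N.
  by move=> si; rewrite /N (big_rem i)//= ltnS leq_addr.
have tb i : i \in s -> (2 ^ trunc_log 2 (d i) <= d i < 2 ^ (trunc_log 2 (d i)).+1)%N.
  by move=> si; rewrite trunc_logP ?d0// trunc_log_ltn.
apply: (@le_trans _ _ (\sum_(i <- s) \sum_(m < N | trunc_log 2 (d i) == m) (2 `^ (- al)) ^+ m)).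
  rewrite big_seq [leRHS]big_seq; apply: ler_sum => i si.
  rewrite (big_pred1 (Ordinal (tN i si))); last first.
    by move=> m; rewrite /= -(inj_eq val_inj) eq_sym.
  have /andP[h _] := tb i si; set m := trunc_log _ _ in h *.
  have -> : (2 `^ (- al)) ^+ m = (2 ^ m)%:R `^ (- al) :> R.
    by rewrite natrX -(powR_mulrn m (powR_ge0 2 _)) -(powR_mulrn m (ler0n R 2)) -!powRrM mulrC.
  rewrite !powRN lef_pV2 ?posrE ?powR_gt0 ?ltr0n ?expn_gt0 ?d0//.
  by apply: ge0_ler_powR; rewrite ?nnegrE ?ler0n ?ler_nat//; lra.
rewrite (exchange_big_dep predT)//=.
apply: (@le_trans _ _ (\sum_(m < N) 6 * q ^+ m)); last first.
  by rewrite -mulr_sumr ler_wpM2l// geometric_sum_le// q0.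
apply: ler_sum => m _; rewrite big_const_seq iter_addr_0 -[leLHS]mulr_natl.
rewrite /q exprMn mulrA; apply: ler_wpM2r; first by rewrite exprn_ge0 ?powR_ge0.
rewrite -natrX -natrM ler_nat.
apply: (@leq_trans (3 * 2 ^ m.+1)); last by rewrite expnS; lia.
apply: leq_trans (dc (2 ^ m.+1)%N).
have -> : count (fun i => trunc_log 2 (d i) == m) s =
  count (fun i => (i \in s) && (trunc_log 2 (d i) == m)) s.
  by apply: eq_in_count => i ->.
apply: sub_count => i /andP[si /eqP <-].
by have /andP[_ /ltnW] := tb i si.
Qed.

Lemma harmonic_unbounded (R : realType) (B : R) :
  exists n, B < \sum_(t < n) (t.+1)%:R^-1.
Proof.
apply: contrapT => h; apply: (@dvg_harmonic R).
apply: nondecreasing_is_cvgn.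
  apply/nondecreasing_seqP => n; rewrite /series /= big_nat_recr//= lerDl.
  by rewrite invr_ge0.
exists B => _ [n _ <-]; rewrite /series /= big_mkord leNgt; apply/negP => hn.
by apply: h; exists n.
Qed.

Section disjoint_sequences.
Variables (R : realType) (p : R) (p1 : 1 <= p).
Local Notation V := (lp p1).

Lemma disjoint_sum_nrm (n : nat) (P : pred nat) (x : nat -> V) :
  (forall t t' j, t != t' -> x t j = 0 \/ x t' j = 0) ->
  nrm (\sum_(t < n | P t) x t) `^ p <= \sum_(t < n | P t) nrm (x t) `^ p.
Proof.
move=> dis; have p0 : 0 < p := lt_le_trans ltr01 p1.
apply: nrm_powR_le => s us.
apply: (@le_trans _ _ (\sum_(j <- s) \sum_(t < n | P t) normc (x t j) `^ p)); last first.
  by rewrite exchange_big; apply: ler_sum => t _; exact: sum_le_nrm.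
apply: ler_sum => j _.
have -> : (\sum_(t < n | P t) x t) j = \sum_(t < n | P t) x t j.
  by elim/big_rec2: _ => // t a b _ <-.
have [[t Pt xt]|h] := pselect (exists2 t : 'I_n, P t & x t j != 0); last first.
  rewrite big1 ?normc0 ?powR0 ?gt_eqF//.
    by apply: sumr_ge0 => *; exact: powR_ge0.
  by move=> t Pt; apply: contrapT => xt; apply: h; exists t => //; apply/eqP.
rewrite (bigD1 t)//= big1 ?addr0 => [|t' /andP[_ gap']]; last first.
  by have [//|xt0] := dis t' t j gap'; rewrite xt0 eqxx in xt.
by rewrite (bigD1 t Pt)/= lerDl; apply: sumr_ge0 => *; exact: powR_ge0.
Qed.

Variables (u : nat -> V) (C : R).
Hypothesis pgt1 : 1 < p.
Hypothesis dis : forall t t' j, t != t' -> u t j = 0 \/ u t' j = 0.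
Hypothesis uC : forall t, nrm (u t) `^ p <= C * t.+1%:R `^ (p - 1).

(** The functional f is tested on z, the sum of the u t with weights 1 / (t + 1) and
phases that align the values of f.  With H the sum in the statement, f z is at
least d H, while disjointness of supports bounds the norm of z by (C H)^(1/p): the
exponent p > 1 bounds H. *)
Lemma functional_large_bounded (f : functional p1) (d : R) : 0 < d ->
  exists B : R, forall (n : nat) (S : pred nat), (forall t, S t -> d <= normc (sval f (u t))) ->
    \sum_(t < n | S t) t.+1%:R^-1 <= B.
Proof.
move=> d0; have [L L0 fL] := functional_bound f.
have p0 : 0 < p := lt_le_trans ltr01 p1.
exists ((L `^ p * C / d `^ p) `^ (p - 1)^-1) => n S hS.
set H := \sum_(t < n | S t) _.
have H0 : 0 <= H by apply: sumr_ge0 => t _; rewrite invr_ge0.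
pose w t := sval f (u t).
pose c t : R[i] := (t.+1%:R^-1)%:C%C * (normc (w t))%:C%C / w t.
have w0 t : S t -> w t != 0.
  move=> St; apply/eqP => wt; have := hS t St; rewrite -/(w t) wt normc0.
  by rewrite leNgt d0.
have nc t : S t -> normc (c t) = t.+1%:R^-1.
  move=> St; rewrite /c !normcM normcV !normcR !ger0_norm ?normc_ge0 ?invr_ge0//.
  by rewrite mulfK// gt_eqF// normc_gt0// w0.
pose z := \sum_(t < n | S t) c t *: u t.
have zle : nrm z `^ p <= C * H.
  apply: (le_trans (@disjoint_sum_nrm n S (fun t => c t *: u t) _)).
    move=> t t' j gap'; change (c t * u t j = 0 \/ c t' * u t' j = 0).
    by have [->|->] := dis j gap'; [left|right]; rewrite mulr0.
  rewrite /H mulr_sumr; apply: ler_sum => t St.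
  rewrite nrmZ powRM ?normc_ge0 ?nrm_ge0// nc//.
  apply: (le_trans (ler_wpM2l (powR_ge0 _ _) (uC t))).
  have t0 : 0 < t.+1%:R :> R by rewrite ltr0n.
  rewrite mulrCA le_eqVlt; apply/orP; left; apply/eqP; congr (_ * _).
  rewrite -powR_inv1 ?(ltW t0)// -powRrM mulN1r -powRD; last first.
    by apply/implyP => _; rewrite gt_eqF.
  by congr (_ `^ _); ring.
have fz : d * H <= normc (sval f z).
  have -> : sval f z = (\sum_(t < n | S t) t.+1%:R^-1 * normc (w t))%:C%C.
    rewrite linear_sum rmorph_sum; apply: eq_bigr => t St; rewrite linearZ.
    change (c t * w t = ((t.+1%:R^-1) * normc (w t))%:C%C).
    by rewrite /c divfK ?w0// rmorphM.
  rewrite normcR ger0_norm; last first.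
    by apply: sumr_ge0 => t _; rewrite mulr_ge0 ?normc_ge0 ?invr_ge0.
  rewrite /H mulr_sumr; apply: ler_sum => t St; rewrite mulrC.
  by rewrite ler_wpM2l ?invr_ge0//; exact: hS.
have key : (d * H) `^ p <= L `^ p * (C * H).
  apply: (@le_trans _ _ ((L * nrm z) `^ p)).
    apply: ge0_ler_powR; rewrite ?nnegrE ?mulr_ge0 ?nrm_ge0 ?(ltW d0) ?(ltW L0) ?(ltW p0)//.
    exact: le_trans fz (fL z).
  by rewrite powRM ?nrm_ge0 ?(ltW L0)// ler_wpM2l ?powR_ge0.
have [->|HN0] := eqVneq H 0; first exact: powR_ge0.
have Hgt0 : 0 < H by rewrite lt0r HN0.
have pm1 : 0 < p - 1 by rewrite subr_gt0.
have dp0 : 0 < d `^ p by rewrite powR_gt0.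
have key2 : H `^ (p - 1) <= L `^ p * C / d `^ p.
  rewrite ler_pdivlMr// mulrC -(ler_pM2r Hgt0) -mulrA [H `^ _ * H]mulrC.
  rewrite mulr_powRB1// -powRM ?(ltW d0)//.
  by apply: (le_trans key); rewrite mulrA.
have -> : H = (H `^ (p - 1)) `^ (p - 1)^-1.
  by rewrite -powRrM divff ?gt_eqF// powRr1.
by apply: ge0_ler_powR; rewrite ?nnegrE ?powR_ge0 ?invr_ge0 ?(ltW pm1)// (le_trans _ key2)// powR_ge0.
Qed.

(** If every t had a functional f i that is large on u t, then the harmonic series
would be covered by N bounded sums. *)
Lemma disjoint_weak_small (N : nat) (f : nat -> functional p1) (d : R) : 0 < d ->
  exists t, forall i, (i < N)%N -> normc (sval (f i) (u t)) < d.
Proof.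
move=> d0; apply: contrapT => h.
have /choice[B hB] : forall i, exists B : R, forall (n : nat) (S : pred nat),
    (forall t, S t -> d <= normc (sval (f i) (u t))) -> \sum_(t < n | S t) t.+1%:R^-1 <= B.
  by move=> i; exact: functional_large_bounded.
have [n hn] := harmonic_unbounded (\sum_(i < N) B i).
move: hn; rewrite ltNge => /negP; apply.
pose S i t := d <= normc (sval (f i) (u t)).
apply: (@le_trans _ _ (\sum_(i < N) \sum_(t < n | S i t) t.+1%:R^-1)); last first.
  by apply: ler_sum => i _; apply: hB.
rewrite (exchange_big_dep predT)//=; apply: ler_sum => t _.
have [i Si] : exists i : 'I_N, S i t.
  apply: contrapT => hi; apply: h; exists t => i iN; rewrite ltNge; apply/negP => Sit.
  by apply: hi; exists (Ordinal iN).
rewrite (bigD1 i)//= lerDl; apply: sumr_ge0 => *; by rewrite invr_ge0.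
Qed.

End disjoint_sequences.

(** * Weak density of lacunary orbits *)

(** The additional gap makes the time n l dominate data that depend on l only. *)
Lemma rapid_sequence (r gap : nat -> nat) : exists n : nat -> nat, n 0%N = 0%N /\
  forall k l, (k < l)%N -> (4 * (n k + r k + r l) + gap l < n l)%N.
Proof.
apply: (@dependent_choice_history nat 0%N
  (fun k l nk nl => (4 * (nk + r k + r l) + gap l < nl)%N)) => l h.
exists (\sum_(k < l.+1) (4 * (h k + r k + r l.+1) + gap l.+1)).+1%N => k kl.
have kl' : (k < l.+1)%N by [].
by rewrite ltnS (bigD1 (Ordinal kl'))//= leq_addr.
Qed.

Section lacunary_orbits.
Variables (R : realType) (p : R) (p1 : 1 <= p).
Local Notation V := (lp p1).
Variables (b : int -> R[i]) (M : R) (T : V -> V).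
Variables (v : nat -> V) (r n gap : nat -> nat) (eps om : nat -> R) (x : V).
Hypothesis bT : diag_shift b M T.
Hypothesis eps0 : forall l, 0 < eps l.
Hypothesis om0 : forall l, 0 < om l.
Hypothesis vsupp : forall l j, (r l < `|j|)%N -> v l j = 0.
Hypothesis vom : forall l s, uniq s ->
  \sum_(j <- s) normc (v l j * b j) `^ p <= om l `^ p.
Hypothesis rapid : forall k l, (k < l)%N -> (4 * (n k + r k + r l) + gap l < n l)%N.
Hypothesis xblock : forall l i, window r n l i -> x i = block b v n eps l 0 i.
Hypothesis x0 : forall i, (forall l, ~~ window r n l i) -> x i = 0.

Let b0 : forall j, b j != 0. Proof. by case: bT. Qed.
Let sep k l : (k < l)%N -> (n k + r k + r l < n l)%N.
Proof. by move=> /rapid; lia. Qed.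

(** The blocks whose images at the times n k are disjoint for different k: the
earlier blocks, which are then far on the left, and the later ones that are so
short that at time n k' their window cannot meet the one at time n k. *)
Definition spread k l := (l < k)%N || (2 * r l < n k)%N.

Definition spread_set k : pred int :=
  fun j => `[< exists l, [/\ l != k, window r n l (j + (n k)%:Z) & spread k l] >].

Local Notation oth := (others v n eps T x).

Definition spread_part k := restr (spread_set k) (oth k).
Definition far_part k := restr (fun j => ~~ spread_set k j) (oth k).

Lemma spread_far k : oth k = spread_part k + far_part k.
Proof.
apply: lpP => j; rewrite coordD !restrE.
by case: (spread_set k j) => /=; rewrite ?addr0 ?add0r.
Qed.

(** A window that is centred at n l - n k determines n l and n k up to errors smaller
than the gaps, because the sequence n grows so rapidly. *)
Lemma spread_window_apart k k' l l' (j : int) : (k < k')%N -> l != k -> l' != k' ->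
  window r n l (j + (n k)%:Z) -> window r n l' (j + (n k')%:Z) ->
  spread k l -> spread k' l' -> False.
Proof.
rewrite /window /spread => kk lk lk' w w' q q'.
have s1 := rapid kk.
have s2 : (l < k)%N \/ (k < l)%N /\ (4 * (n k + r k + r l) < n l)%N /\ (2 * r l < n k)%N.
  move: lk; rewrite neq_ltn => /orP[|kl]; first by left.
  by right; split=> //; split; [have := rapid kl; lia|move: q; rewrite ltnNge (ltnW kl)].
have s3 : (l' < k')%N \/ (k' < l')%N /\ (4 * (n k' + r k' + r l') < n l')%N.
  move: lk'; rewrite neq_ltn => /orP[|kl]; first by left.
  by right; split=> //; have := rapid kl; lia.
have s2' : (l < k)%N -> (4 * (n l + r l + r k) < n k)%N by move=> /rapid; lia.
have s3' : (l' < k')%N -> (4 * (n l' + r l' + r k') < n k')%N by move=> /rapid; lia.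
have s4 : (l < l')%N -> (4 * (n l + r l + r l') < n l')%N by move=> /rapid; lia.
have s5 : (l' < l)%N -> (4 * (n l + r l + r l') < n l)%N \/ (4 * (n l' + r l' + r l) < n l)%N.
  by move=> /rapid; lia.
have s6 : l = l' \/ (l < l')%N \/ (l' < l)%N by lia.
case: s2 => [a2|[a2 [h2 h2']]].
  have := s2' a2; case: s3 => [a3|[a3 h3]]; last by lia.
  by have := s3' a3; lia.
case: s3 => [a3|[a3 h3]]; first by have := s3' a3; lia.
case: s6 => [ll|[ll|ll]].
- subst l'; lia.
- by have := s4 ll; lia.
- by have := rapid ll; lia.
Qed.

Lemma spread_part_disjoint k k' j : k != k' -> spread_part k j = 0 \/ spread_part k' j = 0.
Proof.
move=> kk; rewrite !restrE; case: ifP => [/asboolP[l [lk wl ql]]|]; last by left.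
case: ifP => [/asboolP[l' [lk' wl' ql']]|]; last by right.
by move: kk; rewrite neq_ltn => /orP[kk|kk];
  [case: (spread_window_apart kk lk lk' wl wl')|case: (spread_window_apart kk lk' lk wl' wl)].
Qed.

Lemma spread_part_le k (a : nat -> R) (C : R) :
  (forall l, 0 <= a l) ->
  (forall l (j : int), l != k -> spread k l -> (`|j| <= r l)%N ->
    eps l * om l <= a l * normc (b (j + (n l)%:Z - (n k)%:Z))) ->
  (forall L, \sum_(l < L | (nat_of_ord l != k) && spread k l) a l `^ p <= C) ->
  nrm (spread_part k) `^ p <= C.
Proof.
move=> a0 hb hC.
apply: (@others_restr_le _ _ p1 _ _ _ _ _ _ b0 eps0 om0 vsupp vom sep M T x bT xblock x0
  k (spread k) (spread_set k) a C a0 hb hC) => j l lk wl /asboolP[l' [lk' wl' ql']].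
by rewrite (window_inj p1 sep wl wl').
Qed.

Lemma far_part_le k (a : nat -> R) (C : R) :
  (forall l, 0 <= a l) ->
  (forall l (j : int), l != k -> ~~ spread k l -> (`|j| <= r l)%N ->
    eps l * om l <= a l * normc (b (j + (n l)%:Z - (n k)%:Z))) ->
  (forall L, \sum_(l < L | (nat_of_ord l != k) && ~~ spread k l) a l `^ p <= C) ->
  nrm (far_part k) `^ p <= C.
Proof.
move=> a0 hb hC.
apply: (@others_restr_le _ _ p1 _ _ _ _ _ _ b0 eps0 om0 vsupp vom sep M T x bT xblock x0
  k (fun l => ~~ spread k l) (fun j => ~~ spread_set k j) a C a0 hb hC) => j l lk wl.
by move=> nk; apply: contra nk => ql; apply/asboolP; exists l.
Qed.

(* The growth C (t + 1)^(p - 1) is the one that [disjoint_weak_small] tolerates. *)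
Hypothesis pgt1 : 1 < p.
Hypothesis vdense : forall y (e : R), 0 < e ->
  exists i, forall t, nrm (v (dyadic i t) - y) < e.
Hypothesis spread_small : forall i, exists C : R, forall t,
  nrm (spread_part (dyadic i t)) `^ p <= eps (dyadic i t) `^ p * (C * t.+1%:R `^ (p - 1)).
Hypothesis far_small : forall k, (0 < k)%N -> nrm (far_part k) `^ p <= eps k `^ p * 2^-1 ^+ k.

(** Along k = dyadic i t, the vector T^(n k) x / eps k is the sum of v k, which is
close to y, of a far part that tends to 0 in norm, and of spread parts that have
disjoint supports, on which finitely many functionals are small for some t. *)
Lemma lacunary_weak_density y (N : nat) (f : nat -> functional p1) (d : R) : 0 < d ->
  exists k, forall i, (i < N)%N ->
    normc (sval (f i) ((eps k)^-1%:C%C *: iter (n k) T x - y)) < d.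
Proof.
move=> d0; have p0 : 0 < p := lt_le_trans ltr01 p1.
have [L L0 fL] : exists2 L : R, 0 < L &
    forall i, (i < N)%N -> forall z, normc (sval (f i) z) <= L * nrm z.
  elim: (N) => [|N' [L L0 IH]]; first by exists 1.
  have [L' L'0 fL'] := functional_bound (f N').
  exists (L + L') => [|i]; first exact: addr_gt0.
  rewrite ltnS leq_eqVlt => /orP[/eqP->|iN] z.
    by apply: (le_trans (fL' z)); rewrite ler_wpM2r ?nrm_ge0// lerDr ltW.
  by apply: (le_trans (IH i iN z)); rewrite ler_wpM2r ?nrm_ge0// lerDl ltW.
pose e := d / 3 / L.
have e0 : 0 < e by rewrite !divr_gt0.
have eL : L * e = d / 3 by rewrite /e mulrCA divff ?mulr1// gt_eqF.
have [i hi] := vdense y e0.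
have [C hC] := spread_small i.
have [t0 ht0] : exists t0 : nat, forall t, (t0 <= t)%N -> (2^-1 : R) ^+ (dyadic i t) <= e `^ p.
  have ep0 : 0 < e `^ p by rewrite powR_gt0.
  exists (Num.bound (e `^ p)^-1) => t ht.
  rewrite exprVn -[leRHS]invrK lef_pV2 ?posrE ?invr_gt0 ?exprn_gt0//.
  apply: (@le_trans _ _ (Num.bound (e `^ p)^-1)%:R).
    by apply/ltW/archi_boundP; rewrite invr_ge0 ltW.
  rewrite -natrX ler_nat; apply: (leq_trans ht); apply: (leq_trans (leq_dyadic i t)).
  by apply: ltnW; exact: ltn_expl.
pose k t := dyadic i (t0 + t).
pose u t := (eps (k t))^-1%:C%C *: spread_part (k t).
have nu t (z : V) (c : R) : 0 <= c -> nrm z `^ p <= eps (k t) `^ p * c ->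
    nrm ((eps (k t))^-1%:C%C *: z) `^ p <= c.
  move=> c0 hz; have ek := eps0 (k t).
  have V0 : 0 < (eps (k t))^-1 by rewrite invr_gt0.
  rewrite nrmZ normcR gtr0_norm// powRM ?nrm_ge0 ?(ltW V0)//.
  apply: (le_trans (ler_wpM2l (powR_ge0 _ _) hz)).
  by rewrite mulrA -powRM ?(ltW V0) ?(ltW ek)// mulVf ?gt_eqF// powR1 mul1r.
have C0 : 0 <= C.
  have := le_trans (powR_ge0 _ _) (hC 0%N); rewrite powR1 mulr1.
  by rewrite pmulr_rge0// powR_gt0.
have dis t t' j : t != t' -> u t j = 0 \/ u t' j = 0.
  move=> gap'; have kk : k t != k t'.
    rewrite /k /dyadic; have : (0 < 2 ^ i)%N by rewrite expn_gt0.
    by move: (2 ^ i)%N => w; nia.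
  change ((eps (k t))^-1%:C%C * spread_part (k t) j = 0 \/
    (eps (k t'))^-1%:C%C * spread_part (k t') j = 0).
  by have [->|->] := spread_part_disjoint j kk; [left|right]; rewrite mulr0.
have pm1 : 0 <= p - 1 by rewrite subr_ge0.
have uC t : nrm (u t) `^ p <= C * t0.+1%:R `^ (p - 1) * t.+1%:R `^ (p - 1).
  apply: nu; first by rewrite !mulr_ge0 ?powR_ge0.
  apply: (le_trans (hC _)); rewrite ler_wpM2l ?powR_ge0// -mulrA ler_wpM2l//.
  rewrite -powRM//; apply: ge0_ler_powR; rewrite ?nnegrE ?mulr_ge0//.
  by rewrite -natrM ler_nat; nia.
have d3 : 0 < d / 3 by rewrite divr_gt0.
have [t ht] := disjoint_weak_small pgt1 dis uC N f d3.
exists (k t) => j jN.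
have kt0 : (0 < k t)%N := dyadic_gt0 _ _.
pose w := (eps (k t))^-1%:C%C *: far_part (k t).
have wle : nrm w <= e.
  apply: nrm_le_powR; first exact: ltW.
  apply: le_trans (ht0 (t0 + t)%N (leq_addr _ _)).
  by apply: nu; [rewrite exprn_ge0// invr_ge0|exact: far_small].
have E : (eps (k t))^-1%:C%C *: iter (n (k t)) T x - y = u t + w + (v (k t) - y).
  have -> : iter (n (k t)) T x = (eps (k t))%:C%C *: v (k t) + (spread_part (k t) + far_part (k t)).
    by rewrite -spread_far /others addrCA subrr addr0.
  rewrite /u /w -scalerDr; move: (spread_part _ + far_part _) => z.
  rewrite scalerDr scalerA -rmorphM mulVf ?gt_eqF// scale1r.
  by rewrite addrCA addrA addrC addrA.
have fD (z1 z2 : V) : sval (f j) (z1 + z2) = sval (f j) z1 + sval (f j) z2 by rewrite linearD.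
have h1 := ht j jN.
have h2 : normc (sval (f j) w) <= d / 3.
  by apply: (le_trans (fL j jN w)); rewrite -eL ler_wpM2l// ltW.
have h3 : normc (sval (f j) (v (k t) - y)) <= d / 3.
  apply: (le_trans (fL j jN _)); rewrite -eL; apply: ler_wpM2l; first exact: ltW.
  by apply: ltW; exact: hi.
have gen (z1 z2 z3 : R[i]) : normc z1 < d / 3 -> normc z2 <= d / 3 -> normc z3 <= d / 3 ->
    normc (z1 + z2 + z3) < d.
  move=> n1 n2 n3; apply: (le_lt_trans (ler_normcD _ _)).
  by have := ler_normcD z1 z2; lra.
rewrite E (fD (u t + w) (v (k t) - y)) (fD (u t) w); exact: (gen _ _ _ h1 h2 h3).
Qed.

End lacunary_orbits.

(** * Shifts that are cyclic in the weak sense only *)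

Section sums.
Variable R : realType.

Lemma sum_ord_lt_le (F : nat -> R) k L : (forall l, 0 <= F l) ->
  \sum_(l < L | (l < k)%N) F l <= \sum_(l < k) F l.
Proof.
move=> F0; rewrite (big_ord_widen (maxn L k) F (leq_maxr L k)).
rewrite (big_ord_widen_cond (maxn L k) (fun l => (l < k)%N) F (leq_maxl L k)).
rewrite [leRHS](bigID (fun l : 'I_(maxn L k) => (l < L)%N))/= lerDl.
by apply: sumr_ge0 => *.
Qed.

Lemma bounded_sum_tail (F : nat -> R) (B d : R) : (forall l, 0 <= F l) ->
  (forall L, \sum_(l < L) F l <= B) -> 0 < d ->
  exists l0, forall L, \sum_(l < L | (l0 <= l)%N) F l <= d.
Proof.
move=> F0 FB d0; pose S := range (fun L => \sum_(l < L) F l).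
have S0 : has_sup S.
  by split; [exists (\sum_(l < 0) F l), 0%N|exists B => _ [L _ <-]].
have [_ [l0 _ <-] hl0] := sup_adherent d0 S0.
exists l0 => L.
have : \sum_(l < l0 + L) F l <= sup S by apply: ub_le_sup; [exact: S0.2|exists (l0 + L)%N].
rewrite (bigID (fun l : 'I__ => (l < l0)%N))/=.
have -> : \sum_(i < l0 + L | (i < l0)%N) F i = \sum_(i < l0) F i.
  by rewrite -(big_ord_widen _ _ (leq_addr L l0)).
have : \sum_(l < L | (l0 <= l)%N) F l <= \sum_(i < l0 + L | ~~ (i < l0)%N) F i.
  rewrite (big_ord_widen_cond (l0 + L) (fun l => (l0 <= l)%N) F (leq_addl l0 L)).
  under [leRHS]eq_bigl do rewrite -leqNgt.
  rewrite [leRHS](bigID (fun l : 'I_(l0 + L) => (l < L)%N))/= lerDl.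
  by apply: sumr_ge0.
lra.
Qed.

End sums.

(** The products of the weights w_n = 2 for n > 0 and w_n = 1 otherwise. *)
Definition two_one_weights {R : realType} (j : int) : R[i] := if j is Posz k then (2 ^+ k)%:C%C else 1.

Section two_one_weights.
Variable R : realType.

Lemma normc_two_one j : normc (two_one_weights j : R[i]) = if j is Posz k then 2 ^+ k else 1.
Proof. by case: j => k; rewrite ?normc1// normcR ger0_norm// exprn_ge0. Qed.

Lemma normc_two_one_ge1 j : 1 <= normc (two_one_weights j : R[i]).
Proof. by rewrite normc_two_one; case: j => k //; rewrite exprn_ege1// ler1n. Qed.

Lemma two_one_neq0 j : two_one_weights j != 0 :> R[i].
Proof.
apply/eqP => h; have := normc_two_one_ge1 j.
by rewrite h normc0 leNgt ltr01.
Qed.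

Lemma two_one_step j : normc (two_one_weights j : R[i]) <= normc (two_one_weights (j + 1)) /\
  normc (two_one_weights (j + 1)) <= 2 * normc (two_one_weights j : R[i]).
Proof.
rewrite !normc_two_one; case: j => [k|[|k]].
- have -> : Posz k + 1 = k.+1 by lia.
  rewrite exprS; split=> //; rewrite ler_peMl ?exprn_ge0// ler1n//.
- have -> : Negz 0 + 1 = Posz 0 by lia.
  by rewrite expr0 mulr1 ler1n.
- have -> : Negz k.+1 + 1 = Negz k by lia.
  by rewrite mulr1 ler1n.
Qed.

Lemma two_one_mono j k : normc (two_one_weights j : R[i]) <= normc (two_one_weights (j + k%:Z)).
Proof.
elim: k => [|k IH]; first by rewrite addr0.
apply: (le_trans IH); have [h _] := two_one_step (j + k%:Z).
by have -> : j + k.+1%:Z = j + k%:Z + 1 by lia.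
Qed.

End two_one_weights.

Section weakly_hypercyclic_example.
Variables (R : realType) (p : R) (p1 : 1 <= p).
Local Notation V := (lp p1).

(** The moduli of b do not decrease, so each coordinate of x reappears in T^k x at
least as large, and the orbit of x stays away from 0. *)
Lemma two_one_not_hypercyclic (T : V -> V) : diag_shift two_one_weights 2 T ->
  ~ hypercyclic T.
Proof.
move=> bT [x /denseP dx].
have [x0|xN0] := pselect (forall i, x i = 0).
  have [_ [k _ <-]] := dx (lp_basis p1 0) 1 ltr01; rewrite ltNge => /negP; apply.
  apply: le_trans (coord_le_nrm _ 0).
  change (1 <= normc (iter k T x 0 - (lp_basis p1 0) 0)).
  rewrite (diag_shift_iter _ _ _ bT) x0 mulr0 sub0r normcN normc_basis eqxx.
  by [].
have [i xi] : exists i, x i != 0.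
  by apply: contrapT => h; apply: xN0 => i; apply: contrapT => xi; apply: h; exists i; apply/eqP.
have [_ [k _ <-]] := dx 0 (normc (x i)) (normc_gt0 xi).
rewrite subr0 ltNge => /negP; apply; apply: le_trans (coord_le_nrm _ (i - k%:Z)).
rewrite (diag_shift_iter _ _ _ bT) subrK normcM normcM normcV.
rewrite ler_peMl ?normc_ge0// ler_pdivlMr ?normc_gt0 ?two_one_neq0// mul1r.
by have := two_one_mono R (i - k%:Z) k; rewrite subrK.
Qed.

(** At time n k the later blocks are divided by a large power of 2, while each of the
earlier blocks keeps its norm om l; their p-th powers add up to O(k), which is
within the admissible growth k^(p - 1) because p >= 2. *)
Lemma two_one_weakly_hypercyclic (T : V -> V) : 2 <= p -> diag_shift two_one_weights 2 T ->
  weakly_hypercyclic T.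
Proof.
move=> p2 bT; have [_ b0 _ _] := bT.
have [v [r [om [[v0 r0 om00] vs [om0 omlog omd] vom vd]]]] := repeated_dense_family p1 two_one_weights.
have two_unbounded (B : R) : exists k, B <= 2 ^+ k.
  exists (Num.bound `|B|); apply: (le_trans (ler_norm B)).
  have /ltW/le_trans -> // := archi_boundP (normr_ge0 B).
  by rewrite -natrX ler_nat ltnW// ltn_expl.
have /choice[gap gapP] : forall l, exists k, om l * 2 ^+ (l + l).+1 <= (2 : R) ^+ k.
  by move=> l; exact: two_unbounded.
have [n [n0 rapid]] := rapid_sequence r gap.
have sep k l : (k < l)%N -> (n k + r k + r l < n l)%N by move=> /rapid; lia.
pose eps (l : nat) : R := 1.
have eps0 l : 0 < eps l by [].
have right k l (j : int) : (k < l)%N -> (`|j| <= r l)%N ->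
    om l <= 2^-1 ^+ (k + l).+1 * normc (two_one_weights (j + (n l)%:Z - (n k)%:Z)).
  move=> kl jl; rewrite mulrC exprVn ler_pdivlMr ?exprn_gt0//.
  apply: (@le_trans _ _ (om l * 2 ^+ (l + l).+1)).
    by rewrite ler_wpM2l ?(ltW (om0 _))// ler_eXn2l ?ltr1n// ltnS leq_add2r ltnW.
  apply: (le_trans (gapP l)); rewrite normc_two_one.
  have := rapid k l kl.
  case E : (j + (n l)%:Z - (n k)%:Z) => [m|m] h; last by lia.
  by rewrite ler_eXn2l ?ltr1n//; lia.
have h0 i : 0 <= (2^-1 : R) ^+ i by rewrite exprn_ge0// invr_ge0.
pose a k l := if (l <= k)%N then om l else (2^-1 : R) ^+ (k + l).+1.
have a0 k l : 0 <= a k l by rewrite /a; case: ifP => // _; exact: ltW.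
have part k l (j : int) : (`|j| <= r l)%N ->
    eps l * om l <= a k l * normc (two_one_weights (j + (n l)%:Z - (n k)%:Z)).
  move=> jl; rewrite mul1r /a; case: leqP => lk; last exact: right.
  by rewrite ler_peMr ?normc_two_one_ge1// ltW.
have asum k L : \sum_(l < L) a k l `^ p <= (2 * k.+1)%:R + 1.
  rewrite (bigID (fun l : 'I_L => (l < k.+1)%N))/=; apply: lerD.
    apply: (@le_trans _ _ (\sum_(l < L | (l < k.+1)%N) (logn 2 l).+1%:R)).
      by apply: ler_sum => l lk; rewrite /a -ltnS lk; exact: omlog.
    apply: (le_trans (@sum_ord_lt_le R (fun l => (logn 2 l).+1%:R) k.+1 L (fun l => ler0n _ _))).
    rewrite -natr_sum ler_nat.
    have -> : (\sum_(l < k.+1) (logn 2 l).+1 = \sum_(l < k.+1) logn 2 l + k.+1)%N.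
      under eq_bigr do rewrite -addn1.
      by rewrite big_split /= sum_nat_const card_ord muln1.
    by have := sum_logn2_le k.+1; lia.
  apply: (@le_trans _ _ (\sum_(l < L | ~~ (l < k.+1)%N) 1 * 2^-1 ^+ (k + l).+1)).
    by apply: ler_sum => l /negPf lk; rewrite /a -ltnS lk mul1r powR_half_le.
  apply: (le_trans (sum_half_powers k L (fun l => ~~ (l < k.+1)%N) ler01)).
  by rewrite mul1r exprn_ile1 ?invr_ge0// invf_le1// ler1n.
have [x [xb x0]] : exists x : V, (forall l i, window r n l i -> x i = block two_one_weights v n eps l 0 i) /\
    forall i, (forall l, ~~ window r n l i) -> x i = 0.
  apply: (@block_vector_exists _ _ p1 _ _ _ _ _ _ b0 eps0 om0 vs vom sep (a 0%N)
     ((2 * 1)%:R + 1)) => //.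
    by move=> l j jl; have := part 0%N l j jl; rewrite n0 subr0.
exists x; apply/weakly_denseP => y N f d d0.
have pgt1 : 1 < p by lra.
have spread_small i : exists C : R, forall t,
    nrm (spread_part T v r n eps x (dyadic i t)) `^ p <=
    eps (dyadic i t) `^ p * (C * t.+1%:R `^ (p - 1)).
  exists (2 * (2 ^ i.+1).+1).+1%:R => t; rewrite powR1 mul1r.
  set k := dyadic i t.
  have kt : 2 * k.+1%:R + 1 <= (2 * (2 ^ i.+1).+1).+1%:R * t.+1%:R `^ (p - 1) :> R.
    apply: (@le_trans _ _ ((2 * (2 ^ i.+1).+1).+1%:R * t.+1%:R)); last first.
      by rewrite ler_wpM2l// le1r_powR ?ler1n//; lra.
    rewrite -!natrM natr1 ler_nat /k /dyadic expnS.
    by move: (2 ^ i)%N => w; nia.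
  apply: (le_trans _ kt).
  apply: (@spread_part_le _ _ p1 _ _ _ _ _ _ gap _ _ _ bT eps0 om0 vs vom rapid xb x0 k (a k)) => //.
    by move=> l j _ _; exact: part.
  move=> L; rewrite -natrM; apply: le_trans (asum k L).
  rewrite [leRHS](bigID (fun l : 'I_L => (nat_of_ord l != k) && spread r n k l))/= lerDl.
  by apply: sumr_ge0 => *; exact: powR_ge0.
have far_small k : (0 < k)%N -> nrm (far_part T v r n eps x k) `^ p <= eps k `^ p * 2^-1 ^+ k.
  move=> k0.
  apply: (@far_part_le _ _ p1 _ _ _ _ _ _ gap _ _ _ bT eps0 om0 vs vom rapid xb x0 k (a k)) => //.
    by move=> l j _ _; exact: part.
  move=> L; rewrite powR1.
  apply: le_trans (sum_half_powers k L (fun l => (l != k) && ~~ spread r n k l) ler01).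
  apply: ler_sum => l /andP[lk]; rewrite /spread negb_or -leqNgt => /andP[kl _].
  have {}kl : (k < l)%N by rewrite ltn_neqAle eq_sym lk.
  by rewrite /a leqNgt kl mul1r powR_half_le.
have [k hk] := lacunary_weak_density eps0 rapid pgt1 vd spread_small far_small y N f d0.
exists (iter (n k) T x); first by exists (n k).
move=> i iN; have := hk i iN; rewrite /eps invr1.
by rewrite scale1r.
Qed.

End weakly_hypercyclic_example.

Definition unit_weights {R : realType} (j : int) : R[i] := 1.

Section weakly_supercyclic_example.
Variables (R : realType) (p : R) (p1 : 1 <= p).
Local Notation V := (lp p1).

Lemma unit_weights_iter (T : V -> V) k x j : diag_shift unit_weights 1 T ->
  iter k T x j = x (j + k%:Z).
Proof. by move=> bT; rewrite (diag_shift_iter _ _ _ bT) divff ?oner_eq0// mul1r. Qed.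

Lemma normc_near1 (z : R[i]) : normc (z - 1) < 4^-1 -> 3 / 4 < normc z.
Proof. by have := normcB_ge z 1; rewrite normc1; lra. Qed.

Lemma normc_near_le (z w : R[i]) : normc (z - w) < 4^-1 -> normc w <= 1 -> normc z < 5 / 4.
Proof. by have := normcB_ge w z; rewrite -(normcN (w - z)) opprB; lra. Qed.

(** A multiple of T^k x close to e_0 shows that x has one dominating coordinate; a
multiple close to e_0 + e_1 shows two coordinates of comparable size. *)
Lemma unit_not_supercyclic (T : V -> V) : diag_shift unit_weights 1 T ->
  ~ supercyclic T.
Proof.
move=> bT [x /denseP dx].
have q0 : 0 < 4^-1 :> R by rewrite invr_gt0.
have [_ [l [k ->]] h1] := dx (lp_basis p1 0) _ q0.
have [_ [m [k' ->]] h2] := dx (lp_basis p1 0 + lp_basis p1 1) _ q0.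
have c1 j : normc (l * x (j + k%:Z) - (j == 0)%:R) < 4^-1.
  have := le_lt_trans (coord_le_nrm _ j) h1.
  change (normc (l * iter k T x j - (j == 0)%:R) < 4^-1 ->
    normc (l * x (j + k%:Z) - (j == 0)%:R) < 4^-1).
  by rewrite (unit_weights_iter _ _ _ bT).
have c2 j : normc (m * x (j + k'%:Z) - ((j == 0)%:R + (j == 1)%:R)) < 4^-1.
  have := le_lt_trans (coord_le_nrm _ j) h2.
  change (normc (m * iter k' T x j - ((j == 0)%:R + (j == 1)%:R)) < 4^-1 ->
    normc (m * x (j + k'%:Z) - ((j == 0)%:R + (j == 1)%:R)) < 4^-1).
  by rewrite (unit_weights_iter _ _ _ bT).
have small i : i != k%:Z -> normc l * normc (x i) < 4^-1.
  move=> ik; have := c1 (i - k%:Z); rewrite subrK subr_eq0 (negPf ik) subr0.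
  by rewrite normcM.
have big0 : 3 / 4 < normc l * normc (x k%:Z).
  by have := c1 0; rewrite add0r eqxx -normcM; exact: normc_near1.
have upper i : normc m * normc (x i) < 5 / 4.
  have := c2 (i - k'%:Z); rewrite subrK -normcM => /normc_near_le; apply.
  case: (i - k'%:Z =P 0) => [->|_]; first by rewrite addr0 normc1.
  by rewrite add0r; case: (_ == _); rewrite ?normc1 ?normc0.
have [i ik mi] : exists2 i, i != k%:Z & 3 / 4 < normc m * normc (x i).
  have lower j : ((j == 0) || (j == 1)) -> 3 / 4 < normc m * normc (x (j + k'%:Z)).
    move=> jj; have := c2 j.
    have -> : (j == 0)%:R + (j == 1)%:R = 1 :> R[i].
      by case/orP: jj => /eqP ->; rewrite ?addr0 ?add0r.
    by rewrite -normcM; exact: normc_near1.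
  have [kk|kk] := eqVneq (0 + k'%:Z) k%:Z.
    by exists (1 + k'%:Z); [lia|exact: lower].
  by exists (0 + k'%:Z) => //; exact: lower.
have s := small i ik; have u := upper k%:Z.
clear h1 h2 c1 c2 dx small upper.
have nl := normc_ge0 l; have nm := normc_ge0 m.
have ni := normc_ge0 (x i); have nk := normc_ge0 (x k%:Z).
move: (normc l) (normc m) (normc (x i)) (normc (x k%:Z)) nl nm ni nk s u big0 mi.
move=> L N X Y L0 N0 X0 Y0 s u big0 mi.
have : (L * X) * (N * Y) <= 4^-1 * (5 / 4).
  by apply: ler_pM; rewrite ?mulr_ge0//; exact: ltW.
have : 3 / 4 * (3 / 4) <= (L * Y) * (N * X).
  by apply: ler_pM => //; rewrite ?divr_ge0//; exact: ltW.
lra.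
Qed.

(** The l-th block has norm about e l = (l + 1)^(- (p - 1) / p), and the p-th powers of
these have a finite sum because p > 2.  At time n k, relative to the scalar eps k,
all the other blocks together have a norm of p-th power O(k^(p - 1)), the
admissible growth.  Only later blocks too long to be spread are left; n k is chosen
after the length of the first l0 k blocks, so their index is at least l0 k, and the
tail of the convergent sum is small. *)
Lemma unit_weakly_supercyclic (T : V -> V) : 2 < p -> diag_shift unit_weights 1 T ->
  weakly_supercyclic T.
Proof.
move=> p2 bT; have [_ b0 _ _] := bT.
have p0 : 0 < p by lra.
have pN0 : p != 0 by rewrite gt_eqF.
have [v [r [om [[v0 r0 om00] vs [om0 omlog omd] vom vd]]]] := repeated_dense_family p1 unit_weights.
pose e (l : nat) : R := l.+1%:R `^ (- (p - 1) / p).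
have e0 l : 0 < e l by rewrite powR_gt0// ltr0n.
have ep l : e l `^ p = l.+1%:R `^ (- (p - 1)) by rewrite -powRrM divfK.
pose eps l := e l / om l.
have eps0 l : 0 < eps l by rewrite divr_gt0.
have epsom l : eps l * om l = e l by rewrite divfK// gt_eqF.
have [Z hZ] : exists Z : R, forall L, \sum_(l < L) e l `^ p <= Z.
  have [|Z hZ] := @counted_powR_sum R (p - 1); first by lra.
  exists Z => L; under eq_bigr do rewrite ep.
  rewrite -(big_mkord predT (fun l => l.+1%:R `^ (- (p - 1)))) /index_iota subn0.
  apply: (hZ _ (iota 0 L) succn) => // t.
  apply: (@leq_trans t); last by lia.
  rewrite -size_filter -[leqRHS](size_iota 0); apply: uniq_leq_size.
    by rewrite filter_uniq// iota_uniq.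
  by move=> l; rewrite mem_filter !mem_iota => /andP[].
have /choice[l0 hl0] : forall k, exists l0, forall L,
    \sum_(l < L | (l0 <= l)%N) e l `^ p <= eps k `^ p * 2^-1 ^+ k.
  move=> k; apply: (bounded_sum_tail (F := fun l => e l `^ p) _ hZ).
    by move=> l; exact: powR_ge0.
  by rewrite mulr_gt0 ?powR_gt0 ?exprn_gt0 ?invr_gt0.
pose gap k := (\sum_(l < l0 k) 2 * r l)%N.
have [n [n0 rapid]] := rapid_sequence r gap.
have sep k l : (k < l)%N -> (n k + r k + r l < n l)%N by move=> /rapid; lia.
have part k l (j : int) : eps l * om l <= e l * normc (unit_weights (j + (n l)%:Z - (n k)%:Z)).
  by rewrite epsom normc1 mulr1.
have [x [xb x0]] : exists x : V, (forall l i, window r n l i -> x i = block unit_weights v n eps l 0 i) /\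
    forall i, (forall l, ~~ window r n l i) -> x i = 0.
  apply: (@block_vector_exists _ _ p1 _ _ _ _ _ _ b0 eps0 om0 vs vom sep e Z) => //.
    by move=> l; exact: ltW.
  by move=> l j jl; have := part 0%N l j; rewrite n0 subr0.
exists x; apply/weakly_denseP => y N f d d0.
have pgt1 : 1 < p by lra.
have Z0 : 0 <= Z by have := hZ 0%N; rewrite big_ord0.
have spread_small i : exists C : R, forall t,
    nrm (spread_part T v r n eps x (dyadic i t)) `^ p <=
    eps (dyadic i t) `^ p * (C * t.+1%:R `^ (p - 1)).
  exists (Z * om (dyadic i 0) `^ p * (2 ^ i.+1)%:R `^ (p - 1)) => t.
  set k := dyadic i t.
  have zt : Z <= eps k `^ p * (Z * om (dyadic i 0) `^ p * (2 ^ i.+1)%:R `^ (p - 1) * t.+1%:R `^ (p - 1)).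
    rewrite -(omd i t) -/k.
    have -> : eps k `^ p * (Z * om k `^ p * (2 ^ i.+1)%:R `^ (p - 1) * t.+1%:R `^ (p - 1)) =
      Z * (e k `^ p * ((2 ^ i.+1)%:R * t.+1%:R) `^ (p - 1)).
      have -> : e k `^ p = eps k `^ p * om k `^ p by rewrite -powRM ?epsom// ltW.
      by rewrite (powRM (p - 1) (ler0n R _) (ler0n R _)); ring.
    rewrite ler_peMr// ep powRN mulrC ler_pdivlMr ?powR_gt0 ?ltr0n// mul1r.
    apply: ge0_ler_powR; rewrite ?nnegrE ?mulr_ge0 ?ler0n//; first by lra.
    rewrite -natrM ler_nat /k /dyadic expnS.
    have : (0 < 2 ^ i)%N by rewrite expn_gt0.
    by move: (2 ^ i)%N => w; nia.
  apply: le_trans zt.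
  apply: (@spread_part_le _ _ p1 _ _ _ _ _ _ gap _ _ _ bT eps0 om0 vs vom rapid xb x0 k e) => //.
    by move=> l; exact: ltW.
  move=> L; apply: le_trans (hZ L).
  rewrite [leRHS](bigID (fun l : 'I_L => (nat_of_ord l != k) && spread r n k l))/= lerDl.
  by apply: sumr_ge0 => *; exact: powR_ge0.
have far_small k : (0 < k)%N -> nrm (far_part T v r n eps x k) `^ p <= eps k `^ p * 2^-1 ^+ k.
  move=> k0.
  apply: (@far_part_le _ _ p1 _ _ _ _ _ _ gap _ _ _ bT eps0 om0 vs vom rapid xb x0 k e) => //.
    by move=> l; exact: ltW.
  move=> L; apply: le_trans (hl0 k L).
  rewrite [leLHS]big_mkcond [leRHS]big_mkcond; apply: ler_sum => l _.
  case: ifP => [/andP[lk]|_]; last by case: ifP => // _; exact: powR_ge0.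
  rewrite /spread negb_or -!leqNgt => /andP[kl nl].
  case: leqP => // ll0; exfalso.
  have h : (2 * r l <= gap k)%N by rewrite /gap (bigD1 (Ordinal ll0))//= leq_addr.
  have := rapid 0%N k k0; lia.
have [k hk] := lacunary_weak_density eps0 rapid pgt1 vd spread_small far_small y N f d0.
exists ((eps k)^-1%:C%C *: iter (n k) T x) => //.
by exists (eps k)^-1%:C%C, (n k).
Qed.

End weakly_supercyclic_example.

(** * Weak supercyclicity for p at most 2 *)

(** If the criterion fails for the window of radius N and all m, then it fails at
some coordinate within the window; the bound on the quotients of b moves this
failure to the coordinate N, which is to the right of all the others. *)
Section failure_of_criterion.
Variables (R : realType) (p : R) (p1 : 1 <= p).
Local Notation V := (lp p1).
Variables (b : int -> R[i]) (M : R) (T : V -> V).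
Hypothesis bT : diag_shift b M T.

Let nb0 j : 0 < normc (b j). Proof. by case: bT => _ b0 _ _; exact: normc_gt0. Qed.

Lemma criterion_hypercyclic :
  (forall (N : nat) (C : R), exists (m : nat),
     forall j : int, (`|j| <= N)%N -> C <= normc (b (j + m%:Z)) /\
        C <= normc (b (j - m%:Z))) -> hypercyclic T.
Proof.
move=> crit; have [|x hx] := @block_criterion _ _ p1 b M T [set 1] bT.
  move=> N C; have [m hm] := crit N C; exists m, 1; split=> //.
  by rewrite mulr1 divr1.
exists x; apply/denseP => y d d0; have [k [e [-> _ h]]] := hx y d d0.
exists (iter k T x); first by exists k.
by move: h; rewrite invr1 scale1r.
Qed.

Lemma criterion_supercyclic :
  (forall (N : nat) (C : R), exists (m : nat) (e : R), 0 < e /\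
     forall j : int, (`|j| <= N)%N -> C * e <= normc (b (j + m%:Z)) /\
        C / e <= normc (b (j - m%:Z))) -> supercyclic T.
Proof.
move=> crit; have [|x hx] := @block_criterion _ _ p1 b M T setT bT.
  by move=> N C; have [m [e [e0 hm]]] := crit N C; exists m, e; split.
exists x; apply/denseP => y d d0; have [k [e [_ _ h]]] := hx y d d0.
by exists (e^-1%:C%C *: iter k T x) => //; exists e^-1%:C%C, k.
Qed.

Let spread_bound (N : nat) (i j : int) : (`|j| <= N)%N ->
  normc (b (N%:Z + i)) <= M ^+ (2 * N) * normc (b (j + i)).
Proof.
move=> jN; have [M1 _ _ _] := bT.
have [k kE kN] : exists2 k : nat, N%:Z + i = j + i + k%:Z & (k <= 2 * N)%N.
  by exists (absz (N%:Z - j)); lia.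
rewrite kE; apply: (le_trans (diag_shift_bound _ _ bT)).
by rewrite ler_wpM2r ?normc_ge0// ler_weXn2l.
Qed.

Lemma not_hypercyclic_weights : ~ hypercyclic T -> exists (N : nat) (K : R), 0 < K /\
  forall m : nat, normc (b (N%:Z + m%:Z)) <= K \/ normc (b (N%:Z - m%:Z)) <= K.
Proof.
move=> nh; have [M1 _ _ _] := bT; apply: contrapT => h; apply: nh.
apply: criterion_hypercyclic => N C; apply: contrapT => hN; apply: h.
have M0 : 0 < M ^+ (2 * N) by rewrite exprn_gt0// (lt_le_trans ltr01).
exists N, (M ^+ (2 * N) * (`|C| + 1)); split; first by rewrite mulr_gt0// ltr_wpDl.
move=> m; apply: contrapT => /not_orP[/negP h1 /negP h2]; apply: hN; exists m => j jN.
rewrite -ltNge in h1; rewrite -ltNge in h2.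
have CC : C <= `|C| + 1 by rewrite (le_trans (ler_norm C))// lerDl.
by split; apply: (le_trans CC); rewrite -(ler_pM2l M0);
  [apply: (le_trans (ltW h1))|apply: (le_trans (ltW h2))]; exact: spread_bound.
Qed.

Lemma not_supercyclic_weights : ~ supercyclic T -> exists (N : nat) (K : R),
  forall m : int, normc (b (N%:Z + m)) * normc (b (N%:Z - m)) <= K.
Proof.
move=> ns; have [M1 _ _ _] := bT; apply: contrapT => h; apply: ns.
apply: criterion_supercyclic => N C; apply: contrapT => hN; apply: h.
pose S : R := M ^+ (2 * N).
have S0 : 0 < S by rewrite exprn_gt0// (lt_le_trans ltr01).
pose D := S * (`|C| + 1).
have D0 : 0 < D by rewrite mulr_gt0// ltr_wpDl.
have CC : C <= `|C| + 1 by rewrite (le_trans (ler_norm C))// lerDl.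
have nat_case (m : nat) : normc (b (N%:Z + m%:Z)) * normc (b (N%:Z - m%:Z)) <= D ^+ 2.
  rewrite leNgt; apply/negP => hm; apply: hN.
  set A := normc (b (N%:Z + m%:Z)) in hm *; set B := normc (b (N%:Z - m%:Z)) in hm *.
  have A0 : 0 < A := nb0 _; have B0 : 0 < B := nb0 _.
  have AB0 : 0 <= A / B by rewrite divr_ge0// ltW.
  (* With this choice A / e and B * e coincide. *)
  pose e := Num.sqrt (A / B).
  have e0 : 0 < e by rewrite sqrtr_gt0 divr_gt0.
  have ee : e ^+ 2 = A / B by rewrite sqr_sqrtr.
  have De0 : 0 <= D * e by exact: mulr_ge0 (ltW D0) (ltW e0).
  have Be0 : 0 <= B * e by exact: mulr_ge0 (ltW B0) (ltW e0).
  have h1 : D * e <= A.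
    rewrite -(@ler_pXn2r _ 2)// ?nnegrE ?De0 ?(ltW A0)//.
    rewrite exprMn ee mulrA ler_pdivrMr//.
    by have := ler_wpM2l (ltW A0) (ltW hm); rewrite expr2 [in X in _ -> X]expr2; lra.
  have h2 : D / e <= B.
    rewrite ler_pdivrMr// -(@ler_pXn2r _ 2)// ?nnegrE ?Be0 ?(ltW D0)//.
    rewrite [leRHS]exprMn ee; apply: (le_trans (ltW hm)).
    by rewrite le_eqVlt; apply/orP; left; apply/eqP; field; rewrite gt_eqF.
  exists m, e; split=> // j jN; split.
    rewrite -(ler_pM2l S0); apply: le_trans (spread_bound m%:Z jN).
    apply: le_trans h1; rewrite mulrA ler_wpM2r ?(ltW e0)// /D ler_wpM2l// ltW//.
  rewrite -(ler_pM2l S0); apply: le_trans (spread_bound (- m%:Z) jN).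
  by apply: le_trans h2; rewrite mulrA ler_wpM2r ?invr_ge0 ?(ltW e0)// /D ler_wpM2l// ltW.
exists N, (D ^+ 2) => -[m|m]; first exact: nat_case.
by rewrite NegzE opprK mulrC; exact: nat_case.
Qed.

End failure_of_criterion.

Section weakly_supercyclic.
Variables (R : realType) (p : R) (p1 : 1 <= p).
Local Notation V := (lp p1).

Lemma sum_sq_le (z : V) s : p <= 2 -> uniq s ->
  \sum_(j <- s) normc (z j) ^+ 2 <= nrm z ^+ 2.
Proof.
move=> p2 us; have [z0|zN0] := eqVneq (nrm z) 0.
  rewrite big1 ?z0 ?expr0n// => j _.
  have -> : normc (z j) = 0 by apply/eqP; rewrite eq_le normc_ge0 -z0 coord_le_nrm.
  by rewrite expr0n.
have zgt0 : 0 < nrm z by rewrite lt0r zN0 nrm_ge0.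
apply: (@le_trans _ _ (\sum_(j <- s) nrm z ^+ 2 * (normc (z j) / nrm z) `^ p)).
  apply: ler_sum => j _; have [->|zj] := eqVneq (normc (z j)) 0.
    by rewrite expr0n mulr_ge0 ?sqr_ge0 ?powR_ge0.
  have -> : normc (z j) ^+ 2 = nrm z ^+ 2 * (normc (z j) / nrm z) ^+ 2.
    by field; rewrite gt_eqF.
  rewrite ler_wpM2l ?sqr_ge0// -powR_mulrn ?divr_ge0 ?normc_ge0 ?nrm_ge0//.
  apply: ger_powR => //; rewrite divr_gt0//= ?lt0r ?zj ?normc_ge0//.
  by rewrite ler_pdivrMr// mul1r coord_le_nrm.
rewrite -mulr_sumr ler_piMr ?sqr_ge0//.
under eq_bigr do rewrite powRM ?normc_ge0 ?invr_ge0 ?nrm_ge0//.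
rewrite -mulr_suml -powR_inv1 ?nrm_ge0// -powRrM mulN1r powRN.
by rewrite ler_pdivrMr ?(powR_gt0 _ zgt0)// mul1r sum_le_nrm.
Qed.

(** Fix a time m0 at which the coordinates r and r + 1 of the orbit do not vanish.
Coordinate r + m0 - n of T^n x comes from the same coordinate r + m0 of x as
coordinate r of T^m0 x does.  Normalized by coordinate r, it is so large that the
functional carried by it alone has norm at most K' times the modulus of
coordinate r + n - m0 of T^m0 x: these are square summable. *)
Lemma weakly_supercyclic_supercyclic (T : {linear V -> V}) : p <= 2 ->
  bilateral_weighted_shift T -> weakly_supercyclic T -> supercyclic T.
Proof.
move=> p2 wT [x /weakly_denseP wx]; have [b [M bT]] := weighted_shift_diag wT.
have [_ b0 _ _] := bT; have nb0 j : 0 < normc (b j) by exact: normc_gt0.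
apply: contrapT => /(not_supercyclic_weights bT)[N0 [K bK]].
set r : int := N0%:Z in bK.
have r1r : (r + 1 == r) = false by lia.
pose X n := iter n T x.
have XE n j : X n j = b (j + n%:Z) / b j * x (j + n%:Z) by exact: diag_shift_iter bT.
have [cr crE] := coord_functional p1 r.
have [cs csE] := coord_functional p1 (r + 1).
have half0 : 0 < 2^-1 :> R by rewrite invr_gt0.
have [m0 [Xr Xs]] : exists m0, X m0 r != 0 /\ X m0 (r + 1) != 0.
  have [z [l [m0 ->]] hz] := wx (lp_basis p1 r + lp_basis p1 (r + 1)) 2%N
    (fun i => if i is 0%N then cr else cs) _ half0.
  have := hz 0%N isT; have := hz 1%N isT; rewrite crE csE.
  change (normc (l * X m0 (r + 1) - ((r + 1 == r)%:R + (r + 1 == r + 1)%:R)) < 2^-1 ->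
    normc (l * X m0 r - ((r == r)%:R + (r == r + 1)%:R)) < 2^-1 ->
    exists m0, X m0 r != 0 /\ X m0 (r + 1) != 0).
  rewrite r1r.
  have -> : (r == r + 1) = false by lia.
  rewrite !eqxx add0r addr0 => h1 h2; exists m0; split; apply/eqP => h.
    by move: h2; rewrite h mulr0 sub0r normcN normc1; lra.
  by move: h1; rewrite h mulr0 sub0r normcN normc1; lra.
have nXr := normc_gt0 Xr; have nXs := normc_gt0 Xs.
pose I n := (n != m0) && (X n r != 0).
pose j_ (n : nat) : int := r + m0%:Z - n%:Z.
pose y n : V := ((normc (X n r))^-1)%:C%C *: X n.
have yE n j : y n j = ((normc (X n r))^-1)%:C%C * X n j by [].
have Xj n : normc (X n (j_ n)) = normc (X m0 r) * normc (b r) / normc (b (j_ n)).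
  rewrite !XE; have -> : j_ n + n%:Z = r + m0%:Z by rewrite /j_; lia.
  by rewrite !normcM !normcV; field; rewrite !gt_eqF.
have Xj0 n : 0 < normc (X n (j_ n)) by rewrite Xj divr_gt0// mulr_gt0.
have yj0 n : I n -> y n (j_ n) != 0.
  move=> /andP[_ Xn]; have nXn := normc_gt0 Xn; apply/eqP => h.
  have : 0 < normc (y n (j_ n)).
    by rewrite yE normcM normcR gtr0_norm ?invr_gt0// mulr_gt0// invr_gt0.
  by rewrite h normc0 ltxx.
pose h n j := if j == j_ n then (y n (j_ n))^-1 else 0.
pose g n := (normc (X n r) / normc (X n (j_ n))) ^+ 2.
pose K' := K / (normc (b r) ^+ 2 * normc (X m0 r)).
have K0 : 0 <= K' .
  rewrite divr_ge0 ?mulr_ge0 ?sqr_ge0 ?normc_ge0//.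
  by apply: le_trans (bK 0); rewrite mulr_ge0 ?normc_ge0.
have gle n : normc (X n r) / normc (X n (j_ n)) <= K' * normc (X m0 (r + n%:Z - m0%:Z)).
  have bb := bK (n%:Z - m0%:Z).
  have j2 : r - (n%:Z - m0%:Z) = j_ n by rewrite /j_ opprB addrA.
  have i2 : r + (n%:Z - m0%:Z) = r + n%:Z - m0%:Z by rewrite addrA.
  rewrite j2 i2 in bb.
  set Y := normc (X m0 _); set B1 := normc (b (r + n%:Z - m0%:Z)) in bb.
  have e1 : normc (X n r) = Y * B1 / normc (b r).
    rewrite /Y /B1 !XE; rewrite subrK.
    by rewrite !normcM !normcV; field; rewrite !gt_eqF.
  rewrite Xj e1; set B2 := normc (b (j_ n)) in bb *.
  have -> : Y * B1 / normc (b r) / (normc (X m0 r) * normc (b r) / B2) =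
      B1 * B2 * (Y / (normc (b r) ^+ 2 * normc (X m0 r))).
    by field; rewrite /B2 !gt_eqF.
  rewrite /K' [leRHS]mulrAC -[leRHS]mulrA; apply: ler_wpM2r bb.
  by rewrite divr_ge0 ?mulr_ge0 ?sqr_ge0 ?normc_ge0.
have [F [F0 FX]] : exists F : functional p1, sval F (lp_basis p1 r) = 0 /\
    forall n, I n -> 1 <= normc (sval F (y n)).
  (* s = 1, that is q = 2: the hypothesis of the plank theorem is p - 1 <= 1. *)
  apply: (@infinite_plank R p p1 1 _ _ I y h (fun n => [:: j_ n]) g
    (K' ^+ 2 * nrm (X m0) ^+ 2)).
  - by rewrite lexx ler1n.
  - by rewrite mulr1; lra.
  - move=> n /andP[nm _]; split=> //.
      by move=> j; rewrite inE /h => /negPf ->.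
    by rewrite inE /j_; move: nm; lia.
  - by move=> n In; rewrite big_seq1 /h eqxx mulVf// yj0.
  - move=> n In; have /andP[_ Xn] := In; split; first exact: (exprn_gt0 2 (divr_gt0 (normc_gt0 Xn) (Xj0 n))).
    rewrite /qsum big_seq1 mulr1 powRr1 ?sqr_ge0// /h eqxx powR_mulrn ?normc_ge0//.
    rewrite normcV yE normcM normcR ger0_norm ?invr_ge0 ?normc_ge0// /g.
    by rewrite invfM invrK.
  - move=> L; apply: (@le_trans _ _ (\sum_(n < L | I n) K' ^+ 2 *
        normc (X m0 (r + (n : nat)%:Z - m0%:Z)) ^+ 2)).
      apply: ler_sum => n _; rewrite /g -exprMn.
      apply: lerXn2r (gle n); rewrite nnegrE.
        exact: divr_ge0 (normc_ge0 _) (normc_ge0 _).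
      exact: mulr_ge0 K0 (normc_ge0 _).
    rewrite -mulr_sumr ler_wpM2l ?sqr_ge0//.
    have us : uniq [seq r + n%:Z - m0%:Z | n <- [seq n <- iota 0 L | I n]].
      by rewrite map_inj_uniq ?filter_uniq ?iota_uniq// => a c; lia.
    apply: le_trans (sum_sq_le (X m0) p2 us).
    rewrite big_map big_filter -(big_mkord I (fun n => normc (X m0 (r + n%:Z - m0%:Z)) ^+ 2)).
    by rewrite /index_iota subn0.
(* The multiples of T^m0 x itself are kept away from e_r by coordinate r + 1. *)
pose kap := normc (X m0 r) / normc (X m0 (r + 1)).
have kap0 : 0 <= kap by rewrite divr_ge0 ?normc_ge0.
pose e := (2 * (1 + kap))^-1.
have e0 : 0 < e by rewrite invr_gt0 mulr_gt0// ltr_wpDr.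
have e2 : e <= 2^-1.
  rewrite /e invfM ler_piMr// invf_le1 ?lerDl//; lra.
have ke : kap * e <= 2^-1.
  rewrite /e invfM mulrCA ler_piMr// ler_pdivrMr; lra.
have [_ [l [n ->]] hz] := wx (lp_basis p1 r) 3%N
  (fun i => if i is 0%N then cr else if i is 1%N then F else cs) e e0.
have z0 := hz 0%N isT; have z1 := hz 1%N isT; have z2 := hz 2%N isT.
rewrite crE in z0; rewrite csE in z2.
have {}z0 : normc (l * X n r - 1) < e.
  by move: z0; change (normc (l * X n r - (r == r)%:R) < e -> normc (l * X n r - 1) < e); rewrite eqxx.
have {}z2 : normc (l * X n (r + 1)) < e.
  move: z2; change (normc (l * X n (r + 1) - (r + 1 == r)%:R) < e -> normc (l * X n (r + 1)) < e).
  by rewrite r1r subr0.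
have {}z1 : normc (l * sval F (X n)) < e.
  by move: z1; rewrite linearB F0 subr0 linearZ.
have lX : 2^-1 < normc l * normc (X n r).
  rewrite -normcM; have h1 : normc (1 - l * X n r) < e by rewrite -normcN opprB.
  have h2 := ler_normcD (l * X n r) (1 - l * X n r).
  rewrite addrC subrK normc1 in h2; move: (normc _) (normc (1 - _)) h1 h2 => u w; lra.
rewrite !normcM in z1 z2.
have nl := normc_ge0 l.
have [nm|nm] := eqVneq n m0.
  rewrite nm in lX z2; have : normc l * normc (X m0 r) <= kap * e.
    have -> : normc (X m0 r) = kap * normc (X m0 (r + 1)) by rewrite /kap divfK// gt_eqF.
    by rewrite mulrCA ler_wpM2l// ltW.
  by move=> lk; move: (lt_le_trans lX (le_trans lk ke)); rewrite ltxx.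
have Xn0 : X n r != 0.
  by apply/eqP => z; move: lX; rewrite z normc0 mulr0; apply/negP; rewrite -leNgt ltW.
have In : I n by rewrite /I nm.
have : normc (X n r) <= normc (sval F (X n)).
  have nXn := normc_gt0 Xn0; have := FX n In.
  have -> : sval F (y n) = ((normc (X n r))^-1)%:C%C * sval F (X n) by rewrite /y linearZ.
  by rewrite normcM normcR gtr0_norm ?invr_gt0// ler_pdivlMl// mulr1.
move=> hF; have h' := ler_wpM2l nl hF.
by have := lt_trans (lt_le_trans lX h') (lt_le_trans z1 e2); rewrite ltxx.
Qed.

End weakly_supercyclic.

(** * Weak hypercyclicity for p below 2 *)

Section large_coordinates.
Variables (R : realType) (p : R) (p1 : 1 <= p).
Local Notation V := (lp p1).

Lemma large_coord_seq (z : V) (a : R) : 0 < a ->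
  exists s : seq int, forall j, a <= normc (z j) -> j \in s.
Proof.
move=> a0; pose A := [set j : int | a <= normc (z j)].
suff fA : finite_set A.
  by exists (fset_set A) => j aj; rewrite in_fset_set// inE.
apply: contrapT => iA.
have a0' : 0 < a `^ p by exact: powR_gt0.
have [B BA] := infinite_set_fset (Num.truncn (nrm z `^ p / a `^ p)).+1 iA.
apply/negP; rewrite -ltnNge -(ltr_nat R).
apply: le_lt_trans (truncnS_gt (nrm z `^ p / a `^ p)).
rewrite ler_pdivlMr//; apply: le_trans (sum_le_nrm z (fset_uniq B)).
have -> : #|` B|%:R * a `^ p = \sum_(j <- B) a `^ p.
  by rewrite big_const_seq iter_addr_0 count_predT mulr_natl.
rewrite big_seq [leRHS]big_seq; apply: ler_sum => j jB.
apply: ge0_ler_powR; rewrite ?nnegrE ?normc_ge0 ?(ltW a0) ?(le_trans ler01 p1)//.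
exact: BA.
Qed.

End large_coordinates.

(** The number of pairs is at most the number of edges in both directions. *)
Lemma tournament_size (I : eqType) (e : rel I) (s : seq I) (t : nat) : uniq s ->
  {in s &, forall n m, n != m -> e n m || e m n} ->
  {in s, forall n, (count (e n) s <= t)%N} -> (size s <= 2 * t + 1)%N.
Proof.
move=> us es st; case: (posnP (size s)) => [->//|s0].
rewrite -(leq_pmul2r s0).
have count_sum (P : pred I) : (\sum_(m <- s) (P m : nat) = count P s)%N.
  by rewrite -sum1_count [RHS]big_mkcond; apply: eq_bigr => m _; case: (P m).
have sum_const c : (\sum_(n <- s) c = c * size s)%N.
  by rewrite big_const_seq iter_addn_0 count_predT.
have -> : (size s * size s = \sum_(n <- s) \sum_(m <- s) 1)%N.
  by rewrite sum1_size sum_const.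
apply: (@leq_trans (\sum_(n <- s) \sum_(m <- s) ((m == n) + e n m + e m n))).
  rewrite big_seq [leqRHS]big_seq; apply: leq_sum => n ns.
  rewrite big_seq [leqRHS]big_seq; apply: leq_sum => m ms.
  have [//|mn] := eqVneq m n.
  by have := es m n ms ns mn; case: (e n m); case: (e m n).
under eq_bigr do rewrite !big_split /=.
rewrite !big_split /= [X in (_ + X)%N]exchange_big /= -addnA addnn.
rewrite mulnDl mul1n addnC -mul2n -mulnA leq_add//.
  rewrite leq_mul2l /= -sum_const big_seq [leqRHS]big_seq.
  by apply: leq_sum => n ns; rewrite count_sum st.
rewrite -[leqRHS]sum1_size big_seq [leqRHS]big_seq.
by apply: leq_sum => n ns; rewrite count_sum count_uniq_mem// leq_b1.
Qed.

Section weakly_hypercyclic.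
Variables (R : realType) (p : R) (p1 : 1 <= p).
Local Notation V := (lp p1).

(** The two sides are the penalty of d equal coefficients of modulus 1 / (d a), and the
s-th power of the weight that the plank theorem asks for. *)
Lemma equal_weights_balance (d a s : R) : 0 < d -> 0 < a -> 0 < s ->
  d * (d^-1 / a) `^ (2 * s) = (a^-1 ^+ 2 * d `^ (- (2 - s^-1))) `^ s.
Proof.
move=> d0 a0 s0; have ai0 : 0 <= a^-1 by rewrite invr_ge0 ltW.
rewrite powRM ?invr_ge0 ?(ltW d0) ?(ltW a0)// [RHS]powRM ?sqr_ge0 ?powR_ge0//.
rewrite -(powR_mulrn 2 ai0) -!powRrM -(powR_inv1 (ltW d0)) -powRrM.
rewrite mulrA mulrC; congr (_ * _).
rewrite -{1}(powRr1 (ltW d0)) -powRD; last by rewrite (gt_eqF d0) implybT.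
by congr (_ `^ _); field; rewrite gt_eqF.
Qed.

(** With s = (4 - p) / 2 one has (p - 1)(2 s - 1) = 1 - (p - 2)^2 <= 1, and p < 2
means that s > 1, so the weights d^-(2 - 1 / s) have an exponent larger than 1: they
are summable when at most 3 t sets D n have size at most t. *)
Lemma equal_weights_plank (y : nat -> V) (D : nat -> seq int) (a : R) (r : int) :
  p < 2 -> 0 < a ->
  (forall n, uniq (D n)) -> (forall n, r \notin D n) ->
  (forall n j, j \in D n -> a <= normc (y n j)) ->
  forall I : pred nat, (forall n, I n -> (0 < size (D n))%N) ->
  (forall L t, (count (fun n => size (D n) <= t)%N [seq n <- iota 0 L | I n] <= 3 * t)%N) ->
  exists F : functional p1, sval F (lp_basis p1 r) = 0 /\
    forall n, I n -> 1 <= normc (sval F (y n)).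
Proof.
move=> p2 a0 uD rD aD I I0 Icount.
pose s := (4 - p) / 2.
have s2 : 2 * s = 4 - p by rewrite /s; field.
have p1' := p1; have s1 : 1 < s by lra.
have s12 : 1 <= s <= 2 by apply/andP; split; lra.
have pq : (p - 1) * (2 * s - 1) <= 1.
  rewrite s2 -subr_ge0 (_ : _ - _ = (p - 2) ^+ 2) ?sqr_ge0//; ring.
have s0 : 0 < s by lra.
have al1 : 1 < 2 - s^-1.
  have : s^-1 < 1 by rewrite invf_lt1.
  by lra.
have [C hC] := counted_powR_sum al1.
have y0 n j : j \in D n -> y n j != 0.
  by move=> /aD; apply: contraTneq => ->; rewrite normc0 -ltNge.
pose d n : R := (size (D n))%:R.
pose g n := a^-1 ^+ 2 * d n `^ (- (2 - s^-1)).
pose h n j := if j \in D n then (d n)^-1%:C%C / y n j else 0.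
apply: (@infinite_plank R p p1 s s12 pq I y h D g (a^-1 ^+ 2 * C)) => //.
- by move=> n In; split=> // j; rewrite /h => /negPf ->.
- move=> n In; rewrite big_seq.
  under eq_bigr => j jD do rewrite /h jD divfK ?y0//.
  rewrite -big_seq big_const_seq iter_addr_0 count_predT.
  have dC : (size (D n))%:R = (d n)%:C%C by rewrite rmorph_nat.
  by rewrite -mulr_natl dC -rmorphM mulfV// pnatr_eq0 -lt0n I0.
- move=> n In; have d0 : 0 < d n by rewrite ltr0n I0.
  split; first by rewrite mulr_gt0 ?exprn_gt0 ?invr_gt0 ?powR_gt0.
  rewrite /qsum; apply: (@le_trans _ _ (\sum_(j <- D n) ((d n)^-1 / a) `^ (2 * s))).
    rewrite big_seq [leRHS]big_seq; apply: ler_sum => j jD.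
    apply: ge0_ler_powR; first by lra.
    - by rewrite nnegrE normc_ge0.
    - by rewrite nnegrE divr_ge0 ?invr_ge0 ?(ltW d0) ?(ltW a0).
    rewrite /h jD normcM normcV normcR ger0_norm ?invr_ge0 ?(ltW d0)//.
    rewrite ler_wpM2l ?invr_ge0 ?(ltW d0)// lef_pV2 ?posrE//; first exact: aD.
    exact: lt_le_trans a0 (aD _ _ jD).
  rewrite big_const_seq iter_addr_0 count_predT -[leLHS]mulr_natl -/(d n).
  by rewrite (equal_weights_balance d0 a0 s0).
- move=> L; rewrite -(big_mkord I) -big_filter /g -mulr_sumr ler_wpM2l ?sqr_ge0//.
  rewrite /index_iota subn0; apply: hC => [i|t]; last exact: Icount.
  by rewrite mem_filter => /andP[/I0].
Qed.

(** A n m says that m is a relevant time and that T^n x is large at coordinate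
r + m - n.  The failure of the criterion, applied to m - n, makes A a tournament
on relevant times, and D n, the set of m with A n m, is finite because T^n x has
finitely many large coordinates.  At most one relevant n0 has D n0 empty; the
functional F ignores it, and one of the targets e_r and 2 e_r is at a positive
distance from T^n0 x, as witnessed by some coordinate j. *)
Lemma weakly_hypercyclic_hypercyclic (T : {linear V -> V}) : p < 2 ->
  bilateral_weighted_shift T -> weakly_hypercyclic T -> hypercyclic T.
Proof.
move=> p2 wT [x /weakly_denseP wx]; have [b [M bT]] := weighted_shift_diag wT.
have [_ b0 _ _] := bT; have nb0 j : 0 < normc (b j) by exact: normc_gt0.
apply: contrapT => /(not_hypercyclic_weights bT)[N0 [K [K0 bK]]].
set r : int := N0%:Z in bK.
pose X n := iter n T x.
have XE n j : X n j = b (j + n%:Z) / b j * x (j + n%:Z) by exact: diag_shift_iter bT.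
have half0 : 0 < 2^-1 :> R by rewrite invr_gt0.
pose inN n := 2^-1 < normc (X n r).
pose A n m := [&& inN m, m != n & normc (b (r + m%:Z - n%:Z)) <= K].
pose a := normc (b r) / (2 * K).
have a0 : 0 < a by rewrite divr_gt0// mulr_gt0.
have Alarge n m : A n m -> a <= normc (X n (r + m%:Z - n%:Z)).
  move=> /and3P[mN _ bm]; set B := normc (b _) in bm.
  have B0 : 0 < B by exact: nb0.
  have -> : normc (X n (r + m%:Z - n%:Z)) = normc (X m r) * normc (b r) / B.
    rewrite !XE; have -> : r + m%:Z - n%:Z + n%:Z = r + m%:Z by lia.
    by rewrite !normcM !normcV /B; field; rewrite !gt_eqF.
  have h1 : 2^-1 * normc (b r) <= normc (X m r) * normc (b r).
    by rewrite ler_wpM2r ?normc_ge0// ltW.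
  rewrite ler_pdivlMr//; apply: le_trans h1.
  have -> : a * B = 2^-1 * normc (b r) * (B / K) by rewrite /a; field; rewrite gt_eqF.
  rewrite ler_piMr//; first by rewrite mulr_ge0 ?normc_ge0// ltW.
  by rewrite ler_pdivrMr// mul1r.
have [D DE] : {D : nat -> seq nat & forall n, uniq (D n) /\ forall m, (m \in D n) = A n m}.
  apply: (@choice _ _ (fun n D => uniq D /\ forall m, (m \in D) = A n m)) => n.
  have [s sE] := large_coord_seq (X n) a0.
  exists [seq m <- undup [seq absz (j - r + n%:Z)%R | j <- s] | A n m].
  split=> [|m]; first by rewrite filter_uniq// undup_uniq.
  rewrite mem_filter mem_undup; case Am : (A n m) => //=.
  by apply/mapP; exists (r + m%:Z - n%:Z); [exact/sE/Alarge|lia].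
have Atour n m : inN n -> inN m -> n != m -> A n m || A m n.
  move=> nN mN nm; rewrite /A nN mN nm eq_sym nm !andTb.
  have i1 : r + m%:Z - n%:Z = r + (m%:Z - n%:Z) by lia.
  have i2 : r + n%:Z - m%:Z = r - (m%:Z - n%:Z) by lia.
  rewrite i1 i2; have [k [kE|kE]] : exists k : nat, m%:Z - n%:Z = k%:Z \/ m%:Z - n%:Z = - k%:Z.
    by exists (absz (m%:Z - n%:Z)%R); lia.
    by rewrite kE; have [->|->] := bK k; rewrite ?orbT.
  by rewrite kE opprK; have [->|->] := bK k; rewrite ?orbT.
have few s t : uniq s -> {in s, forall n, inN n} ->
    (count (fun n => size (D n) <= t)%N s <= 2 * t + 1)%N.
  move=> us sN; rewrite -size_filter; apply: (@tournament_size _ A).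
  - exact: filter_uniq.
  - by move=> n m; rewrite !mem_filter => /andP[_ /sN nN] /andP[_ /sN mN]; exact: Atour.
  - move=> n; rewrite mem_filter => /andP[nt ns]; apply: leq_trans nt.
    rewrite -size_filter; apply: uniq_leq_size; first by rewrite !filter_uniq.
    by move=> m; rewrite mem_filter => /andP[Anm _]; have [_ ->] := DE n.
pose js n := [seq r + m%:Z - n%:Z | m <- D n].
have sjs n : size (js n) = size (D n) by rewrite size_map.
pose I n := inN n && (0 < size (D n))%N.
have [F [F0 FX]] : exists F : functional p1, sval F (lp_basis p1 r) = 0 /\
    forall n, I n -> 1 <= normc (sval F (X n)).
  apply: (@equal_weights_plank X js a r p2 a0).
  - move=> n; rewrite map_inj_uniq; first by have [] := DE n.
    by move=> m m'; lia.
  - move=> n; apply/mapP => -[m]; have [_ ->] := DE n.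
    by move=> /and3P[_ mn _]; move: mn; lia.
  - by move=> n _ /mapP[m + ->]; have [_ ->] := DE n; exact: Alarge.
  - by move=> n /andP[_]; rewrite sjs.
  - move=> L [|t].
      rewrite muln0 leqn0 -leqn0 leqNgt -has_count -all_predC; apply/allP => n.
      by rewrite mem_filter => /andP[/andP[_ nD] _]; rewrite /= sjs leqn0 -lt0n.
    apply: (@leq_trans (2 * t.+1 + 1)); last by lia.
    under eq_count do rewrite sjs.
    apply: few; first by rewrite filter_uniq ?iota_uniq.
    by move=> n; rewrite mem_filter => /andP[/andP[]].
have [c [j [e [e0 c1 hc]]]] : exists (c : R[i]) (j : int) (e : R), [/\ 0 < e, 1 <= normc c &
    forall n, inN n -> size (D n) = 0%N -> e <= normc (X n j - c * (j == r)%:R)].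
  have [[n0 [n0N n0D]]|no] := pselect (exists n0, inN n0 /\ size (D n0) = 0%N); last first.
    by exists 1, r, 1; split; rewrite ?normc1// => n nN nD; case: no; exists n.
  have uniq0 n : inN n -> size (D n) = 0%N -> n = n0.
    move=> nN nD; apply/eqP; apply: contraT => nn0.
    have un : uniq [:: n; n0] by rewrite /= inE nn0.
    have nN2 : {in [:: n; n0], forall m, inN m} by move=> m; rewrite !inE => /orP[]/eqP->.
    by have := few _ 0%N un nN2; rewrite /= nD n0D.
  have [[j hj]|same] := pselect (exists j, X n0 j != (j == r)%:R).
    exists 1, j, (normc (X n0 j - (j == r)%:R)); split; rewrite ?normc1//.
      by apply: normc_gt0; rewrite subr_eq0.
    by move=> n nN nD; rewrite (uniq0 n nN nD) mul1r.
  exists 2, r, 1; split=> //.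
    by have := normcR (2 : R); rewrite rmorph_nat => ->; rewrite ger0_norm// ler1n.
  move=> n nN nD; rewrite (uniq0 n nN nD).
  have -> : X n0 r = 1.
    by apply: contrapT => Xr; apply: same; exists r; rewrite eqxx; apply/eqP.
  rewrite eqxx mulr1 -normcN (_ : - (1 - 2) = 1) ?normc1//; ring.
have [cr crE] := coord_functional p1 r.
have [cj cjE] := coord_functional p1 j.
have me0 : 0 < Num.min 2^-1 e by rewrite lt_min half0.
have [_ [n _ <-] hz] := wx (c *: lp_basis p1 r) 3%N
  (fun i => if i is 0%N then cr else if i is 1%N then F else cj) (Num.min 2^-1 e) me0.
have z0 := hz 0%N isT; have z1 := hz 1%N isT; have z2 := hz 2%N isT.
rewrite crE lt_min in z0; rewrite cjE lt_min in z2; rewrite lt_min in z1.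
have {}z0 : normc (X n r - c) < 2^-1.
  move: z0 => /andP[+ _].
  change (normc (X n r - c * (r == r)%:R) < 2^-1 -> normc (X n r - c) < 2^-1).
  by rewrite eqxx mulr1.
have {}z2 : normc (X n j - c * (j == r)%:R) < e by move: z2 => /andP[_].
have {}z1 : normc (sval F (X n)) < 2^-1.
  have FX' : sval F (X n - c *: lp_basis p1 r) = sval F (X n).
    have -> : sval F (X n - c *: lp_basis p1 r) = sval F (X n) - c * sval F (lp_basis p1 r).
      by rewrite linearB linearZ.
    by rewrite F0 mulr0 subr0.
  by move: z1 => /andP[+ _]; rewrite FX'.
have nN : inN n.
  rewrite /inN; have h1 : normc (c - X n r) < 2^-1 by rewrite -normcN opprB.
  have h2 := ler_normcD (X n r) (c - X n r).
  rewrite addrC subrK in h2; move: (normc _) (normc (c - _)) c1 h1 h2.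
  by move: (normc c) => t u v; lra.
have [D0|Dn] := posnP (size (D n)).
  by have := le_lt_trans (hc n nN D0) z2; rewrite ltxx.
have In : I n by rewrite /I nN.
have := lt_trans (le_lt_trans (FX n In) z1) (_ : 2^-1 < 1 :> R).
by rewrite ltxx invf_lt1// ltr1n => /(_ isT).
Qed.

End weakly_hypercyclic.

(** * The two equivalences *)

Theorem corollary1p7 (R : realType) (p : R) (p1 : 1 <= p) :
  ((forall T : {linear lp p1 -> lp p1},
      bilateral_weighted_shift T -> weakly_hypercyclic T -> hypercyclic T)
   <-> p < 2) /\
  ((forall T : {linear lp p1 -> lp p1},
      bilateral_weighted_shift T -> weakly_supercyclic T -> supercyclic T)
   <-> p <= 2).
Proof.
split; split=> [h|p2 T].
- rewrite ltNge; apply/negP => p2.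
  have [T [wT bT]] := @diag_shift_exists R p p1 two_one_weights 2 (ler1n _ 2)
    (@two_one_neq0 R) (fun j => (two_one_step R j).2).
  exact: two_one_not_hypercyclic bT (h T wT (two_one_weakly_hypercyclic p2 bT)).
- exact: weakly_hypercyclic_hypercyclic.
- rewrite leNgt; apply/negP => p2.
  have unit_step j : normc (unit_weights (j + 1) : R[i]) <= 1 * normc (unit_weights j).
    by rewrite mul1r.
  have [T [wT bT]] := @diag_shift_exists R p p1 unit_weights 1 (lexx 1)
    (fun=> oner_neq0 _) unit_step.
  exact: unit_not_supercyclic bT (h T wT (unit_weakly_supercyclic p2 bT)).
- exact: weakly_supercyclic_supercyclic.
Qed.
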